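(* Fix $k>0$. For a generic one-parameter family $\Psi(x,y,\lambda)$, $\lambda\in\mathbb{R}$, of planar Helmholtz functions, the phase singularity at any point and parameter value where $\Psi=0$ is radially equivalent to the regular singularity $(x,y)\mapsto x+\mathrm{i}y$ or to the hyperbolic singularity $(x,y)\mapsto x^2-y^2+\mathrm{i}y$ at the origin.
   Context: $\mathbb{C}$ is identified with $\mathbb{R}^2$ via $u+\mathrm{i}w=(u,w)$. A planar Helmholtz function is a smooth complex valued function $\psi(x,y)$ with $\psi_{xx}+\psi_{yy}+k^2\psi=0$. A one-parameter family of them is a smooth function $\Psi(x,y,\lambda)$, defined on an open subset of $\mathbb{R}^2\times\mathbb{R}$, such that $\Psi(\cdot,\cdot,\lambda)$ is a Helmholtz function for each $\lambda$. Genericity is local: a property holds for generic families if, for every family $\Psi$ defined on a neighbourhood of a point $(x_0,y_0,\lambda_0)$, there is a smaller neighbourhood $V$ of this point such that $\Psi|_V$ can be approximated arbitrarily closely in the $C^\infty$ topology by families $\widetilde\Psi$ of Helmholtz functions on $V$ having the property (at all points of $V$). A radial transformation near $0\in\mathbb{C}$ is a local diffeomorphism $\tau:(\mathbb{C},0)\to(\mathbb{C},0)$, $\tau(u,w)=(U,W)$, sending each radial line (ray) $\{\theta=\mathrm{const.}\}$ to a radial line, where $u+\mathrm{i}w=re^{\mathrm{i}\theta}$; equivalently $U=\rho(u,w)(au+bw)$, $W=\rho(u,w)(cu+dw)$ with $\rho$ a positive function and $a,b,c,d\in\mathbb{R}$, $ad-bc\neq0$. The phase singularity of $\Psi$ at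 $(x_1,y_1,\lambda_1)$ with $\Psi(x_1,y_1,\lambda_1)=0$ is radially equivalent to $\varphi$ at the origin if there are a local diffeomorphism $\sigma$ of the plane with $\sigma(0,0)=(x_1,y_1)$ and a local radial transformation $\tau$ such that $\Psi(\sigma(x,y),\lambda_1)=\tau(\varphi(x,y))$ near the origin. *)

(* Defs.v *)
From HB Require Import structures.
From mathcomp Require Import all_boot all_order all_algebra.
From mathcomp Require Import all_classical all_reals all_analysis.
Set Implicit Arguments.
Unset Strict Implicit.
Unset Printing Implicit Defensive.
Import Order.TTheory GRing.Theory Num.Theory.
Import numFieldNormedType.Exports.
Local Open Scope classical_set_scope.
Local Open Scope ring_scope.

(* Used both for R^2 and for the complex numbers, u + iw being (u, w). *)
Notation plane R := (R * R)%type.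
(* Points (x, y, lambda), encoded as ((x, y), lambda). *)
Notation spacetime R := (plane R * R)%type.

Section Smooth.
Context {R : realType} {X Y : normedModType R}.
Implicit Types (A : set X) (f : X -> Y) (s : seq X).

Definition iter_derive s f : X -> Y := foldr (fun v h => 'D_v h) f s.

(* For A open and X finite-dimensional this is C^oo on A: the iterated
   directional derivatives of every order exist on A and, being differentiable,
   are continuous there. *)
Definition smooth_on A f : Prop :=
  forall s x, A x -> differentiable (iter_derive s f) x.

End Smooth.

(* f restricts to a diffeomorphism, with inverse g, from an open neighbourhood
   of a onto an open neighbourhood of b = f a. *)
Definition local_diffeo (R : realType) (X Y : normedModType R)
    (f : X -> Y) (a : X) (b : Y) : Prop :=
  f a = b /\
  exists (A : set X) (B : set Y) (g : Y -> X),
    [/\ open A, A a, open B & f @` A = B] /\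
    [/\ {in A, cancel f g}, smooth_on A f & smooth_on B g].

Section Helmholtz.
Context {R : realType}.
Implicit Types (k : R) (A : set (plane R)) (psi : plane R -> plane R).
Implicit Types (U V K : set (spacetime R)) (Psi : spacetime R -> plane R).

Definition e_x : plane R := (1, 0).
Definition e_y : plane R := (0, 1).

Definition helmholtz_on k A psi : Prop :=
  smooth_on A psi /\
  forall z, A z ->
    'D_e_x ('D_e_x psi) z + 'D_e_y ('D_e_y psi) z + k ^+ 2 *: psi z = 0.

Definition helmholtz_family_on k U Psi : Prop :=
  smooth_on U Psi /\
  forall l : R, helmholtz_on k [set z | U (z, l)] (fun z => Psi (z, l)).

Definition axes : seq (spacetime R) := [:: (e_x, 0); (e_y, 0); (0, 1)].

(* On an open set V, the sets of Psi' with Cinfty_close K r e Psi Psi', for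
   K a compact subset of V, r : nat and e > 0, form a basis of neighbourhoods of
   Psi for the C^oo topology (uniform convergence of the partial derivatives of
   all orders on compact subsets of V). *)
Definition Cinfty_close K (r : nat) (e : R) Psi Psi' : Prop :=
  forall s, {subset s <= axes} -> (size s <= r)%N ->
  forall p, K p -> `|iter_derive s Psi' p - iter_derive s Psi p| < e.

Definition holds_generically k
    (P : (spacetime R -> plane R) -> spacetime R -> Prop) : Prop :=
  forall U Psi p0, open U -> U p0 -> helmholtz_family_on k U Psi ->
  exists V, [/\ open V, V p0, V `<=` U &
    forall K r e, compact K -> K `<=` V -> 0 < e ->
    exists Psi', [/\ helmholtz_family_on k V Psi',
                     Cinfty_close K r e Psi Psi' &
                     forall p, V p -> P Psi' p]].

Definition is_ray (L : set (plane R)) : Prop :=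
  exists2 v : plane R, v != 0 & L = [set t *: v | t in [set t : R | 0 < t]].

(* The ball is for the sup norm on R * R; like any disk it is star-shaped, so
   it meets every ray in an initial segment of that ray. *)
Definition radial_transformation (tau : plane R -> plane R) : Prop :=
  local_diffeo tau 0 0 /\
  exists2 d : R, 0 < d &
    forall L, is_ray L ->
    exists2 L', is_ray L' & tau @` (L `&` ball (0 : plane R) d) `<=` L'.

Definition radially_equivalent_at Psi (p : spacetime R)
    (phi : plane R -> plane R) : Prop :=
  exists sigma tau : plane R -> plane R,
    [/\ local_diffeo sigma 0 p.1, radial_transformation tau &
        \forall z \near (0 : plane R), Psi (sigma z, p.2) = tau (phi z)].

Definition regular_singularity : plane R -> plane R := fun z => (z.1, z.2).

Definition hyperbolic_singularity : plane R -> plane R :=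
  fun z => (z.1 ^+ 2 - z.2 ^+ 2, z.2).

End Helmholtz.

(* Main.v *)
Require Import Defs.
From HB Require Import structures.
From mathcomp Require Import all_boot all_order all_algebra.
From mathcomp Require Import all_classical all_reals all_analysis.
From mathcomp Require Import ring lra zify.
Import Order.TTheory GRing.Theory Num.Theory.
Import numFieldNormedType.Exports.
Local Open Scope classical_set_scope.
Local Open Scope ring_scope.

(** Let [p1] and [p2] be the components of a Helmholtz function at a zero, and write
    [{f, g}] for the Jacobian determinant of two real functions.  With [J = {p1, p2}],
    call the zero degenerate if [J], [{J, p1}] and [{J, p2}] all vanish there.  A zero
    which is not degenerate has one of the two normal forms, and in a generic
    one-parameter family no zero is degenerate.

    Normal form.  If [J] does not vanish at the zero, the function is itself a local
    diffeomorphism.  Otherwise a linear change of the target, which is radial, turns the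
    function into [(f, g)] with [df = 0] and [{J, g} > 0] at the zero, now for
    [J = {f, g}].  Hence [(J, g)] are local coordinates, by [inverse_function].  If
    [F (xi, eta)] is the expression of [f] in them, then [J = F_xi * {J, g}], so that
    [F_xi] vanishes exactly where [xi] does.  Dividing twice by [xi] ([hadamard2]) gives
    [f = g ^ 2 h(g) + J ^ 2 q(J, g)], which is [fold_form].  Comparing the second
    derivatives of both sides at the zero yields [q > 0].  The Helmholtz equation says
    that the Laplacian of [f] vanishes at the zero, and this forces [h < 0].  So the
    factor [M = - h(g)] is positive near the zero, and in the coordinates
    [(x, y) = (J sqrt(M q), M g)] the map [M (f, g)] is [(x ^ 2 - y ^ 2, y)]
    ([hyperbolic_form]).  Multiplication by [M], which only depends on the target point
    [(f, g)], is undone by a radial transformation ([radial_scaling]).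

    Genericity.  At a zero, the Helmholtz equation and the symmetry of second
    derivatives determine the 2-jet by the five complex numbers
    [psi, psi_x, psi_y, psi_xx, psi_xy].  The degenerate jets are covered by a Lipschitz
    map of six bounded real parameters ([bad_jet]); with the point [(x, y, lambda)] at
    which they occur, this makes nine parameters.  On the other side, there are five
    real Helmholtz functions whose 2-jets at a given point are the unit vectors
    ([helmholtz_basis]).  Adding to the family a combination of these with complex
    coefficients gives a perturbation with ten real parameters.  Near the base point the
    coefficients can be recovered in a Lipschitz way from the jet of the perturbed
    family and the point where it is taken ([coefficient_lipschitz]).  Therefore the
    coefficients for which a degenerate zero occurs are a Lipschitz image of a
    nine-dimensional box, and they cannot fill a ten-dimensional cube, however small: a
    count of grid points shows this ([exists_not_covered]), in the role that the theorem
    of Sard usually plays.  Arbitrarily small coefficients thus remove all degenerate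
    zeros in a fixed ball ([avoid_bad_jets]), and small coefficients make the
    perturbation small with any number of derivatives. *)

Set Implicit Arguments.
Unset Strict Implicit.
Unset Printing Implicit Defensive.

(** * Smoothness as differentiability of every finite order *)

Section Differentiability.
Context {R : realType} {X Y : normedModType R}.
Implicit Types (f g : X -> Y) (L : X -> Y).

Lemma differentiable_eps f x : differentiable f x ->
  forall e, 0 < e -> \forall y \near x, `|f y - f x - 'd f x (y - x)| <= e * `|y - x|.
Proof.
move=> /diff_locallyP[_ /eqaddoP fo] e e0.
have := fo e e0; rewrite [X in _ -> X](near_shift 0) => h.
apply: filterS h => y /=; rewrite subr0 !fctE /=.
by rewrite addrK opprD addrA.
Qed.

(** The bound on [L] makes it continuous, which linearity alone does not in infinite
    dimension. *)
Lemma eps_differentiable f L x : linear L ->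
  (exists k, forall v, `|L v| <= k * `|v|) ->
  (forall e, 0 < e -> \forall y \near x, `|f y - f x - L (y - x)| <= e * `|y - x|) ->
  differentiable f x /\ forall v, 'D_v f x = L v.
Proof.
move=> linL [k Lk] fL.
pose LM := GRing.isLinear.Build _ _ _ _ _ linL.
pose LL : {linear X -> Y} := HB.pack L LM.
have cL : continuous LL.
  apply: bounded_linear_continuous; apply/linear_boundedP; near=> r => y.
  by apply: le_trans (Lk y) _; rewrite ler_wpM2r.
have fo : f \o shift x = cst (f x) + LL +o_ 0 id.
  apply/eqaddoP => e e0; have := fL e e0; rewrite (near_shift 0) => h.
  apply: filterS h => y /=.
  by rewrite subr0 !fctE /= addrK opprD addrA.
have dL := diff_unique cL fo.
have df : differentiable f x by apply/diff_locallyP; rewrite dL.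
by split=> // v; rewrite deriveE// dL.
Unshelve. all: by end_near. Qed.

Lemma diff_bound f x : differentiable f x ->
  exists2 k, 0 < k & forall v, `|'d f x v| <= k * `|v|.
Proof. by move=> df; apply: linear_lipschitz; exact: diff_continuous. Qed.

Lemma near_eq_differentiable f g x : {near x, f =1 g} ->
  differentiable f x -> differentiable g x.
Proof.
move=> fg df; have fgx : f x = g x := nbhs_singleton fg.
have [k k0 fk] := diff_bound df.
apply: (@eps_differentiable g ('d f x) x _ _ _).1; first exact: linearP.
  by exists k.
move=> e e0; have h := differentiable_eps df e0.
by apply: filterS2 fg h => y <-; rewrite -fgx.
Qed.

End Differentiability.

Section Cn.
Context {R : realType}.

(** Differentiable [n.+1] times on [A]: already [n = 0] asks for a derivative. As the
    recursion is on the order and not on a list of directions, an induction on [n] can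
    treat all functions at once. *)
Fixpoint Cn {X Y : normedModType R} (n : nat) (A : set X) (f : X -> Y) : Prop :=
  (forall x, A x -> differentiable f x) /\
  if n is m.+1 then forall v, Cn m A ('D_v f) else True.

Section General.
Context {X Y : normedModType R}.
Implicit Types (A B : set X) (f g : X -> Y).

Lemma Cn_diff n A f x : Cn n A f -> A x -> differentiable f x.
Proof. by case: n => [|n] [h _]; apply: h. Qed.

Lemma CnS n A f : Cn n.+1 A f -> Cn n A f.
Proof.
elim: n f => [|n IHn] f [fd fD]; first by split.
split=> [|v]; first exact: fd.
exact: IHn (fD v).
Qed.

Lemma Cn_derive n A f v : Cn n.+1 A f -> Cn n A ('D_v f).
Proof. by case=> _; apply. Qed.

Lemma iter_derive_rcons s v f : iter_derive (rcons s v) f = iter_derive s ('D_v f).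
Proof. by rewrite /iter_derive foldr_rcons. Qed.

Lemma smooth_onP A f : smooth_on A f <-> forall n, Cn n A f.
Proof.
split=> [sf n|Cf s x Ax].
  elim: n f sf => [|n IHn] f sf; first by split=> // x; exact: (sf [::]).
  split; first by move=> x; exact: (sf [::]).
  by move=> v; apply: IHn => s x; rewrite -iter_derive_rcons; exact: sf.
elim/last_ind: s f Cf => [|s v IHs] f Cf; first exact: Cn_diff (Cf 0) Ax.
by rewrite iter_derive_rcons; apply: IHs => n; apply: Cn_derive; exact: Cf.
Qed.

Lemma Cn_sub n A B f : A `<=` B -> Cn n B f -> Cn n A f.
Proof.
move=> AB; elim: n f => [|n IHn] f [fd fD].
  by split=> // x /AB /fd.
split=> [x /AB /fd //|v]; apply: IHn; exact: fD.
Qed.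

Lemma Cn_ext n A f g : open A -> (forall x, A x -> f x = g x) -> Cn n A f -> Cn n A g.
Proof.
move=> oA; elim: n f g => [|n IHn] f g fg [fd fD].
  split=> // x Ax; apply: near_eq_differentiable (fd x Ax).
  by apply: filterS (open_nbhs_nbhs (conj oA Ax)) => y; exact: fg.
split=> [x Ax|v].
  apply: near_eq_differentiable (fd x Ax).
  by apply: filterS (open_nbhs_nbhs (conj oA Ax)) => y; exact: fg.
apply: IHn (fD v) => x Ax; apply: near_eq_derive.
by apply: filterS (open_nbhs_nbhs (conj oA Ax)) => y; exact: fg.
Qed.

Lemma Cn_cst n A (c : Y) : Cn n A (cst c).
Proof.
elim: n c => [|n IHn] c; split=> //.
move=> v; suff -> : 'D_v (cst c : X -> Y) = cst 0 by [].
by apply/funext => x; exact: derive_cst.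
Qed.

Lemma Cn_add n A f g : open A -> Cn n A f -> Cn n A g -> Cn n A (f + g).
Proof.
move=> oA; elim: n f g => [|n IHn] f g [fd fD] [gd gD].
  by split=> // x Ax; apply: differentiableD; [exact: fd | exact: gd].
split=> [x Ax|v]; first by apply: differentiableD; [exact: fd | exact: gd].
apply: Cn_ext (IHn _ _ (fD v) (gD v)) => // x Ax.
by rewrite deriveD//; apply: diff_derivable; [exact: fd | exact: gd].
Qed.

Lemma Cn_scale n A f (c : R) : open A -> Cn n A f -> Cn n A (c \*: f).
Proof.
move=> oA; elim: n f => [|n IHn] f [fd fD].
  by split=> // x Ax; apply: differentiableZ; exact: fd.
split=> [x Ax|v]; first by apply: differentiableZ; exact: fd.
apply: Cn_ext (IHn _ (fD v)) => // x Ax.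
by rewrite deriveZ//; apply: diff_derivable; exact: fd.
Qed.

Lemma Cn_affine n A f : (forall x, differentiable f x) ->
  (forall v x y, 'D_v f x = 'D_v f y) -> Cn n A f.
Proof.
case: n => [|n] fd fD; split=> // v.
suff -> : 'D_v f = cst ('D_v f 0) by exact: Cn_cst.
by apply/funext => x; exact: fD.
Qed.

End General.

Section Scalar.
Context {X : normedModType R}.
Implicit Types (A B : set X) (f g : X -> R).

Lemma Cn_mul n A f g : open A -> Cn n A f -> Cn n A g -> Cn n A (f * g).
Proof.
move=> oA; elim: n f g => [|n IHn] f g Cf Cg.
  by split=> // x Ax; apply: differentiableM; [exact: Cn_diff Cf _ | exact: Cn_diff Cg _].
split=> [x Ax|v].
  by apply: differentiableM; [exact: Cn_diff Cf _ | exact: Cn_diff Cg _].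
have h : Cn n A (f * 'D_v g + g * 'D_v f).
  by apply: Cn_add => //; apply: IHn => //; (try exact: Cn_derive); exact: CnS.
apply: Cn_ext h => // x Ax.
by rewrite deriveM//; apply: diff_derivable; [exact: Cn_diff Cf _ | exact: Cn_diff Cg _].
Qed.

Lemma derive_comp1 (h : R -> R) h' f x v : is_derive (f x) (1 : R) h h' ->
  differentiable f x -> 'D_v (h \o f) x = h' * 'D_v f x /\ differentiable (h \o f) x.
Proof.
move=> [dh hE] df.
have dh2 : differentiable h (f x) by apply/derivable1_diffP.
have dc : differentiable (h \o f) x by apply: differentiable_comp.
split=> //; rewrite !deriveE// diff_comp// /comp.
rewrite -[X in 'd h (f x) X]mulr1 -[X in 'd h (f x) X]/( 'd f x v *: (1 : R)) linearZ /=.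
by rewrite -[X in _ *: X]deriveE// hE /GRing.scale/= mulrC.
Qed.

(** The hypothesis on [h' \o f] is one order weaker than the conclusion. For the
    inverse, the square root, the sine and the cosine, the derivative is expressed
    through functions of the same kind, so that an induction on [n] provides it. *)
Lemma Cn_comp1 n A f (h h' : R -> R) : open A ->
  (forall x, A x -> is_derive (f x) (1:R) h (h' (f x))) ->
  Cn n A f -> (if n is m.+1 then Cn m A (h' \o f) else True) -> Cn n A (h \o f).
Proof.
move=> oA hh Cf Ch.
have D x v : A x -> 'D_v (h \o f) x = h' (f x) * 'D_v f x /\ differentiable (h \o f) x.
  by move=> Ax; apply: derive_comp1; [exact: hh | exact: Cn_diff Cf _].
case: n Cf Ch => [|n] Cf Ch; first by split=> // x Ax; have [] := D x 0 Ax.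
split=> [x Ax|v]; first by have [] := D x 0 Ax.
apply: (@Cn_ext _ _ _ _ ((h' \o f) * 'D_v f)) => //.
  by move=> x Ax; have [->] := D x v Ax.
by apply: Cn_mul => //; exact: Cn_derive.
Qed.

Lemma Cn_inv n A f : open A -> (forall x, A x -> f x != 0) -> Cn n A f ->
  Cn n A (fun x => (f x)^-1).
Proof.
move=> oA f0; elim: n => [|n IHn] Cf.
  by split=> // x Ax; apply: differentiableV; [exact: Cn_diff Cf _ | exact: f0].
apply: (@Cn_comp1 _ _ f (@GRing.inv R) (fun y => - (y ^- 2))) => //.
  move=> x Ax; split; first by apply: derivableV => //; exact: f0.
  by rewrite deriveV ?derive_id ?f0 //= /GRing.scale/= mulr1.
have C1 := IHn (CnS Cf).
apply: (@Cn_ext _ _ _ _ ((-1) \*: ((fun x => (f x)^-1) * (fun x => (f x)^-1)))) => //.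
  by move=> x Ax /=; rewrite /GRing.scale/= mulN1r !fctE expr2 invfM.
by apply: Cn_scale => //; exact: Cn_mul.
Qed.

Lemma Cn_sqrt n A f : open A -> (forall x, A x -> 0 < f x) -> Cn n A f ->
  Cn n A (fun x => Num.sqrt (f x)).
Proof.
move=> oA f0 Cf.
have D x : A x -> is_derive (f x) (1:R) Num.sqrt (2 * Num.sqrt (f x))^-1.
  by move=> Ax; apply: is_derive1_sqrt; exact: f0.
elim: n Cf => [|n IHn] Cf.
  exact: (@Cn_comp1 0 _ f Num.sqrt (fun y => (2 * Num.sqrt y)^-1)).
apply: (@Cn_comp1 n.+1 _ f Num.sqrt (fun y => (2 * Num.sqrt y)^-1)) => //.
apply: (@Cn_inv _ _ (fun x => 2 * Num.sqrt (f x))) => //.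
  by move=> x Ax; rewrite mulf_neq0// gt_eqF// sqrtr_gt0 f0.
by apply: (@Cn_scale _ _ n A _ 2) => //; exact: IHn (CnS Cf).
Qed.

Lemma Cn_sin_cos n A f : open A -> Cn n A f ->
  Cn n A (fun x => sin (f x)) /\ Cn n A (fun x => cos (f x)).
Proof.
move=> oA; elim: n => [|n IHn] Cf.
  split; split=> // x Ax; have df := Cn_diff Cf Ax.
    by have [] := derive_comp1 0 (is_derive_sin (f x)) df.
  by have [] := derive_comp1 0 (is_derive_cos (f x)) df.
have [Cs Cc] := IHn (CnS Cf); split.
  by apply: (@Cn_comp1 n.+1 _ f sin cos) => // x Ax; exact: is_derive_sin.
apply: (@Cn_comp1 n.+1 _ f cos (fun y => - sin y)) => //.
apply: (@Cn_ext _ _ _ _ ((-1) \*: (fun x => sin (f x)))) => //.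
  by move=> x Ax /=; rewrite /GRing.scale/= mulN1r.
exact: Cn_scale.
Qed.

End Scalar.

Section Plane.
Context {X : normedModType R}.
Implicit Types (A : set X) (B : set (plane R)).

Lemma differentiable_fst (V W : normedModType R) (p : V * W) :
  differentiable (fst : V * W -> V) p /\ forall v, 'D_v (fst : V * W -> V) p = v.1.
Proof.
apply: eps_differentiable => //.
  exists 1 => v; rewrite mul1r; case: v => a b.
  by rewrite prod_normE/= le_max lexx.
by move=> e e0; near=> y; rewrite subrr normr0 mulr_ge0// ltW.
Unshelve. all: by end_near. Qed.

Lemma differentiable_snd (V W : normedModType R) (p : V * W) :
  differentiable (snd : V * W -> W) p /\ forall v, 'D_v (snd : V * W -> W) p = v.2.
Proof.
apply: eps_differentiable => //.
  exists 1 => v; rewrite mul1r; case: v => a b.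
  by rewrite prod_normE/= le_max lexx orbT.
by move=> e e0; near=> y; rewrite subrr normr0 mulr_ge0// ltW.
Unshelve. all: by end_near. Qed.

Lemma derive_pair (f g : X -> R) x v : differentiable f x -> differentiable g x ->
  'D_v (fun y => (f y, g y)) x = ('D_v f x, 'D_v g x) /\
  differentiable (fun y => (f y, g y)) x.
Proof.
move=> df dg; have dp := differentiable_pair df dg.
by split => //; rewrite !deriveE// diff_pair.
Qed.

Lemma Cn_pair n A (f g : X -> R) : open A -> Cn n A f -> Cn n A g ->
  Cn n A (fun y => (f y, g y)).
Proof.
move=> oA; elim: n f g => [|n IHn] f g Cf Cg.
  by split=> // x Ax; apply: differentiable_pair;
    [exact: Cn_diff Cf _ | exact: Cn_diff Cg _].
split=> [x Ax|v].
  by apply: differentiable_pair; [exact: Cn_diff Cf _ | exact: Cn_diff Cg _].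
apply: Cn_ext (IHn _ _ (Cn_derive v Cf) (Cn_derive v Cg)) => // x Ax.
by rewrite (derive_pair _ _ _).1//;  [exact: Cn_diff Cf _ | exact: Cn_diff Cg _].
Qed.

(** The chain rule through the plane. *)
Lemma derive_comp2 (F : plane R -> R) (f g : X -> R) x v :
  differentiable F (f x, g x) -> differentiable f x -> differentiable g x ->
  'D_v (fun y => F (f y, g y)) x =
    'D_v f x * 'D_e_x F (f x, g x) + 'D_v g x * 'D_e_y F (f x, g x) /\
  differentiable (fun y => F (f y, g y)) x.
Proof.
move=> dF df dg; have [pE dp] := derive_pair v df dg.
have dc : differentiable (fun y => F (f y, g y)) x by apply: (differentiable_comp dp).
split=> //; rewrite (deriveE _ dc) (diff_comp dp)//=.
rewrite -(deriveE _ dp) pE !(deriveE _ dF).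
rewrite (_ : ('D_v f x, 'D_v g x) = 'D_v f x *: e_x + 'D_v g x *: e_y).
  by rewrite linearD !linearZ.
by congr pair; rewrite /= /GRing.scale/= !(mulr0, mulr1, addr0, add0r).
Qed.

(** The derivatives of [F (f, g)] are made of [F_x (f, g)] and [F_y (f, g)], whence an
    induction on [n] for all [F]. *)
Lemma Cn_comp2 n A B (F : plane R -> R) (f g : X -> R) : open A -> open B ->
  (forall x, A x -> B (f x, g x)) -> Cn n B F -> Cn n A f -> Cn n A g ->
  Cn n A (fun y => F (f y, g y)).
Proof.
move=> oA oB AB.
have D m F' f' g' x v : A x -> B (f' x, g' x) -> Cn m B F' -> Cn m A f' -> Cn m A g' ->
  'D_v (fun y => F' (f' y, g' y)) x =
    'D_v f' x * 'D_e_x F' (f' x, g' x) + 'D_v g' x * 'D_e_y F' (f' x, g' x) /\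
  differentiable (fun y => F' (f' y, g' y)) x.
  move=> Ax Bx CF Cf Cg; apply: derive_comp2.
  - exact: Cn_diff CF _.
  - exact: Cn_diff Cf _.
  - exact: Cn_diff Cg _.
elim: n F => [|n IHn] F CF Cf Cg.
  by split=> // x Ax; have [] := D _ F f g x 0 Ax (AB x Ax) CF Cf Cg.
split=> [x Ax|v]; first by have [] := D _ F f g x 0 Ax (AB x Ax) CF Cf Cg.
have Cf1 := CnS Cf; have Cg1 := CnS Cg.
apply: (@Cn_ext _ _ _ _ ('D_v f * (fun y => 'D_e_x F (f y, g y)) +
  'D_v g * (fun y => 'D_e_y F (f y, g y)))) => //.
  by move=> x Ax; have [->] := D _ F f g x v Ax (AB x Ax) CF Cf Cg.
have Cx : Cn n A (fun y => 'D_e_x F (f y, g y)).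
  by apply: (IHn ('D_e_x F)) => //; exact: Cn_derive.
have Cy : Cn n A (fun y => 'D_e_y F (f y, g y)).
  by apply: (IHn ('D_e_y F)) => //; exact: Cn_derive.
exact: (Cn_add oA (Cn_mul oA (Cn_derive v Cf) Cx) (Cn_mul oA (Cn_derive v Cg) Cy)).
Qed.

End Plane.
End Cn.

(** * Mean value estimates *)

Section MeanValue.
Context {R : realType} {X : normedModType R}.
Implicit Types (A : set X) (f : X -> R).

Definition seg_closed A := forall x y t, A x -> A y -> 0 <= t <= 1 -> A (x + t *: (y - x)).

Lemma ball_normP (V : normedModType R) (a : V) r z : ball a r z = (`|z - a| < r) :> Prop.
Proof. by rewrite -ball_normE /= distrC. Qed.

Lemma segment_dist (a x y : X) t : 0 <= t <= 1 ->
  `|x + t *: (y - x) - a| <= (1 - t) * `|x - a| + t * `|y - a|.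
Proof.
move=> /andP[t0 t1].
have -> : x + t *: (y - x) - a = (1 - t) *: (x - a) + t *: (y - a).
  rewrite scalerBl scale1r -[RHS]addrA [- _ + _]addrC -scalerBr opprB addrA subrK.
  by rewrite addrAC.
by apply: le_trans (ler_normD _ _) _; rewrite !normrZ (ger0_norm t0) ger0_norm ?subr_ge0.
Qed.

Lemma seg_closed_ball (a : X) r : seg_closed (ball a r).
Proof.
move=> x y t; rewrite !ball_normP => xr yr t01;
  apply: le_lt_trans (segment_dist a x y t01) _.
case/andP: t01 => t0 t1; have [|] := leP `|x - a| `|y - a|; nra.
Qed.

Lemma seg_closed_cball (a : X) r : seg_closed [set z | `|z - a| <= r].
Proof.
move=> x y t /= xr yr t01; apply: le_trans (segment_dist a x y t01) _.
by case/andP: t01 => t0 t1; nra.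
Qed.

Lemma derive_segment f x h t : differentiable f (x + t *: h) ->
  is_derive t (1 : R) (fun s => f (x + s *: h)) ('D_h f (x + t *: h)).
Proof.
move=> df;
  have E : (fun s => s^-1 *: (((fun s => f (x + s *: h)) \o shift t) (s *: (1:R)) - f
    (x + t *: h)))
   = (fun s => s^-1 *: ((f \o shift (x + t *: h)) (s *: h) - f (x + t *: h))).
  apply/funext => s /=; congr (_ *: (f _ - _)).
  have -> : s *: (1 : R) = s by exact: mulr1.
  by rewrite scalerDl addrCA.
split; last by rewrite /derive E.
by rewrite /derivable E; exact: diff_derivable.
Qed.

Lemma mean_value A f C x y : seg_closed A -> A x -> A y ->
  (forall z, A z -> differentiable f z) ->
  (forall z, A z -> `|'D_(y - x) f z| <= C) -> `|f y - f x| <= C.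
Proof.
move=> sA Ax Ay df Df.
pose phi t := f (x + t *: (y - x)).
have dphi (t : R) : t \in `[0, 1] ->
  is_derive t (1:R) phi ('D_(y - x) f (x + t *: (y - x))).
  by rewrite in_itv /= => t01; apply: derive_segment; apply/df/sA.
have dphi_oo (t : R) : t \in `]0, 1[ ->
  is_derive t (1:R) phi ('D_(y - x) f (x + t *: (y - x))).
  by move=> t01; apply: dphi; exact: subset_itv_oo_cc t01.
have cphi : {within `[0, 1], continuous phi}.
  apply: continuous_in_subspaceT => t; rewrite inE /= => t01.
  by apply: differentiable_continuous; apply/derivable1_diffP; have [] := dphi t t01.
have [t t01] := MVT_segment ler01 dphi_oo cphi.
rewrite /phi scale1r scale0r addr0 subr0 mulr1 [x + _]addrC subrK => ->.
by apply/Df/sA => //; move: t01; rewrite in_itv.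
Qed.

(** The coefficients are bounded by the norm, so that a bound on finitely many
    directional derivatives bounds the differential. *)
Definition frame n (b : 'I_n -> X) := forall v, exists2 c : 'I_n -> R,
  forall i, `|c i| <= `|v| & v = \sum_i c i *: b i.

Lemma derive_frame n (b : 'I_n -> X) f x C v : frame b -> differentiable f x ->
  (forall i, `|'D_(b i) f x| <= C) -> `|'D_v f x| <= n%:R * C * `|v|.
Proof.
move=> fb df Cf; have [c cv vE] := fb v.
rewrite deriveE// {1}vE linear_sum; apply: le_trans (ler_norm_sum _ _ _) _.
rewrite -mulrA -[n in n%:R]card_ord mulr_natl -sumr_const; apply: ler_sum => i _.
rewrite linearZ normrM mulrC ler_pM//.
by rewrite -deriveE.
Qed.

Lemma lipschitz_frame n (b : 'I_n -> X) A f C x y : frame b -> seg_closed A ->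
  (forall z, A z -> differentiable f z) ->
  (forall z i, A z -> `|'D_(b i) f z| <= C) ->
  A x -> A y -> `|f y - f x| <= n%:R * C * `|y - x|.
Proof.
move=> fb sA df Cf Ax Ay; apply: (mean_value sA) => // z Az.
by apply: derive_frame fb _ _ => [|i]; [exact: df | exact: Cf].
Qed.

Lemma compact_bound (K : set X) f : compact K -> (forall x, K x -> {for x, continuous f}) ->
  exists2 B, 0 < B & forall x, K x -> `|f x| <= B.
Proof.
move=> cK cf.
have /ex_strict_bound_gt0[B B0 fB] : bounded_set (f @` K).
  apply/compact_bounded/continuous_compact => //.
  by apply: continuous_in_subspaceT => x; rewrite inE; exact: cf.
by exists B => // x Kx; apply/ltW/fB; exists x.
Qed.

Lemma near_derive_lt n (b : 'I_n -> X) (A : set X) f a e : open A -> A a -> Cn 1 A f ->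
  0 < e ->
  \forall z \near a, forall i, `|'D_(b i) f z - 'D_(b i) f a| < e.
Proof.
move=> oA Aa Cf e0.
have H i : \forall z \near a, `|'D_(b i) f z - 'D_(b i) f a| < e.
  have /differentiable_continuous := Cn_diff (Cn_derive (b i) Cf) Aa.
  by move=> /cvgrPdist_lt /(_ e e0); apply: filterS => z; rewrite distrC.
exact: filter_forall H.
Qed.

End MeanValue.

(** * The inverse function theorem in the plane *)

Section Frames.
Context {R : realType}.

Definition plane_axes (i : 'I_2) : plane R := if i == 0 then e_x else e_y.

Lemma pair_norm1 (V W : normedModType R) (v : V * W) : `|v.1| <= `|v|.
Proof. by case: v => a b; rewrite prod_normE/= le_max lexx. Qed.

Lemma pair_norm2 (V W : normedModType R) (v : V * W) : `|v.2| <= `|v|.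
Proof. by case: v => a b; rewrite prod_normE/= le_max lexx orbT. Qed.

Lemma pair_normP (V W : normedModType R) (v : V * W) c :
  (`|v| <= c) = (`|v.1| <= c) && (`|v.2| <= c).
Proof. by case: v => a b; rewrite prod_normE/= ge_max. Qed.

Lemma pairP (V W : Type) (u v : V * W) : u.1 = v.1 -> u.2 = v.2 -> u = v.
Proof. by case: u v => [a b] [c d] /= -> ->. Qed.

Lemma ball_planeE (a z : plane R) r : ball a r z = (`|z - a| < r) :> Prop.
Proof. by rewrite -ball_normE /= distrC. Qed.

Lemma frame_plane : frame plane_axes.
Proof.
move=> v; exists (fun i => if i == 0 then v.1 else v.2).
  by move=> i; case: ifP => _; [exact: pair_norm1 | exact: pair_norm2].
rewrite !big_ord_recl big_ord0 /= /plane_axes/= addr0; case: v => a b.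
by congr pair; rewrite /= /GRing.scale/= !(mulr0, mulr1, addr0, add0r).
Qed.

Lemma derive_plane (f : plane R -> R) z v : differentiable f z ->
  'D_v f z = v.1 * 'D_e_x f z + v.2 * 'D_e_y f z.
Proof.
move=> df; rewrite !deriveE// (_ : 'd f z v = 'd f z (v.1 *: e_x + v.2 *: e_y)).
  by rewrite linearD !linearZ.
congr ('d f z _); case: v => a b.
by congr pair; rewrite /= /GRing.scale/= !(mulr0, mulr1, addr0, add0r).
Qed.

Lemma compact_cball (a : plane R) r : compact [set z | `|z - a| <= r].
Proof.
have -> : [set z | `|z - a| <= r] =
  [set` `[a.1 - r, a.1 + r]] `*` [set` `[a.2 - r, a.2 + r]].
  apply/seteqP; split => z /=; rewrite pair_normP !in_itv /= !ler_distl => //.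
    by move=> /andP[].
  by move=> [-> ->].
by apply: compact_setX; exact: segment_compact.
Qed.

Lemma lin2_bound (p q : R) (v : plane R) : `|p * v.1 + q * v.2| <= (`|p| + `|q|) * `|v|.
Proof.
apply: le_trans (ler_normD _ _) _; rewrite !normrM mulrDl.
by apply: lerD; rewrite ler_wpM2l//; [exact: pair_norm1 | exact: pair_norm2].
Qed.

Lemma derive_lin3 (h k l : plane R -> R) c d v z :
  differentiable h z -> differentiable k z -> differentiable l z ->
  'D_v (h + c \*: k + d \*: l) z = 'D_v h z + c * 'D_v k z + d * 'D_v l z.
Proof.
move=> /(@diff_derivable _ _ _ _ _ v) dh /(@diff_derivable _ _ _ _ _ v) dk
  /(@diff_derivable _ _ _ _ _ v) dl.
have ck : derivable (c \*: k) z v by exact: derivableZ.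
have dl' : derivable (d \*: l) z v by exact: derivableZ.
rewrite (deriveD (derivableD dh ck) dl') (deriveD dh ck).
by rewrite (deriveZ _ dk) (deriveZ _ dl).
Qed.

Lemma Cn_fst n A : Cn n A (fst : plane R -> R).
Proof.
apply: Cn_affine => [x|v x y]; first by have [] := differentiable_fst x.
by rewrite (differentiable_fst x).2 (differentiable_fst y).2.
Qed.

Lemma Cn_snd n A : Cn n A (snd : plane R -> R).
Proof.
apply: Cn_affine => [x|v x y]; first by have [] := differentiable_snd x.
by rewrite (differentiable_snd x).2 (differentiable_snd y).2.
Qed.

Definition jac (f g : plane R -> R) (z : plane R) :=
  'D_e_x f z * 'D_e_y g z - 'D_e_y f z * 'D_e_x g z.

End Frames.

Section InverseFunction.
Context {R : realType}.

Variables (A : set (plane R)) (f g : plane R -> R) (a : plane R).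
Hypotheses (oA : open A) (Aa : A a).
Hypotheses (Cf : forall n, Cn n A f) (Cg : forall n, Cn n A g).
Hypothesis ja : jac f g a != 0.

Let F z := (f z, g z).

(** The inverse of the matrix of the differential of [(f, g)] at [z]. *)
Definition inv_differential (z v : plane R) : plane R :=
  ('D_e_y g z / jac f g z * v.1 + (- 'D_e_y f z / jac f g z) * v.2,
   - 'D_e_x g z / jac f g z * v.1 + 'D_e_x f z / jac f g z * v.2).

Lemma inv_differentialB z v w :
  inv_differential z (v - w) = inv_differential z v - inv_differential z w.
Proof. by congr pair; rewrite /=; ring. Qed.

Lemma inv_differential_bound z :
  exists2 K, 0 < K & forall v, `|inv_differential z v| <= K * `|v|.
Proof.
set p := `|'D_e_y g z / jac f g z|; set q := `|- 'D_e_y f z / jac f g z|.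
set s := `|- 'D_e_x g z / jac f g z|; set t := `|'D_e_x f z / jac f g z|.
have p0 : 0 <= p := normr_ge0 _; have q0 : 0 <= q := normr_ge0 _.
have s0 : 0 <= s := normr_ge0 _; have t0 : 0 <= t := normr_ge0 _.
exists (1 + (p + q) + (s + t)) => [|v]; first by lra.
rewrite pair_normP; apply/andP; split.
  by apply: le_trans (lin2_bound _ _ _) _; rewrite ler_wpM2r// -/p -/q; lra.
by apply: le_trans (lin2_bound _ _ _) _; rewrite ler_wpM2r// -/s -/t; lra.
Qed.

Lemma inv_differential_inj z v : jac f g z != 0 -> inv_differential z v = 0 -> v = 0.
Proof.
move=> jz [/eqP h1 /eqP h2].
have E1 : v.1 =
    'D_e_x f z * (inv_differential z v).1 + 'D_e_y f z * (inv_differential z v).2.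
  rewrite /= {h1 h2}; move: jz; rewrite /jac.
  by move: ('D_e_x f z) ('D_e_y f z) ('D_e_x g z) ('D_e_y g z) => p q s t j; field.
have E2 : v.2 =
    'D_e_x g z * (inv_differential z v).1 + 'D_e_y g z * (inv_differential z v).2.
  rewrite /= {h1 h2}; move: jz; rewrite /jac.
  by move: ('D_e_x f z) ('D_e_y f z) ('D_e_x g z) ('D_e_y g z) => p q s t j; field.
by apply: pairP; rewrite ?E1 ?E2 /= (eqP h1) (eqP h2) !mulr0 addr0.
Qed.

(** The Newton iteration for [F z = 0], with the differential frozen at [a]. *)
Definition newton_map (z : plane R) := z - inv_differential a (F z).

Let newton1 := (fst : plane R -> R) +
  (- ('D_e_y g a / jac f g a)) \*: f + ('D_e_y f a / jac f g a) \*: g.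
Let newton2 := (snd : plane R -> R) +
  ('D_e_x g a / jac f g a) \*: f + (- ('D_e_x f a / jac f g a)) \*: g.

Lemma newton_mapE z : newton_map z = (newton1 z, newton2 z).
Proof. by congr pair; rewrite /= /newton1 /newton2 !fctE /= /GRing.scale/=; ring. Qed.

Lemma Cn_newton n : Cn n A newton1 /\ Cn n A newton2.
Proof.
split; (apply: Cn_add => //; [apply: Cn_add => //|]); try exact: Cn_scale.
  exact: Cn_fst.
exact: Cn_snd.
Qed.

Lemma derive_newton i : 'D_(plane_axes i) newton1 a = 0 /\ 'D_(plane_axes i) newton2 a = 0.
Proof.
have df : differentiable f a := Cn_diff (Cf 0) Aa.
have dg : differentiable g a := Cn_diff (Cg 0) Aa.
have [d1 D1] := differentiable_fst a; have [d2 D2] := differentiable_snd a.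
have j := ja; rewrite /jac in j; rewrite /plane_axes.
split; rewrite derive_lin3// ?D1 ?D2 /jac; case: ifP => _ /=; move: j;
  move: ('D_e_x f a) ('D_e_y f a) ('D_e_x g a) ('D_e_y g a) => p q s t j; by field.
Qed.

(** The differential of the Newton map vanishes at [a], so it is small nearby. *)
Lemma newton_contraction : exists2 r, 0 < r &
  [/\ ball a r `<=` A, forall z, ball a r z -> jac f g z != 0 &
   forall x y, ball a r x -> ball a r y ->
     `|newton_map y - newton_map x| <= 2^-1 * `|y - x|].
Proof.
have [C1 C2] := Cn_newton 1.
have q0 : 0 < 4^-1 :> R by [].
have N1 := near_derive_lt plane_axes oA Aa C1 q0.
have N2 := near_derive_lt plane_axes oA Aa C2 q0.
have NA : \forall z \near a, A z by exact: open_nbhs_nbhs.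
have NJ : \forall z \near a, jac f g z != 0.
  have cj : {for a, continuous (jac f g)}.
    have h (k : plane R -> R) v : (forall n, Cn n A k) -> {for a, continuous ('D_v k)}.
      by move=> Ck; apply: differentiable_continuous;
        exact: Cn_diff (Cn_derive v (Ck 1)) Aa.
    by apply: cvgB; apply: cvgM; exact: h.
  exact: (cvgr_neq0 _ cj).
have /nbhs_ballP[r /= r0 rP] : \forall z \near a, [/\ A z, jac f g z != 0,
    forall i, `|'D_(plane_axes i) newton1 z - 'D_(plane_axes i) newton1 a| < 4^-1 &
    forall i, `|'D_(plane_axes i) newton2 z - 'D_(plane_axes i) newton2 a| < 4^-1].
  by near=> z; split; [near: z|near: z|near: z|near: z].
exists r => //; split=> [z /rP[]//|z /rP[]//|x y xr yr].
have E : 2^-1 = 2%:R * 4^-1 :> R by field.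
have sb := @seg_closed_ball _ _ a r.
have B1 : `|newton1 y - newton1 x| <= 2%:R * 4^-1 * `|y - x|.
  apply: (@lipschitz_frame R _ 2 plane_axes (ball a r) newton1 4^-1 x y frame_plane sb _ _
    xr yr).
    by move=> z /rP[Az _ _ _]; exact: Cn_diff C1 Az.
  by move=> z i /rP[_ _ h _]; move: (h i); rewrite (derive_newton i).1 subr0 => /ltW.
have B2 : `|newton2 y - newton2 x| <= 2%:R * 4^-1 * `|y - x|.
  apply: (@lipschitz_frame R _ 2 plane_axes (ball a r) newton2 4^-1 x y frame_plane sb _ _
    xr yr).
    by move=> z /rP[Az _ _ _]; exact: Cn_diff C2 Az.
  by move=> z i /rP[_ _ _ h]; move: (h i); rewrite (derive_newton i).2 subr0 => /ltW.
rewrite (newton_mapE y) (newton_mapE x) E pair_normP; apply/andP; split.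
  exact: B1.
exact: B2.
Unshelve. all: by end_near. Qed.

Section Inverse.
Variable r : R.
Hypotheses (r0 : 0 < r) (sA : ball a r `<=` A)
  (jr : forall z, ball a r z -> jac f g z != 0).
Hypothesis hP : forall x y, ball a r x -> ball a r y ->
  `|newton_map y - newton_map x| <= 2^-1 * `|y - x|.

(** The identity is the sum of the Newton map, which halves distances, and of
    [inv_differential a] applied to [F]. *)
Lemma expansion_bound x y : ball a r x -> ball a r y ->
  `|y - x| <= 2 * `|inv_differential a (F y - F x)|.
Proof.
move=> xr yr; have := hP xr yr;
  have -> : y - x = newton_map y - newton_map x + inv_differential a (F y - F x).
  by rewrite inv_differentialB /newton_map;
    move: (inv_differential _ _) (inv_differential _ _) => u w; apply: pairP => /=; ring.
move=> h; have := ler_normD (newton_map y - newton_map x) (inv_differential a (F y - F x));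
  lra.
Qed.

(** The solutions of [F z = y] are the fixed points of
    [T z = newton_map z + inv_differential a y], which halves distances and maps the
    closed ball to itself. A point of this compact ball that minimises [`|T z - z|] is
    fixed, as [T z] would do better otherwise. *)
Lemma newton_solve x0 rho y :
  0 <= rho -> [set z | `|z - x0| <= rho] `<=` ball a r ->
  2 * `|inv_differential a (y - F x0)| <= rho ->
  exists2 z, `|z - x0| <= rho & F z = y.
Proof.
move=> rho0 sub yb; set K := [set z | _] in sub *.
have Kx0 : K x0 by rewrite /K /= subrr normr0.
pose T z := newton_map z + inv_differential a y.
have TT z w : K z -> K w -> `|T w - T z| <= 2^-1 * `|w - z|.
  by move=> Kz Kw; rewrite /T opprD addrACA subrr addr0; apply: hP; exact: sub.
have TK z : K z -> K (T z).
  move=> Kz; rewrite /K /=.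
  have -> : T z - x0 = newton_map z - newton_map x0 + inv_differential a (y - F x0).
    by rewrite inv_differentialB /T /newton_map;
      move: (inv_differential _ _) (inv_differential _ _) (inv_differential _ _) => u v w;
      apply: pairP => /=; ring.
  apply: le_trans (ler_normD _ _) _; have := hP (sub _ Kx0) (sub _ Kz).
  by move: Kz; rewrite /K /=; lra.
have [z Kz zmin] : exists2 c, c \in K & forall t, t \in K -> `|T c - c| <= `|T t - t|.
  apply: (@compact_EVT_min _ _ (fun z => `|T z - z|)).
  - by exists x0.
  - exact: compact_cball.
  apply: continuous_in_subspaceT => z; rewrite inE => Kz.
  have Az := sA (sub _ Kz); have [C1 C2] := Cn_newton 0.
  have cP : {for z, continuous newton_map}.
    rewrite (_ : newton_map = fun z => (newton1 z, newton2 z)); last by apply/funext => w;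
      exact: newton_mapE.
    apply: (@cvg_pair _ _ _ (nbhs z) (nbhs (newton1 z)) (nbhs (newton2 z))).
      exact: (differentiable_continuous (Cn_diff C1 Az)).
    exact: (differentiable_continuous (Cn_diff C2 Az)).
  apply: (@cvg_norm _ _ _ (nbhs z)); apply: cvgB; last exact: cvg_id.
  by apply: cvgD => //; exact: cvg_cst.
rewrite !inE in Kz; exists z => //.
have := zmin (T z); rewrite inE => /(_ (TK _ Kz)) h1; have h2 := TT _ _ Kz (TK _ Kz).
have : `|T z - z| <= 0 by lra.
rewrite normr_le0 subr_eq0 => /eqP Tz.
have : inv_differential a (F z - y) = 0.
  rewrite inv_differentialB; move: Tz; rewrite /T /newton_map;
    move: (inv_differential _ _) (inv_differential _ _) => u v.
  by rewrite -addrA -[RHS]addr0 => /addrI; rewrite addrC -opprB => /eqP;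
    rewrite oppr_eq0 => /eqP.
by move=> /(inv_differential_inj ja) /eqP; rewrite subr_eq0 => /eqP.
Qed.

Definition Finv (y : plane R) : plane R := xget a [set z | ball a r z /\ F z = y].

Lemma FinvK z : ball a r z -> Finv (F z) = z.
Proof.
move=> Bz; rewrite /Finv; case: xgetP => [w _ [Bw FE]|/(_ z)[]//].
apply/eqP; rewrite -subr_eq0 -normr_le0.
have := expansion_bound Bz Bw; rewrite FE subrr.
by have := inv_differentialB a 0 0; rewrite !subrr => ->; rewrite normr0 mulr0.
Qed.

Lemma FinvP y : (F @` ball a r) y -> ball a r (Finv y) /\ F (Finv y) = y.
Proof. by move=> [z Bz <-]; rewrite FinvK. Qed.

Lemma open_image : open (F @` ball a r).
Proof.
rewrite openE => _ [x0 Bx0 <-].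
have [rho rho0 sub] : exists2 rho : R, 0 < rho & (forall z : plane R, `|z - x0| <= rho ->
  ball a r z).
  exists ((r - `|x0 - a|) / 2) => [|z /=]; first by move: Bx0; rewrite ball_planeE; lra.
  rewrite ball_planeE => h; have := ler_normD (z - x0) (x0 - a); rewrite addrA subrK.
  by move: Bx0; rewrite ball_planeE; lra.
have [K K0 LK] := inv_differential_bound a.
apply/nbhs_ballP; exists (rho / (2 * K)) => /=; first by rewrite divr_gt0// mulr_gt0.
move=> y; rewrite ball_planeE => yb.
have [|z zrho Fz] := @newton_solve x0 rho y (ltW rho0) sub.
  have := LK (y - F x0); move: yb; rewrite ltr_pdivlMr ?mulr_gt0//; nra.
by exists z => //; apply: sub.
Qed.

Lemma Finv_lipschitz : exists2 C, 0 < C & forall x y, ball a r x -> ball a r y ->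
  `|y - x| <= C * `|F y - F x|.
Proof.
have [K K0 LK] := inv_differential_bound a; exists (2 * K) => [|x y Bx By];
  first by rewrite mulr_gt0.
apply: le_trans (expansion_bound Bx By) _; rewrite -mulrA ler_wpM2l//; exact: LK.
Qed.

Lemma inv_differential_linear1 z : linear (fun v => (inv_differential z v).1).
Proof. by move=> c u v /=; rewrite /GRing.scale/=; ring. Qed.

Lemma inv_differential_linear2 z : linear (fun v => (inv_differential z v).2).
Proof. by move=> c u v /=; rewrite /GRing.scale/=; ring. Qed.

(** The error of the linear approximation of [F] at [z] is [o(`|x - z|)] and, as [Finv]
    is Lipschitz, it is [o(`|F x - F z|)]; the inverse differential turns it into the
    error for [Finv]. *)
Lemma Finv_eps z e : ball a r z -> 0 < e ->
  \forall y \near F z, `|Finv y - z - inv_differential z (y - F z)| <= e * `|y - F z|.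
Proof.
move=> Bz e0; have [C C0 FC] := Finv_lipschitz; have [K K0 LK] := inv_differential_bound z.
have df := Cn_diff (Cf 0) (sA Bz); have dg := Cn_diff (Cg 0) (sA Bz).
pose e' := e / (K * C); have e'0 : 0 < e' by rewrite divr_gt0// mulr_gt0.
have /nbhs_ballP[d /= d0 dP] : \forall x \near z,
   `|f x - f z - 'd f z (x - z)| <= e' * `|x - z| /\
   `|g x - g z - 'd g z (x - z)| <= e' * `|x - z|.
  exact: (filterI (differentiable_eps df e'0) (differentiable_eps dg e'0)).
have NB : \forall y \near F z, (F @` ball a r) y.
  by apply: open_nbhs_nbhs; split; [exact: open_image | exists z].
have dC : 0 < d / C by rewrite divr_gt0.
have ND : \forall y \near F z, `|y - F z| < d / C.
  by apply/nbhs_ballP; exists (d / C) => // y; rewrite ball_planeE.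
near=> y.
have [Bx Fx] : ball a r (Finv y) /\ F (Finv y) = y by apply: FinvP; near: y.
have yd : `|y - F z| < d / C by near: y.
have xy : `|Finv y - z| <= C * `|y - F z| by rewrite -{2}Fx; exact: FC.
have /dP[ef eg] : ball z d (Finv y).
  by rewrite ball_planeE; apply: le_lt_trans xy _; rewrite mulrC -ltr_pdivlMr.
set x := Finv y in Bx Fx xy ef eg *; rewrite -Fx.
have -> : x - z - inv_differential z (F x - F z) =
    - inv_differential z (f x - f z - 'd f z (x - z), g x - g z - 'd g z (x - z)).
  have Ef : 'd f z (x - z) = (x - z).1 * 'D_e_x f z + (x - z).2 * 'D_e_y f z.
    by rewrite -(deriveE (x - z) df) derive_plane.
  have Eg : 'd g z (x - z) = (x - z).1 * 'D_e_x g z + (x - z).2 * 'D_e_y g z.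
    by rewrite -(deriveE (x - z) dg) derive_plane.
  rewrite {}Ef {}Eg; move: (jr Bz); rewrite /inv_differential /jac.
  move: ('D_e_x f z) ('D_e_y f z) ('D_e_x g z) ('D_e_y g z) => p q s t j.
  by rewrite /F; move: (f x) (f z) (g x) (g z) => fx fz gx gz; apply: pairP => /=; field.
rewrite normrN; apply: le_trans (LK _) _.
have : `|(f x - f z - 'd f z (x - z), g x - g z - 'd g z (x - z))| <= e' * `|x - z|.
  by rewrite pair_normP; apply/andP; split; [exact: ef | exact: eg].
have -> : e = K * (e' * C) by rewrite /e'; field; rewrite !gt_eqF.
rewrite Fx -2!mulrA ler_pM2l// => h; apply: le_trans h _; rewrite ler_wpM2l//.
exact: ltW.
Unshelve. all: by end_near. Qed.

Lemma Finv_derive z v : ball a r z ->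
  [/\ differentiable (fst \o Finv) (F z),
      'D_v (fst \o Finv) (F z) = (inv_differential z v).1,
      differentiable (snd \o Finv) (F z) &
      'D_v (snd \o Finv) (F z) = (inv_differential z v).2].
Proof.
move=> Bz; have [K K0 LK] := inv_differential_bound z.
have [d1 D1] : differentiable (fst \o Finv) (F z) /\
    forall v, 'D_v (fst \o Finv) (F z) = (inv_differential z v).1.
  apply: (eps_differentiable (inv_differential_linear1 z)).
    by exists K => w; apply: le_trans (LK w); exact: pair_norm1.
  move=> e e0; apply: filterS (Finv_eps Bz e0) => y h; apply: le_trans h.
  rewrite /= FinvK//;
    exact: (@pair_norm1 R R R (Finv y - z - inv_differential z (y - F z))).
have [d2 D2] : differentiable (snd \o Finv) (F z) /\
    forall v, 'D_v (snd \o Finv) (F z) = (inv_differential z v).2.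
  apply: (eps_differentiable (inv_differential_linear2 z)).
    by exists K => w; apply: le_trans (LK w); exact: pair_norm2.
  move=> e e0; apply: filterS (Finv_eps Bz e0) => y h; apply: le_trans h.
  rewrite /= FinvK//;
    exact: (@pair_norm2 R R R (Finv y - z - inv_differential z (y - F z))).
by [].
Qed.

(** The derivatives of [Finv] are the entries of the inverse Jacobian matrix taken at
    [Finv], so each order of differentiability implies the next one. *)
Lemma Cn_Finv n : Cn n (F @` ball a r) (fst \o Finv) /\ Cn n (F @` ball a r) (snd \o Finv).
Proof.
have oB := open_image; have ob : open (ball a r) by exact: ball_open.
have Cjac m : Cn m (ball a r) (fun z => (jac f g z)^-1).
  apply: Cn_inv => //.
  apply: (@Cn_add _ _ _ _ _ _ (fun z => - ('D_e_y f z * 'D_e_x g z))) => //.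
    by apply: (Cn_mul ob); apply: Cn_sub sA _; exact: Cn_derive.
  apply: (@Cn_ext _ _ _ _ _ ((-1) \*: ('D_e_y f * 'D_e_x g))) => //.
    by move=> x _; rewrite /= /GRing.scale/= mulN1r.
  by apply: Cn_scale => //; apply: (Cn_mul ob); apply: Cn_sub sA _; exact: Cn_derive.
elim: n => [|n [C1 C2]].
  by split; split=> // _ [z Bz <-]; have [] := Finv_derive 0 Bz.
have Cc (h : plane R -> R) : (forall n, Cn n (ball a r) h) ->
  Cn n (F @` ball a r) (fun y => h (Finv y)).
  move=> Ch;
    apply: (@Cn_ext _ _ _ _ _ (fun y => h ((fst \o Finv) y, (snd \o Finv) y))) => //.
    by move=> y _ /=; rewrite -surjective_pairing.
  apply: (@Cn_comp2 R _ n _ _ h (fst \o Finv) (snd \o Finv) oB ob) => // y /FinvP[By _].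
  by rewrite /= -surjective_pairing.
have CD (h : plane R -> R) v : (forall n, Cn n A h) ->
  forall m, Cn m (ball a r) (fun z => 'D_v h z / jac f g z).
  by move=> Ch m; apply: (Cn_mul ob) => //; apply: Cn_sub sA _; exact: Cn_derive.
split; split=> [_ [z Bz <-]|v]; try by have [] := Finv_derive 0 Bz.
  apply: (@Cn_ext _ _ _ _ _ (fun y => v.1 * ('D_e_y g (Finv y) / jac f g (Finv y)) +
     (- v.2) * ('D_e_y f (Finv y) / jac f g (Finv y)))) => //.
    by move=> _ [z Bz <-]; have [_ -> _ _] := Finv_derive v Bz; rewrite FinvK//=; ring.
  apply: Cn_add => //; apply: Cn_scale => //.
    exact: (Cc _ (CD g e_y Cg)).
  exact: (Cc _ (CD f e_y Cf)).
apply: (@Cn_ext _ _ _ _ _ (fun y => (- v.1) * ('D_e_x g (Finv y) / jac f g (Finv y)) +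
     v.2 * ('D_e_x f (Finv y) / jac f g (Finv y)))) => //.
  by move=> _ [z Bz <-]; have [_ _ _ ->] := Finv_derive v Bz; rewrite FinvK//=; ring.
apply: Cn_add => //; apply: Cn_scale => //.
  exact: (Cc _ (CD g e_x Cg)).
exact: (Cc _ (CD f e_x Cf)).
Qed.

End Inverse.

Theorem inverse_function : local_diffeo F a (F a).
Proof.
have [r r0 [sA jr hP]] := newton_contraction.
split=> //; exists (ball a r), (F @` ball a r), (Finv r); split.
  split=> //; [exact: ball_open | exact: ballxx | exact: open_image].
split.
- by move=> z; rewrite inE; exact: FinvK.
- apply/smooth_onP => n; apply: Cn_pair; first exact: ball_open.
    exact: Cn_sub sA (Cf n).
  exact: Cn_sub sA (Cg n).
- apply/smooth_onP => n; have oB := open_image sA hP.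
  have [C1 C2] := Cn_Finv sA jr hP n.
  apply: Cn_ext (Cn_pair oB C1 C2) => // y _ /=.
  by rewrite -surjective_pairing.
Qed.

End InverseFunction.

(** * Division of smooth functions by the first coordinate *)

Section UnitIntegral.
Context {R : realType}.
Implicit Types (p q : R -> R).

Definition cont01 p := forall t, 0 <= t <= 1 -> {for t, continuous p}.
Definition int01 p : R := \int[@lebesgue_measure R]_(t in `[0, 1]) p t.

Lemma cont01_within p : cont01 p -> {within `[0, 1], continuous p}.
Proof. by move=> cp; apply: continuous_in_subspaceT => t; rewrite inE /= in_itv /=;
  exact: cp. Qed.

Lemma cont01_integrable p : cont01 p ->
  (@lebesgue_measure R).-integrable `[0, 1] (EFin \o p).
Proof.
move=> cp; apply: continuous_compact_integrable; first exact: segment_compact.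
exact: cont01_within.
Qed.

Lemma cont01_scale (c : R) p : cont01 p -> cont01 (fun t => c * p t).
Proof. by move=> cp t t01; apply: cvgM; [exact: cvg_cst | exact: cp]. Qed.

Lemma cont01_add p q : cont01 p -> cont01 q -> cont01 (fun t => p t + q t).
Proof. by move=> cp cq t t01; apply: cvgD; [exact: cp | exact: cq]. Qed.

Lemma cont01_sub p q : cont01 p -> cont01 q -> cont01 (fun t => p t - q t).
Proof. by move=> cp cq t t01; apply: cvgB; [exact: cp | exact: cq]. Qed.

Lemma int01_scale c p : cont01 p -> int01 (fun t => c * p t) = c * int01 p.
Proof. by move=> cp; apply: RintegralZl => //; exact: cont01_integrable. Qed.

Lemma int01_add p q : cont01 p -> cont01 q ->
  int01 (fun t => p t + q t) = int01 p + int01 q.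
Proof. by move=> cp cq; apply: RintegralD => //; exact: cont01_integrable. Qed.

Lemma int01_sub p q : cont01 p -> cont01 q ->
  int01 (fun t => p t - q t) = int01 p - int01 q.
Proof. by move=> cp cq; apply: RintegralB => //; exact: cont01_integrable. Qed.

Lemma int01_bound p B : cont01 p -> (forall t, 0 <= t <= 1 -> `|p t| <= B) ->
  `|int01 p| <= B.
Proof.
move=> cp pB; apply: le_trans (le_normr_Rintegral _ (cont01_integrable cp)) _ => //.
have -> : B = int01 (cst B).
  rewrite /int01 Rintegral_cst//; have := @lebesgue_measure_itv R `[0, 1];
    rewrite /= lte_fin ltr01 oppr0 => ->.
  by rewrite /= ?oppr0 ?addr0 ?adde0 /= mulr1.
apply: le_Rintegral => //.
- by apply: cont01_integrable => t t01; apply: (@cvg_norm _ _ _ (nbhs t)); exact: cp.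
- by apply: cont01_integrable => t t01; exact: cvg_cst.
Qed.

Lemma int01_derive (F p : R -> R) :
  (forall t : R, 0 <= t <= 1 -> is_derive t (1 : R) F (p t)) ->
  cont01 p -> int01 p = F 1 - F 0.
Proof.
move=> dF cp; rewrite /int01 /Rintegral.
have cF (t : R) : 0 <= t <= 1 -> {for t, continuous F}.
  by move=> /dF[d _]; apply: differentiable_continuous; exact/derivable1_diffP.
rewrite (@continuous_FTC2 _ p F 0 1 ltr01)//.
- exact: cont01_within.
- split.
  + by move=> t /subset_itv_oo_cc; rewrite in_itv /= => /dF[].
  + by apply: cvg_at_right_filter; apply: cF; rewrite lexx ler01.
  + by apply: cvg_at_left_filter; apply: cF; rewrite lexx ler01.
by move=> t /subset_itv_oo_cc; rewrite in_itv /= => /dF[_ <-]; rewrite derive1E.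
Qed.

End UnitIntegral.

Section Average.
Context {R : realType} (d : R).
Implicit Types (f g : plane R -> R) (z w : plane R).
Let A := ball (0 : plane R) d.

(** The integral over [t] in [0, 1] of [t ^ j * g (t x, y)]. The weights [t ^ j] make
    this class of functions stable under differentiation. *)
Definition avg j g z : R := int01 (fun t => t ^+ j * g (t * z.1, z.2)).

Lemma shrink_norm (t : R) z : 0 <= t <= 1 -> `|(t * z.1, z.2)| <= `|z|.
Proof.
move=> /andP[t0 t1]; rewrite pair_normP; apply/andP; split=> /=; last exact: pair_norm2.
rewrite normrM (ger0_norm t0); apply: le_trans (pair_norm1 z).
by rewrite ler_piMl.
Qed.

Lemma shrink_ball (t : R) z : 0 <= t <= 1 -> A z -> A (t * z.1, z.2).
Proof. by rewrite /A !ball_planeE !subr0 => t01 zd; apply: le_lt_trans zd;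
  exact: shrink_norm. Qed.

Lemma derive_shrink f z (t : R) : A z -> 0 <= t <= 1 -> Cn 0 A f ->
  is_derive t (1 : R) (fun s => f (s * z.1, z.2)) (z.1 * 'D_e_x f (t * z.1, z.2)).
Proof.
move=> Az t01 Cf; have E s : (s * z.1, z.2) = (0, z.2) + s *: (z.1, 0) :> plane R.
  by apply: pairP; rewrite /= /GRing.scale/=; ring.
have df : differentiable f (t * z.1, z.2) := Cn_diff Cf (shrink_ball t01 Az).
have -> : (fun s => f (s * z.1, z.2)) = (fun s => f ((0, z.2) + s *: (z.1, 0))).
  by apply/funext => s; rewrite E.
have -> : z.1 * 'D_e_x f (t * z.1, z.2) = 'D_((z.1, 0)) f ((0, z.2) + t *: (z.1, 0)).
  by rewrite -E [RHS]derive_plane//= mul0r addr0.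
by apply: derive_segment; rewrite -E.
Qed.

Lemma cont01_avg j g z : A z -> Cn 0 A g -> cont01 (fun t => t ^+ j * g (t * z.1, z.2)).
Proof.
move=> Az Cg t t01; apply: cvgM; first exact: exprn_continuous.
have [h _] := derive_shrink Az t01 Cg.
exact: (differentiable_continuous ((derivable1_diffP _ _).1 h)).
Qed.

(** The first order Taylor expansion with an error that is uniform in [u]; this
    uniformity permits differentiation under the integral sign. *)
Lemma quad_bound (K : set (plane R)) g C u v : seg_closed K ->
  (forall z, K z -> differentiable g z) ->
  (forall z i, K z -> differentiable ('D_(plane_axes i) g) z) ->
  (forall z i j, K z -> `|'D_(plane_axes i) ('D_(plane_axes j) g) z| <= C) ->
  K u -> K v -> 0 <= C ->
  `|g v - g u - ((v - u).1 * 'D_e_x g u + (v - u).2 * 'D_e_y g u)| <= 4 * C * `|v - u| ^+ 2.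
Proof.
move=> sK dg ddg DDg Ku Kv C0; set h := v - u.
pose K' := K `&` [set z | `|z - u| <= `|h|].
have sK' : seg_closed K'.
  move=> x y t [Kx xu] [Ky yu] t01; split; first exact: sK.
  exact: seg_closed_cball.
pose a := 'D_e_x g u; pose b := 'D_e_y g u.
pose g' := g + (- a) \*: (fst : plane R -> R) + (- b) \*: (snd : plane R -> R).
have D z w : K z -> differentiable g' z /\ 'D_w g' z = 'D_w g z - a * w.1 - b * w.2.
  move=> Kz; have [d1 D1] := differentiable_fst z; have [d2 D2] := differentiable_snd z.
  split; last by rewrite (derive_lin3 _ _ _ (dg z Kz) d1 d2) D1 D2 !mulNr.
  apply: differentiableD; last exact: differentiableZ.
  by apply: differentiableD; [exact: (dg z Kz)|exact: differentiableZ].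
have -> : g v - g u - (h.1 * a + h.2 * b) = g' v - g' u.
  by rewrite /g' !fctE /= /GRing.scale/= /h /=; ring.
apply: (@mean_value R _ K' g' (4 * C * `|h| ^+ 2) u v sK').
- by split; [exact: Ku | rewrite /= subrr normr0].
- by split; [exact: Kv | rewrite /= lexx].
- by move=> z [Kz _]; have [] := D z 0 Kz.
move=> z [Kz zu]; have [_ ->] := D z (v - u) Kz; rewrite derive_plane; last exact: dg.
have L i : `|'D_(plane_axes i) g z - 'D_(plane_axes i) g u| <= 2 * C * `|h|.
  apply: le_trans (@lipschitz_frame R _ 2 plane_axes K ('D_(plane_axes i) g) C u z
    frame_plane sK _ _ Ku Kz) _.
  - by move=> w Kw; exact: ddg.
  - by move=> w j Kw; apply: DDg.
  by rewrite ler_wpM2l// mulr_ge0.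
have Lx : `|'D_e_x g z - a| <= 2 * C * `|h| by exact: (L 0).
have Ly : `|'D_e_y g z - b| <= 2 * C * `|h| by exact: (L 1).
have -> : (v - u).1 * 'D_e_x g z + (v - u).2 * 'D_e_y g z - a * (v - u).1 - b * (v - u).2 =
  ('D_e_x g z - a) * h.1 + ('D_e_y g z - b) * h.2.
  by rewrite /h; move: ('D_e_x g z) ('D_e_y g z) => p q; ring.
apply: le_trans (lin2_bound _ _ _) _.
rewrite (_ : 4 * C * `|h| ^+ 2 = (2 * C * `|h| + 2 * C * `|h|) * `|h|); last by ring.
by apply: ler_wpM2r; [exact: normr_ge0 | exact: lerD].
Qed.

(** The error of the linear approximation of [avg j g] is the integral of the errors for
    [g] at the points [(t x, y)], which [quad_bound] controls uniformly in [t]. *)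
Lemma derive_avg j g z v : (forall n, Cn n A g) -> A z ->
  differentiable (avg j g) z /\
  'D_v (avg j g) z = v.1 * avg j.+1 ('D_e_x g) z + v.2 * avg j ('D_e_y g) z.
Proof.
move=> Cg Az.
pose p := avg j.+1 ('D_e_x g) z; pose q := avg j ('D_e_y g) z.
suff [dd DD] : differentiable (avg j g) z /\ forall v, 'D_v (avg j g) z = p * v.1 + q * v.2.
  split; first exact: dd.
  rewrite (DD v) -/p -/q; clearbody p q.
  by rewrite (mulrC v.1) (mulrC v.2).
have zd : `|z| < d by move: Az; rewrite /A ball_planeE subr0.
pose rho := (`|z| + d) / 2.
pose K := [set w : plane R | `|w - 0| <= rho].
have KA : K `<=` A by move=> w; rewrite /K /A /= ball_planeE /rho => h;
  apply: le_lt_trans h _; lra.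
have [C C0 HC] : exists2 C, 0 < C &
    forall w, K w -> forall i k, `|'D_(plane_axes i) ('D_(plane_axes k) g) w| <= C.
  have B i k : exists2 C, 0 < C & forall w, K w ->
    `|'D_(plane_axes i) ('D_(plane_axes k) g) w| <= C.
    apply: compact_bound; first exact: compact_cball.
    move=> w /KA Aw; apply: differentiable_continuous.
    by apply: Cn_diff Aw; apply: (Cn_derive _ (Cn_derive _ (Cg 2))).
  have [C0 c0 h0] := B 0 0; have [C1 c1 h1] := B 0 1; have [C2 c2 h2] := B 1 0;
    have [C3 c3 h3] := B 1 1.
  exists (C0 + C1 + C2 + C3) => [|w Kw i k]; first by lra.
  have I2 (l : 'I_2) : l = 0 \/ l = 1.
    by case: l => [[|[|//]] l2]; [left|right]; exact: val_inj.
  by case: (I2 i) => ->; case: (I2 k) => ->;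
    [apply: le_trans (h0 w Kw) _|apply: le_trans (h1 w Kw) _|
     apply: le_trans (h2 w Kw) _|apply: le_trans (h3 w Kw) _]; lra.
have C1 : 0 <= C := ltW C0.
have Q (t : R) w : 0 <= t <= 1 -> K w ->
   `|g (t * w.1, w.2) - g (t * z.1, z.2) -
     (t * (w - z).1 * 'D_e_x g (t * z.1, z.2) + (w - z).2 * 'D_e_y g (t * z.1, z.2))| <=
   4 * C * `|w - z| ^+ 2.
  move=> t01 Kw.
  have Ks u : K u -> K (t * u.1, u.2).
    by rewrite /K /= !subr0 => h; apply: le_trans (shrink_norm u t01) h.
  have Kz : K z by rewrite /K /= subr0 /rho; lra.
  have := @quad_bound K g C (t * z.1, z.2) (t * w.1, w.2).
  rewrite (_ : (t * w.1, w.2) - (t * z.1, z.2) = (t * (w - z).1, (w - z).2)); last first.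
    by apply: pairP => //=; ring.
  move=> h; apply: le_trans (h _ _ _ _ (Ks _ Kz) (Ks _ Kw) C1) _.
  - exact: seg_closed_cball.
  - by move=> x /KA; apply: Cn_diff (Cg 0).
  - by move=> x i /KA; apply: Cn_diff (Cn_derive _ (Cg 1)).
  - by move=> x i k Kx; apply: HC.
  rewrite ler_wpM2l ?mulr_ge0// lerXn2r ?nnegrE//; exact: shrink_norm.
have Ex : Cn 0 A ('D_e_x g) := Cn_derive _ (Cg 1).
have Ey : Cn 0 A ('D_e_y g) := Cn_derive _ (Cg 1).
have c3 := cont01_avg (j := j.+1) Az Ex; have c4 := cont01_avg (j := j) Az Ey.
have Ep h : p * h = int01 (fun t => h * (t ^+ j.+1 * 'D_e_x g (t * z.1, z.2))).
  exact: (etrans (mulrC p h) (esym (@int01_scale R h _ c3))).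
have Eq h : q * h = int01 (fun t => h * (t ^+ j * 'D_e_y g (t * z.1, z.2))).
  exact: (etrans (mulrC q h) (esym (@int01_scale R h _ c4))).
clearbody p q.
apply: eps_differentiable.
- by move=> c x y /=; rewrite /GRing.scale/=; ring.
- by exists (`|p| + `|q|) => x; exact: lin2_bound.
move=> e e0.
have e1 : 0 < Num.min (e / (4 * C)) ((d - `|z|) / 2).
  rewrite lt_min; apply/andP; split; apply: divr_gt0 => //; first exact: mulr_gt0.
  by rewrite subr_gt0.
apply/nbhs_ballP; exists (Num.min (e / (4 * C)) ((d - `|z|) / 2)) => // w.
rewrite ball_planeE lt_min => /andP[we wz].
have Kw : K w.
  rewrite /K /= subr0 /rho -(subrK z w); apply: le_trans (ler_normD _ _) _; lra.
have Aw := KA _ Kw.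
have c1 := cont01_avg (j := j) Aw (Cg 0); have c2 := cont01_avg (j := j) Az (Cg 0).
have c5 := cont01_scale (c := (w - z).1) c3; have c6 := cont01_scale (c := (w - z).2) c4.
rewrite Ep Eq; have c7 := cont01_sub c1 c2; have c8 := cont01_add c5 c6.
have E1 : avg j g w - avg j g z =
  int01 (fun t => t ^+ j * g (t * w.1, w.2) - t ^+ j * g (t * z.1, z.2)).
  by rewrite (int01_sub c1 c2).
rewrite E1 -(int01_add c5 c6) -(int01_sub c7 c8).
apply: (@le_trans _ _ (4 * C * `|w - z| ^+ 2)); last first.
  rewrite expr2 mulrA ler_wpM2r//; move: we; rewrite ltr_pdivlMr ?mulr_gt0//; nra.
apply: int01_bound; first exact: cont01_sub.
move=> t t01; apply: le_trans (Q t w t01 Kw).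
set X := (X in _ <= `|X|).
rewrite (_ : _ - _ = t ^+ j * X); last first.
  by rewrite /X exprSr; ring.
rewrite normrM ler_piMl// normrX exprn_ile1// ger0_norm; by case/andP: t01.
Qed.

Lemma Cn_avg n j g : (forall n, Cn n A g) -> Cn n A (avg j g).
Proof.
have oA : open A by exact: ball_open.
elim: n j g => [|n IHn] j g Cg.
  by split=> // z Az; have [] := derive_avg j 0 Cg Az.
split=> [z Az|v]; first by have [] := derive_avg j 0 Cg Az.
apply: (@Cn_ext _ _ _ _ _
  (fun z => v.1 * avg j.+1 ('D_e_x g) z + v.2 * avg j ('D_e_y g) z)) => //.
  by move=> z Az; have [_ ->] := derive_avg j v Cg Az.
by apply: Cn_add => //; apply: Cn_scale => //; apply: IHn => m; exact: Cn_derive.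
Qed.

(** The fundamental theorem of calculus on the horizontal segment from the axis to [z]. *)
Lemma avg_factor f z : Cn 1 A f -> A z -> (f (0, z.2) = 0) ->
  f z = z.1 * avg 0 ('D_e_x f) z.
Proof.
move=> Cf Az f0; have Ex : Cn 0 A ('D_e_x f) := Cn_derive _ Cf.
have c := cont01_avg (j := 0) Az Ex.
rewrite /avg -(int01_scale _ c).
have dF (t : R) : 0 <= t <= 1 ->
    is_derive t (1 : R) (fun s => f (s * z.1, z.2))
      (z.1 * (t ^+ 0 * 'D_e_x f (t * z.1, z.2))).
  by move=> t01; rewrite expr0 mul1r; apply: derive_shrink => //; exact: CnS.
rewrite (int01_derive dF (cont01_scale c)).
by rewrite mul1r mul0r f0 subr0 -surjective_pairing.
Qed.

(** The first quotient is [avg 0] of [f_x] and vanishes on the axis because [f_x] does,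
    so it can be divided once more. *)
Lemma hadamard2 f : (forall n, Cn n A f) ->
  (forall z, A z -> f (0, z.2) = 0) -> (forall z, A z -> 'D_e_x f (0, z.2) = 0) ->
  exists2 q, forall n, Cn n A q & forall z, A z -> f z = z.1 ^+ 2 * q z.
Proof.
move=> Cf f0 Df0; pose q1 := avg 0 ('D_e_x f).
have C1 n : Cn n A q1 by apply: Cn_avg => m; exact: Cn_derive.
exists (avg 0 ('D_e_x q1)); first by move=> n; apply: Cn_avg => m; exact: Cn_derive.
move=> z Az; rewrite (avg_factor (Cf 1) Az (f0 z Az)) -/q1.
rewrite (avg_factor (C1 1) Az) ?expr2 ?mulrA//.
rewrite /q1 /avg /= (_ : (fun t => _) = fun t => 0 * t).
  by rewrite (int01_scale 0 (p := id)) ?mul0r// => t _; exact: cvg_id.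
by apply/funext => t; rewrite mulr0 Df0// mulr0 mul0r.
Qed.

End Average.

(** * Components, local diffeomorphisms and Jacobians *)

Section Components.
Context {R : realType} {X : normedModType R}.

Lemma derive_components (h : X -> plane R) x : differentiable h x ->
  [/\ differentiable (fst \o h) x, differentiable (snd \o h) x &
      forall v, 'D_v (fst \o h) x = ('D_v h x).1 /\ 'D_v (snd \o h) x = ('D_v h x).2].
Proof.
move=> dh; have [d1 D1] := differentiable_fst (h x);
  have [d2 D2] := differentiable_snd (h x).
have dc1 : differentiable (fst \o h) x by apply: differentiable_comp.
have dc2 : differentiable (snd \o h) x by apply: differentiable_comp.
split=> // v;
  rewrite (deriveE v dc1) (deriveE v dc2) (diff_comp dh d1) (diff_comp dh d2) /=.
by rewrite -(deriveE _ d1) -(deriveE _ d2) D1 D2 (deriveE v dh).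
Qed.

Lemma Cn_components n (C : set X) (h : X -> plane R) : open C -> Cn n C h ->
  Cn n C (fst \o h) /\ Cn n C (snd \o h).
Proof.
move=> oC; elim: n h => [|n IHn] h [dh Dh].
  by split; split=> // x Cx; have [] := derive_components (dh x Cx).
split; split=> [x Cx|v]; try by have [] := derive_components (dh x Cx).
  by apply: Cn_ext (IHn _ (Dh v)).1 => // x Cx;
    have [_ _ /(_ v)[->]] := derive_components (dh x Cx).
by apply: Cn_ext (IHn _ (Dh v)).2 => // x Cx;
  have [_ _ /(_ v)[_ ->]] := derive_components (dh x Cx).
Qed.

End Components.

Section LocalDiffeo.
Context {R : realType}.

Lemma local_diffeo_inv (f : plane R -> plane R) a b : local_diffeo f a b ->
  exists g, [/\ local_diffeo g b a, {for b, continuous g}, \forall y \near b, f (g y) = y,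
     \forall x \near a, g (f x) = x &
     exists2 d, 0 < d & (forall n, Cn n (ball b d) (fst \o g)) /\
       (forall n, Cn n (ball b d) (snd \o g))].
Proof.
move=> [fab [A [B [g [[oA Aa oB AB] [gK sf sg]]]]]]; exists g.
have fK y : B y -> A (g y) /\ f (g y) = y.
  by rewrite -AB => -[x Ax <-]; rewrite gK ?inE.
have Bb : B b by rewrite -AB; exists a.
split.
- split; first by rewrite -fab gK ?inE.
  exists B, A, f; split; split=> //.
    apply/seteqP; split=> [_ [y By <-]|x Ax]; first by have [] := fK y By.
    by exists (f x); [rewrite -AB; exists x | rewrite gK ?inE].
  by move=> y; rewrite inE => /fK[].
- by apply: differentiable_continuous; exact: (sg [::] b Bb).
- by apply: filterS (open_nbhs_nbhs (conj oB Bb)) => y /fK[].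
- by apply: filterS (open_nbhs_nbhs (conj oA Aa)) => x Ax; rewrite gK ?inE.
have /nbhs_ballP[d d0 dB] := open_nbhs_nbhs (conj oB Bb).
exists d => //; have Cg n : Cn n (ball b d) g by apply: Cn_sub dB _;
  exact: ((smooth_onP _ _).1 sg n).
have ob : open (ball b d) by exact: ball_open.
by split=> n; have [] := Cn_components ob (Cg n).
Qed.

Lemma smooth_id (A : set (plane R)) : smooth_on A (id : plane R -> plane R).
Proof.
apply/smooth_onP => n; apply: Cn_affine => [x|v x y]; first exact: ex_diff.
by rewrite (derive_id x v) (derive_id y v).
Qed.

Lemma local_diffeo_id (a : plane R) : local_diffeo id a a.
Proof.
split=> //; exists setT, setT, id; split; split=> //.
- exact: openT.
- exact: openT.
- by rewrite image_id.
- exact: smooth_id.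
- exact: smooth_id.
Qed.

Lemma radial_id : radial_transformation (id : plane R -> plane R).
Proof.
split; first exact: local_diffeo_id.
exists 1 => // L rL; exists L => //.
by rewrite image_id => z [].
Qed.

Lemma derive_mul0 (a c : plane R -> R) v z : differentiable a z -> differentiable c z ->
  a z = 0 ->
  'D_v (a * c) z = 'D_v a z * c z.
Proof.
move=> da dc az; rewrite deriveM; [|exact: diff_derivable|exact: diff_derivable].
by rewrite az scale0r add0r mulrC.
Qed.

(** At a zero of [a], only the term in which both factors [a] are differentiated
    survives. *)
Lemma derive2_sqr (N : set (plane R)) (a b : plane R -> R) u v z : open N -> N z ->
  Cn 1 N a -> Cn 1 N b -> a z = 0 ->
  'D_u ('D_v (fun x => a x ^+ 2 * b x)) z = 2 * ('D_u a z * 'D_v a z * b z).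
Proof.
move=> oN Nz Ca Cb az.
pose c := 2 \*: ('D_v a * b) + a * 'D_v b.
have da x : N x -> differentiable a x := Cn_diff Ca (x := x).
have db x : N x -> differentiable b x := Cn_diff Cb (x := x).
have E x : N x -> 'D_v (fun x => a x ^+ 2 * b x) x = (a * c) x.
  move=> Nx; have -> : (fun x => a x ^+ 2 * b x) = a * (a * b).
    by apply/funext => y; rewrite expr2 -mulrA.
  have ax : derivable a x v by apply: diff_derivable; exact: da.
  have bx : derivable b x v by apply: diff_derivable; exact: db.
  rewrite (deriveM ax (derivableM ax bx)) (deriveM ax bx).
  by rewrite /c !fctE /= /GRing.scale/=; ring.
have Cc : differentiable c z.
  have Dva : differentiable ('D_v a) z by exact: Cn_diff (Cn_derive v Ca) Nz.
  have Dvb : differentiable ('D_v b) z by exact: Cn_diff (Cn_derive v Cb) Nz.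
  apply: differentiableD; first by apply: differentiableZ; apply: differentiableM => //;
    exact: db.
  by apply: differentiableM => //; exact: da.
have -> : 'D_u ('D_v (fun x => a x ^+ 2 * b x)) z = 'D_u (a * c) z.
  by apply: near_eq_derive; apply: filterS (open_nbhs_nbhs (conj oN Nz)) => x; exact: E.
rewrite derive_mul0//; last exact: da.
by rewrite /c !fctE /= /GRing.scale/= az mul0r addr0; ring.
Qed.

Lemma derive_jac (N : set (plane R)) (f g : plane R -> R) u z :
  N z -> Cn 1 N f -> Cn 1 N g ->
  'D_u (jac f g) z = 'D_u ('D_e_x f) z * 'D_e_y g z + 'D_e_x f z * 'D_u ('D_e_y g) z
     - ('D_u ('D_e_y f) z * 'D_e_x g z + 'D_e_y f z * 'D_u ('D_e_x g) z).
Proof.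
move=> Nz Cf Cg.
have d (k : plane R -> R) v : Cn 1 N k -> derivable ('D_v k) z u.
  by move=> Ck; apply: diff_derivable; exact: Cn_diff (Cn_derive v Ck) Nz.
have -> : jac f g = 'D_e_x f * 'D_e_y g - 'D_e_y f * 'D_e_x g by [].
have dfx := d f e_x Cf; have dfy := d f e_y Cf; have dgx := d g e_x Cg;
  have dgy := d g e_y Cg.
rewrite (deriveB (derivableM dfx dgy) (derivableM dfy dgx)) (deriveM dfx dgy)
  (deriveM dfy dgx).
rewrite /GRing.scale /=.
move: ('D_u ('D_e_x f) z) ('D_u ('D_e_y f) z) ('D_u ('D_e_x g) z) ('D_u ('D_e_y g) z).
by move: ('D_e_x f z) ('D_e_y f z) ('D_e_x g z) ('D_e_y g z) => *; ring.
Qed.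

Lemma Cn_jac (N : set (plane R)) f g n : open N -> (forall n, Cn n N f) ->
  (forall n, Cn n N g) -> Cn n N (jac f g).
Proof.
move=> oN Cf Cg; apply: (@Cn_add _ _ _ _ _ _ (fun z => - ('D_e_y f z * 'D_e_x g z))) => //.
  by apply: (Cn_mul oN); exact: Cn_derive.
apply: (@Cn_ext _ _ _ _ _ ((-1) \*: ('D_e_y f * 'D_e_x g))) => //.
  by move=> x _; rewrite /= /GRing.scale/= mulN1r.
by apply: Cn_scale => //; apply: (Cn_mul oN); exact: Cn_derive.
Qed.

End LocalDiffeo.

(** * Fold and hyperbolic normal forms *)

Section NormalForm.
Context {R : realType}.
Variables (N : set (plane R)) (f g : plane R -> R) (z1 : plane R).
Hypotheses (oN : open N) (Nz : N z1).
Hypotheses (Cf : forall n, Cn n N f) (Cg : forall n, Cn n N g).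
Hypotheses (f0 : f z1 = 0) (g0 : g z1 = 0).
Hypotheses (fx0 : 'D_e_x f z1 = 0) (fy0 : 'D_e_y f z1 = 0).

Let J := jac f g.
Hypothesis J0 : 0 < jac J g z1.

Let Jz1 : J z1 = 0.
Proof. by rewrite /J /jac fx0 fy0 !mul0r subrr. Qed.

Let CJ n : Cn n N J.
Proof. exact: Cn_jac. Qed.

Lemma near_comp (G : plane R -> plane R) (P : plane R -> Prop) y : {for y, continuous G} ->
  (\forall x \near G y, P x) -> \forall x \near y, P (G x).
Proof. by move=> cG nP; exact: (cG _ nP). Qed.

(** The pair [(J, g)] vanishes at [z1] and has there a nonzero Jacobian, so it is a
    system of coordinates, with inverse [Gi]. *)
Lemma fold_coordinates : exists Gi : plane R -> plane R, exists2 d, 0 < d &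
  [/\ Gi 0 = z1, forall n, Cn n (ball 0 d) (fst \o Gi),
    forall n, Cn n (ball 0 d) (snd \o Gi),
     forall y, ball 0 d y -> [/\ N (Gi y), jac J g (Gi y) != 0 & (J (Gi y), g (Gi y)) = y] &
     \forall x \near z1, Gi (J x, g x) = x].
Proof.
have jne : jac J g z1 != 0 by rewrite gt_eqF.
have := inverse_function oN Nz CJ Cg jne; rewrite Jz1 g0 -[(0, 0)]/(0 : plane R).
move=> /local_diffeo_inv[Gi [[G0 _] cG TG GT [d1 d10 [C1 C2]]]].
exists Gi.
have NN : \forall y \near (0 : plane R), N (Gi y).
  by apply: near_comp cG _; rewrite G0; exact: open_nbhs_nbhs.
have NJ : \forall y \near (0 : plane R), jac J g (Gi y) != 0.
  apply: (@near_comp _ (fun x => jac J g x != 0) _ cG); rewrite G0.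
  have cj : {for z1, continuous (jac J g)}.
    by apply: differentiable_continuous; exact: (Cn_diff (Cn_jac 0 oN CJ Cg) Nz).
  exact: (cvgr_neq0 _ cj).
have ND : \forall y \near (0 : plane R), ball 0 d1 y by exact: nbhsx_ballx.
have /nbhs_ballP[d /= d0 dP] : \forall y \near (0 : plane R),
    (N (Gi y) /\ jac J g (Gi y) != 0) /\ ((J (Gi y), g (Gi y)) = y /\ ball 0 d1 y).
  exact: (filterI (filterI NN NJ) (filterI TG ND)).
exists d => //; split=> //.
- by move=> n; apply: Cn_sub (C1 n) => y /dP[_ []].
- by move=> n; apply: Cn_sub (C2 n) => y /dP[_ []].
- by move=> y /dP[[? ?] [? _]].
Qed.

(** Let [F] be [f] in the coordinates [(J, g)]. The identity [J = F_xi * {J, g}] shows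
    that [F_xi] vanishes on the axis [J = 0], so that [F] minus its restriction to this
    axis is divisible by [J ^ 2]. The restriction is divisible by [g ^ 2], because [f]
    and [df] vanish at [z1]. *)
Lemma fold_form : exists2 d, 0 < d & exists q h : plane R -> R,
  [/\ forall n, Cn n (ball 0 d) q, forall n, Cn n (ball 0 d) h &
   \forall x \near z1, f x = g x ^+ 2 * h (g x, 0) + J x ^+ 2 * q (J x, g x)].
Proof.
have [Gi [d d0 [G0 C1 C2 dP GT]]] := fold_coordinates.
exists d => //; set B := ball (0 : plane R) d.
have oB : open B by exact: ball_open.
have B0 : B 0 by exact: ballxx.
pose F (y : plane R) := f (Gi y).
have FE (k : plane R -> R) : (fun y => k (Gi y)) =
  fun y => k ((fst \o Gi) y, (snd \o Gi) y).
  by apply/funext => y /=; rewrite -surjective_pairing.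
have CF n : Cn n B F.
  rewrite /F FE;
    apply: (@Cn_comp2 R _ n _ _ f (fst \o Gi) (snd \o Gi) oB oN) => // y /dP[Ny _ _].
  by rewrite /= -surjective_pairing.
have DF (k : plane R -> R) v (y : plane R) : (forall n, Cn n N k) -> B y ->
  'D_v (fun y => k (Gi y)) y =
   'D_v (fst \o Gi) y * 'D_e_x k (Gi y) + 'D_v (snd \o Gi) y * 'D_e_y k (Gi y).
  move=> Ck By; have [Ny _ _] := dP y By; rewrite FE.
  have Gy : Gi y = ((fst \o Gi) y, (snd \o Gi) y) by rewrite /= -surjective_pairing.
  rewrite [in RHS]Gy; apply: (@derive_comp2 R _ k (fst \o Gi) (snd \o Gi) y v _ _ _).1.
  - by rewrite -Gy; exact: Cn_diff (Ck 0%N) Ny.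
  - exact: Cn_diff (C1 0%N) By.
  - exact: Cn_diff (C2 0%N) By.
(* Jacobians multiply under a change of coordinates: J = {f, g} = F_xi {J, g}. *)
have Fx (y : plane R) : B y -> 'D_e_x F y * jac J g (Gi y) = y.1.
  move=> By; have [Ny jy Ty] := dP y By.
  have nB : \forall w \near y, B w by exact: open_nbhs_nbhs.
  have E1 : 'D_e_x (fun y => J (Gi y)) y = 1.
    rewrite (@near_eq_derive _ _ _ _ (fst : plane R -> R)) ?(differentiable_fst y).2//.
    by apply: filterS nB => w /dP[_ _ Tw] /=; rewrite -[in RHS]Tw.
  have E2 : 'D_e_x (fun y => g (Gi y)) y = 0.
    rewrite (@near_eq_derive _ _ _ _ (snd : plane R -> R)) ?(differentiable_snd y).2//.
    by apply: filterS nB => w /dP[_ _ Tw] /=; rewrite -[in RHS]Tw.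
  rewrite /F DF//; rewrite DF// in E1; rewrite DF// in E2.
  have -> : y.1 = 'D_e_x f (Gi y) * 'D_e_y g (Gi y) - 'D_e_y f (Gi y) * 'D_e_x g (Gi y).
    by rewrite -[in LHS]Ty.
  move: E1 E2; rewrite [jac J g _]/jac.
  move: ('D_e_x (fst \o Gi) y) ('D_e_x (snd \o Gi) y) ('D_e_x J (Gi y)) ('D_e_y J (Gi y)).
  move: ('D_e_x g (Gi y)) ('D_e_y g (Gi y)) ('D_e_x f (Gi y)) ('D_e_y f (Gi y)).
  move=> gx gy fx fy a b Jx Jy E1 E2.
  have -> : (a * fx + b * fy) * (Jx * gy - Jy * gx) =
    fx * ((a * Jx + b * Jy) * gy - Jy * (a * gx + b * gy)) +
    fy * (Jx * (a * gx + b * gy) - (a * Jx + b * Jy) * gx) by ring.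
  by rewrite E1 E2; ring.
have Fx0 (y : plane R) : B y -> 'D_e_x F (0, y.2) = 0.
  move=> By; have By' : B (0, y.2).
    by have := @shrink_ball R d 0 y; rewrite mul0r lexx ler01; apply.
  have := Fx _ By'; have [_ jn _] := dP _ By'.
  by move=> /eqP; rewrite mulf_eq0 (negbTE jn) orbF => /eqP.
have Fy0 : 'D_e_y F 0 = 0 by rewrite /F DF// G0 fx0 fy0 !mulr0 addr0.
have F0 : F 0 = 0 by rewrite /F G0.
have B1 (y : plane R) : B y -> B (0, y.1).
  rewrite /B !ball_planeE !subr0 => h; apply: le_lt_trans h;
    rewrite pair_normP /= normr0 normr_ge0.
  exact: pair_norm1.
have B2 (y : plane R) : B y -> B (0, y.2).
  rewrite /B !ball_planeE !subr0 => h; apply: le_lt_trans h;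
    rewrite pair_normP /= normr0 normr_ge0.
  exact: pair_norm2.
(* The restriction of F to the axis J = 0, with the coordinate g put first so that the
   division applies to it. *)
pose h0 (y : plane R) := F (0, y.1).
have Ccst n : Cn n B (fun _ : plane R => 0 : R) by exact: Cn_cst.
have Ch0 n : Cn n B h0.
  by apply: (@Cn_comp2 R _ n _ _ F (fun _ => 0) fst oB oB) => //; exact: Cn_fst.
have dcst z : differentiable (fun _ : plane R => 0 : R) z by exact: differentiable_cst.
have Dh0 (y : plane R) : B y -> 'D_e_x h0 (0, y.2) = 0.
  move=> By; rewrite (@derive_comp2 R (plane R) F (fun _ => 0) fst (0, y.2) e_x _ _ _).1 /=.
  - by rewrite (differentiable_fst ((0, y.2) : plane R)).2 derive_cst mul0r add0r mul1r.
  - exact: Cn_diff (CF 0%N) B0.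
  - exact: dcst.
  - by have [] := differentiable_fst ((0, y.2) : plane R).
have [h Ch hE] := hadamard2 Ch0 (fun _ _ => F0) Dh0.
(* F minus its restriction to the axis, to be divided by the square of J. *)
pose K (y : plane R) := F y - F (0, y.2).
have CF2 n : Cn n B (fun y : plane R => F (0, y.2)).
  by apply: (@Cn_comp2 R _ n _ _ F (fun _ => 0) snd oB oB) => //; exact: Cn_snd.
have CK n : Cn n B K.
  apply: (@Cn_add _ _ _ _ _ _ (fun y : plane R => - F (0, y.2))) => //.
  apply: (@Cn_ext _ _ _ _ _ ((-1) \*: (fun y : plane R => F (0, y.2)))) => //.
    by move=> x _; rewrite /= /GRing.scale/= mulN1r.
  exact: Cn_scale.
have DK (y : plane R) : B y -> 'D_e_x K (0, y.2) = 0.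
  move=> By; rewrite deriveB; last 2 first.
  - by apply: diff_derivable; exact: Cn_diff (CF 0%N) (B2 _ By).
  - by apply: diff_derivable; exact: Cn_diff (CF2 0%N) (B2 _ By).
  rewrite Fx0// (@derive_comp2 R (plane R) F (fun _ => 0) snd (0, y.2) e_x _ _ _).1 /=.
  - by rewrite (differentiable_snd ((0, y.2) : plane R)).2 derive_cst !mul0r addr0 subr0.
  - exact: Cn_diff (CF 0%N) (B2 _ By).
  - exact: dcst.
  - by have [] := differentiable_snd ((0, y.2) : plane R).
have [q Cq qE] := hadamard2 CK (fun _ _ => subrr _) DK.
exists q, h; split=> //.
have nB : \forall x \near z1, B (J x, g x).
  have cT : {for z1, continuous (fun x => (J x, g x))}.
    apply: (@cvg_pair _ _ _ (nbhs z1) (nbhs (J z1)) (nbhs (g z1))).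
      exact: (differentiable_continuous (Cn_diff (CJ 0%N) Nz)).
    exact: (differentiable_continuous (Cn_diff (Cg 0%N) Nz)).
  apply: (near_comp cT); rewrite Jz1 g0; exact: nbhsx_ballx.
near=> x.
have Bx : B (J x, g x) by near: x.
have Gx : Gi (J x, g x) = x by near: x.
have -> : f x = F (J x, g x) by rewrite /F Gx.
rewrite -(qE _ Bx) /= /K /=.
have Bg : B (g x, 0).
  move: Bx; rewrite /B !ball_planeE !subr0 => h1; apply: le_lt_trans h1;
    rewrite pair_normP /= normr0 normr_ge0 andbT.
  exact: (@pair_norm2 R R R (J x, g x)).
by have := hE _ Bg; rewrite /= /h0 /= => <-; rewrite addrC subrK.
Unshelve. all: by end_near. Qed.

End NormalForm.

Section Hyperbolic.
Context {R : realType}.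
Variables (N : set (plane R)) (f g : plane R -> R) (z1 : plane R).
Hypotheses (oN : open N) (Nz : N z1).
Hypotheses (Cf : forall n, Cn n N f) (Cg : forall n, Cn n N g).
Hypotheses (f0 : f z1 = 0) (g0 : g z1 = 0).
Hypotheses (fx0 : 'D_e_x f z1 = 0) (fy0 : 'D_e_y f z1 = 0).

Let J := jac f g.
Hypothesis J0 : 0 < jac J g z1.
Hypothesis lap : 'D_e_x ('D_e_x f) z1 + 'D_e_y ('D_e_y f) z1 = 0.

Let Jz1 : J z1 = 0.
Proof. by rewrite /J /jac fx0 fy0 !mul0r subrr. Qed.

Let CJ n : Cn n N J.
Proof. exact: Cn_jac. Qed.

Lemma derive_jac_critical u :
  'D_u J z1 = 'D_u ('D_e_x f) z1 * 'D_e_y g z1 - 'D_u ('D_e_y f) z1 * 'D_e_x g z1.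
Proof.
have alg (a b c d e h x y : R) : x = 0 -> y = 0 -> a * b + x * c - (d * e + y * h) =
  a * b - d * e.
  by move=> -> ->; rewrite !mul0r !addr0.
exact: etrans (derive_jac u Nz (Cf 1%N) (Cg 1%N)) (alg _ _ _ _ _ _ _ _ fx0 fy0).
Qed.

Lemma derive2_sum (N1 : set (plane R)) (k a b : plane R -> R) u v : open N1 -> N1 z1 ->
  Cn 1 N1 a -> Cn 1 N1 b -> (forall x, N1 x -> k x = a x + b x) ->
  'D_u ('D_v k) z1 = 'D_u ('D_v a) z1 + 'D_u ('D_v b) z1.
Proof.
move=> oN1 N1z Ca Cb E.
have n1 x : N1 x -> \forall y \near x, N1 y by move=> N1x; exact: open_nbhs_nbhs.
have -> : 'D_u ('D_v k) z1 = 'D_u ('D_v a + 'D_v b) z1.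
  apply: near_eq_derive; apply: filterS (n1 _ N1z) => x N1x.
  have -> : 'D_v k x = 'D_v (a + b) x.
    by apply: near_eq_derive; apply: filterS (n1 _ N1x) => y; exact: E.
  by rewrite deriveD//; apply: diff_derivable;
    [exact: Cn_diff Ca N1x | exact: Cn_diff Cb N1x].
rewrite deriveD//; apply: diff_derivable.
  exact: Cn_diff (Cn_derive v Ca) N1z.
exact: Cn_diff (Cn_derive v Cb) N1z.
Qed.

(** In [f = g ^ 2 H + J ^ 2 G], differentiating [J = {f, g}] with the second derivatives
    of [f] at [z1] gives [2 G {J, g} = 1], hence [G > 0]. The Laplacian of [f] at [z1]
    is twice [H (g_x ^ 2 + g_y ^ 2) + G (J_x ^ 2 + J_y ^ 2)]; it vanishes, hence
    [H < 0]. Then [M = - h] is positive and [M f = (J sqrt (M G)) ^ 2 - (M g) ^ 2]. *)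
Lemma hyperbolic_form : exists2 d, 0 < d &
  exists (M : plane R -> R) (sigma : plane R -> plane R),
  [/\ forall n, Cn n (ball 0 d) M, 0 < M 0, local_diffeo sigma 0 z1,
    {for 0, continuous sigma} &
   \forall z \near (0 : plane R), hyperbolic_singularity z =
      (M (g (sigma z), 0) * f (sigma z), M (g (sigma z), 0) * g (sigma z))].
Proof.
have [d d0 [q [h [Cq Ch E]]]] := fold_form oN Nz Cf Cg f0 g0 fx0 fy0 J0.
have ob : open (ball (0 : plane R) d) by exact: ball_open.
have cT : {for z1, continuous (fun x => (J x, g x))}.
  apply: (@cvg_pair _ _ _ (nbhs z1) (nbhs (J z1)) (nbhs (g z1))).
    exact: (differentiable_continuous (Cn_diff (CJ 0%N) Nz)).
  exact: (differentiable_continuous (Cn_diff (Cg 0%N) Nz)).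
have NB : \forall x \near z1, ball (0 : plane R) d (J x, g x).
  by apply: (near_comp cT); rewrite Jz1 g0; exact: nbhsx_ballx.
have NN : \forall x \near z1, N x by exact: open_nbhs_nbhs.
have /nbhs_ballP[r1 /= r10 rP] : \forall x \near z1,
    (N x /\ ball (0 : plane R) d (J x, g x)) /\
    f x = g x ^+ 2 * h (g x, 0) + J x ^+ 2 * q (J x, g x).
  exact: (filterI (filterI NN NB) E).
pose N1 := ball z1 r1; have oN1 : open N1 by exact: ball_open.
have N1z : N1 z1 by exact: ballxx.
have N1N : N1 `<=` N by move=> x /rP[[]].
have bg x : N1 x -> ball (0 : plane R) d (g x, 0).
  move=> /rP[[_ Bx] _]; move: Bx; rewrite !ball_planeE !subr0 => h1; apply: le_lt_trans h1.
  rewrite pair_normP /= normr0 normr_ge0 andbT; exact: (@pair_norm2 R R R (J x, g x)).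
pose H x := h (g x, 0); pose G x := q (J x, g x).
have CJ1 n : Cn n N1 J by exact: Cn_sub N1N (CJ n).
have Cg1 n : Cn n N1 g by exact: Cn_sub N1N (Cg n).
have CH n : Cn n N1 H.
  apply: (@Cn_comp2 R _ n _ _ h g (fun _ => 0) oN1 ob) => //; exact: Cn_cst.
have CG n : Cn n N1 G.
  by apply: (@Cn_comp2 R _ n _ _ q J g oN1 ob) => // x /rP[[]].
have CA n : Cn n N1 (fun x => g x ^+ 2 * H x) by
  exact: (Cn_mul oN1 (Cn_mul oN1 (Cg1 n) (Cg1 n)) (CH n)).
have CB n : Cn n N1 (fun x => J x ^+ 2 * G x) by
  exact: (Cn_mul oN1 (Cn_mul oN1 (CJ1 n) (CJ1 n)) (CG n)).
have D2 u v : 'D_u ('D_v f) z1 =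
    2 * ('D_u g z1 * 'D_v g z1 * H z1) + 2 * ('D_u J z1 * 'D_v J z1 * G z1).
  rewrite (derive2_sum u v oN1 N1z (CA 1%N) (CB 1%N)); last by move=> x /rP[].
  by rewrite (derive2_sqr u v oN1 N1z (Cg1 1%N) (CH 1%N) g0)
    (derive2_sqr u v oN1 N1z (CJ1 1%N) (CG 1%N) Jz1).
have [Gpos Hneg] : 0 < G z1 /\ H z1 < 0.
  have jx := derive_jac_critical e_x; have jy := derive_jac_critical e_y;
    move: lap J0 jx jy.
  rewrite [jac J g z1]/jac !D2.
  move: ('D_e_x J z1) ('D_e_y J z1) ('D_e_x g z1) ('D_e_y g z1) (G z1) (H z1).
  move=> Jx Jy gx gy G0 H0 lap0 j0 ex ey.
  (* The gradient of J at z1 is known from the second derivatives of f, which in turn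
     involve the gradients of J and g: the terms with H cancel. *)
  have e1 : (Jx * gy - Jy * gx) = 2 * G0 * (Jx * gy - Jy * gx) ^+ 2.
    by move: (congr1 (fun t => t * gy) ex) (congr1 (fun t => t * gx) ey) => /=; lra.
  have Gp : 0 < G0.
    have : 0 < 2 * G0 * (Jx * gy - Jy * gx) ^+ 2 by rewrite -e1.
    by rewrite pmulr_lgt0 ?exprn_gt0// pmulr_rgt0.
  split=> //; rewrite ltNge; apply/negP => H0ge.
  have P0 : 0 <= Jx ^+ 2 + Jy ^+ 2 by rewrite addr_ge0// sqr_ge0.
  (* The Lagrange identity bounds the product below by the squared Jacobian of (J, g). *)
  have PQ : 0 < (Jx ^+ 2 + Jy ^+ 2) * (gx ^+ 2 + gy ^+ 2).
    have -> : (Jx ^+ 2 + Jy ^+ 2) * (gx ^+ 2 + gy ^+ 2) =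
      (Jx * gy - Jy * gx) ^+ 2 + (Jx * gx + Jy * gy) ^+ 2 by ring.
    by rewrite ltr_pwDl ?sqr_ge0// exprn_gt0.
  have Pp : 0 < Jx ^+ 2 + Jy ^+ 2.
    by rewrite lt_def P0 andbT; apply/eqP => P00; rewrite P00 mul0r ltxx in PQ.
  have Q0 : 0 <= H0 * (gx ^+ 2 + gy ^+ 2) by rewrite mulr_ge0// addr_ge0// sqr_ge0.
  have R0 : 0 < G0 * (Jx ^+ 2 + Jy ^+ 2) by rewrite mulr_gt0.
  lra.
pose M (y : plane R) := - h y; pose M1 x := M (g x, 0).
have Cn_opp n (A : set (plane R)) (k : plane R -> R) : open A -> Cn n A k ->
  Cn n A (fun x => - k x).
  move=> oA Ck; apply: (@Cn_ext _ _ _ _ _ ((-1) \*: k)) => //.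
    by move=> x _; rewrite /= /GRing.scale/= mulN1r.
  exact: Cn_scale.
have CM1 n : Cn n N1 M1 by apply: Cn_opp oN1 (CH n).
have M1z : 0 < M1 z1 by rewrite /M1 /M oppr_gt0.
have cM1 : {for z1, continuous M1} := differentiable_continuous (Cn_diff (CM1 0%N) N1z).
have cG : {for z1, continuous G} := differentiable_continuous (Cn_diff (CG 0%N) N1z).
have /nbhs_ballP[r2 /= r20 r2P] : \forall x \near z1, (0 < M1 x /\ 0 < G x) /\ N1 x.
  have p1 : \forall x \near z1, 0 < M1 x by exact: (cvgr_gt _ cM1).
  have p2 : \forall x \near z1, 0 < G x by exact: (cvgr_gt _ cG).
  have p3 : \forall x \near z1, N1 x by exact: nbhsx_ballx.
  exact: (filterI (filterI p1 p2) p3).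
pose N2 := ball z1 r2; have oN2 : open N2 by exact: ball_open.
have N2z : N2 z1 by exact: ballxx.
have N21 : N2 `<=` N1 by move=> x /r2P[].
pose s x := Num.sqrt (M1 x * G x).
have Cs n : Cn n N2 s.
  apply: (@Cn_sqrt _ _ n N2 (M1 * G)) => //.
    by move=> x /r2P[[? ?] _]; rewrite mulr_gt0.
  by apply: Cn_mul => //; apply: Cn_sub N21 _.
have CJ2 n : Cn n N2 J by exact: Cn_sub N21 (CJ1 n).
have Cg2 n : Cn n N2 g by exact: Cn_sub N21 (Cg1 n).
have CM2 n : Cn n N2 M1 by exact: Cn_sub N21 (CM1 n).
pose S1 := J * s; pose S2 := g * M1.
have CS1 n : Cn n N2 S1 by exact: (Cn_mul oN2 (CJ2 n) (Cs n)).
have CS2 n : Cn n N2 S2 by exact: (Cn_mul oN2 (Cg2 n) (CM2 n)).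
have dd (k : plane R -> R) : (forall n, Cn n N2 k) -> differentiable k z1.
  by move=> Ck; exact: Cn_diff (Ck 0%N) N2z.
have DS1 v : 'D_v S1 z1 = 'D_v J z1 * s z1 by apply: derive_mul0 => //; exact: dd.
have DS2 v : 'D_v S2 z1 = 'D_v g z1 * M1 z1 by apply: derive_mul0 => //; exact: dd.
have jS : jac S1 S2 z1 != 0.
  have -> : jac S1 S2 z1 = s z1 * M1 z1 * jac J g z1.
    rewrite /jac !DS1 !DS2 -!/(jac f g) -!/J.
    by move: ('D_e_x J z1) ('D_e_y J z1) ('D_e_x g z1) ('D_e_y g z1) => *; ring.
  by rewrite !mulf_neq0// gt_eqF// sqrtr_gt0 mulr_gt0.
have := inverse_function oN2 N2z CS1 CS2 jS.
have -> : (S1 z1, S2 z1) = 0.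
  by apply: pairP; rewrite /S1 /S2 !fctE /= ?Jz1 ?g0 mul0r.
move=> /local_diffeo_inv[sigma [lsigma csigma TG _ _]].
exists d => //; exists M, sigma; split=> //.
- by move=> n; exact: Cn_opp ob (Ch n).
- by move: M1z; rewrite /M1 g0.
have sig0 : sigma 0 = z1 by case: lsigma.
have N2s : \forall z \near (0 : plane R), N2 (sigma z).
  by apply: (near_comp csigma); rewrite sig0; exact: nbhsx_ballx.
near=> z.
have Sz : (S1 (sigma z), S2 (sigma z)) = z by near: z.
have [[M1p Gp] N1s] : (0 < M1 (sigma z) /\ 0 < G (sigma z)) /\ N1 (sigma z).
  by apply: r2P; near: z.
have [_ fE] := rP _ N1s.
rewrite /hyperbolic_singularity -[in LHS]Sz /= -/(M1 (sigma z)) fE -/(G (sigma z)).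
have -> : h (g (sigma z), 0) = - M1 (sigma z) by rewrite /M1 /M opprK.
rewrite /S1 /S2 !fctE /= [(J _ * _) ^+ 2]exprMn /s sqr_sqrtr ?mulr_ge0 ?ltW//.
apply: pairP => /=; last exact: mulrC.
by move: (J (sigma z)) (g (sigma z)) (M1 (sigma z)) (G (sigma z)) => *; ring.
Unshelve. all: by end_near. Qed.

End Hyperbolic.

(** * Radial equivalence of nondegenerate zeros *)

Section RadialScaling.
Context {R : realType}.
Variables (d : R) (M : plane R -> R) (b11 b12 b21 b22 : R).
Hypotheses (d0 : 0 < d) (CM : forall n, Cn n (ball 0 d) M) (M0 : 0 < M 0).
Hypothesis det0 : b11 * b22 - b12 * b21 != 0.

Definition lin1 (a b : R) (w : plane R) : R := a * w.1 + b * w.2.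

Lemma Cn_lin1 a b n A : Cn n A (lin1 a b).
Proof.
apply: (@Cn_sub _ _ _ _ _ setT) => //.
apply: (@Cn_ext _ _ _ _ _ (a \*: (fst : plane R -> R) + b \*: (snd : plane R -> R))) => //.
  exact: openT.
apply: Cn_add; [exact: openT | apply: Cn_scale; [exact: openT | exact: Cn_fst] |
  apply: Cn_scale; [exact: openT | exact: Cn_snd]].
Qed.

Lemma differentiable_lin1 a b z : differentiable (lin1 a b) z.
Proof. exact: (Cn_diff (Cn_lin1 a b 0 setT)). Qed.

Lemma derive_lin1 a b z v : 'D_v (lin1 a b) z = a * v.1 + b * v.2.
Proof.
have [d1 D1] := differentiable_fst z; have [d2 D2] := differentiable_snd z.
have -> : lin1 a b = a \*: (fst : plane R -> R) + b \*: (snd : plane R -> R) by [].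
rewrite deriveD; last 2 first.
- by apply: diff_derivable; exact: differentiableZ.
- by apply: diff_derivable; exact: differentiableZ.
rewrite (deriveZ _ (diff_derivable (v := v) d1)) (deriveZ _ (diff_derivable (v := v) d2)).
by rewrite D1 D2.
Qed.

Lemma lin1_0 a b : lin1 a b 0 = 0.
Proof. by rewrite /lin1 /= !mulr0 addr0. Qed.

Let f := lin1 b11 b12.
Let g := lin1 b21 b22.

(** An invertible linear map followed by multiplication by a positive factor. The factor
    is a function of the second component only, as is the one that [hyperbolic_form]
    provides. *)
Definition radial_map w := (M (g w, 0) * f w, M (g w, 0) * g w).

(** The linear map and the multiplication by a positive factor both map rays to rays,
    and so does the local inverse of their composition. *)
Lemma radial_scaling : exists2 tau, radial_transformation tau &
  \forall w \near (0 : plane R), tau (radial_map w) = w.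
Proof.
have cg0 : {for 0, continuous (fun w => (g w, 0 : R))}.
  apply: (@cvg_pair _ _ _ (nbhs (0 : plane R)) (nbhs (g 0)) (nbhs (0 : R)));
    last exact: cvg_cst.
  exact: (differentiable_continuous (differentiable_lin1 _ _ _)).
have /nbhs_ballP[r /= r0 rP] : \forall w \near (0 : plane R), ball (0 : plane R) d (g w, 0).
  by apply: (near_comp cg0); rewrite /g lin1_0; exact: nbhsx_ballx.
pose N := ball (0 : plane R) r; have oN : open N by exact: ball_open.
have N0 : N 0 by exact: ballxx.
have ob : open (ball (0 : plane R) d) by exact: ball_open.
pose Mg w := M (g w, 0).
have CMg n : Cn n N Mg.
  apply: (@Cn_comp2 R _ n _ _ M g (fun _ => 0) oN ob) => //;
    [exact: Cn_lin1 | exact: Cn_cst].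
have CS (k : plane R -> R) : (forall n, Cn n N k) -> forall n, Cn n N (k * Mg).
  by move=> Ck n; exact: Cn_mul.
have Cf n : Cn n N f by exact: Cn_lin1.
have Cg n : Cn n N g by exact: Cn_lin1.
have dd (k : plane R -> R) : (forall n, Cn n N k) -> differentiable k 0.
  by move=> Ck; exact: Cn_diff (Ck 0%N) N0.
have Mg0 : Mg 0 = M 0 by rewrite /Mg /g lin1_0.
have D1 v : 'D_v (f * Mg) 0 = (b11 * v.1 + b12 * v.2) * M 0.
  by rewrite (derive_mul0 v (dd _ Cf) (dd _ CMg) (lin1_0 _ _)) derive_lin1 Mg0.
have D2 v : 'D_v (g * Mg) 0 = (b21 * v.1 + b22 * v.2) * M 0.
  by rewrite (derive_mul0 v (dd _ Cg) (dd _ CMg) (lin1_0 _ _)) derive_lin1 Mg0.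
have jS : jac (f * Mg) (g * Mg) 0 != 0.
  rewrite /jac !D1 !D2 /= !mulr0 !mulr1 !addr0 !add0r.
  have -> : b11 * M 0 * (b22 * M 0) - b12 * M 0 * (b21 * M 0) =
    M 0 ^+ 2 * (b11 * b22 - b12 * b21) by ring.
  by rewrite mulf_neq0// expf_neq0// gt_eqF.
have := inverse_function oN N0 (CS _ Cf) (CS _ Cg) jS.
have -> : ((f * Mg) 0, (g * Mg) 0) = 0.
  by apply: pairP; rewrite /= !fctE /= /f /g lin1_0 mul0r.
move=> /local_diffeo_inv[tau [ltau ctau TG GT _]].
have RM w : radial_map w = ((f * Mg) w, (g * Mg) w).
  by rewrite /radial_map; congr pair; rewrite !fctE mulrC.
exists tau; last by apply: filterS GT => w; rewrite RM.
have tau0 : tau 0 = 0 by case: ltau.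
split=> //.
have cMg : {for 0, continuous Mg} := differentiable_continuous (dd _ CMg).
have /nbhs_ballP[e /= e0 eP] : \forall y \near (0 : plane R), 0 < Mg (tau y) /\
  ((f * Mg) (tau y), (g * Mg) (tau y)) = y.
  have p1 : \forall w \near (0 : plane R), 0 < Mg w by apply: (cvgr_gt _ cMg); rewrite Mg0.
  have p2 : \forall y \near (0 : plane R), 0 < Mg (tau y).
    by apply: (@near_comp _ _ (fun w => 0 < Mg w) _ ctau); rewrite tau0.
  exact: (filterI p2 TG).
exists e => // L [v0 v0n ->]; pose D := b11 * b22 - b12 * b21; have det1 : D != 0 := det0.
(* The image of the ray through v0 is the ray through the image of v0 under the inverse
   of the linear part. *)
pose A (v : plane R) : plane R :=
  ((b22 * v.1 - b12 * v.2) / D, (- b21 * v.1 + b11 * v.2) / D).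
exists [set t *: A v0 | t in [set t : R | 0 < t]].
  exists (A v0) => //; apply: contra_neq v0n => -[h1 h2].
  have E1 : v0.1 = b11 * (A v0).1 + b12 * (A v0).2.
    by rewrite /= /D; move: det0 => ?; field.
  have E2 : v0.2 = b21 * (A v0).1 + b22 * (A v0).2.
    by rewrite /= /D; move: det0 => ?; field.
  by apply: pairP; rewrite ?E1 ?E2 /= h1 h2 !mulr0 addr0.
move=> _ [y [[t /= t0 <-] /eP[mu0 E]] <-].
set w := tau (t *: v0) in mu0 E *; set mu := Mg w in mu0.
exists (t / mu); first by rewrite /= divr_gt0.
have E1 : f w * mu = t * v0.1 by have := congr1 fst E.
have E2 : g w * mu = t * v0.2 by have := congr1 snd E.
have mun : mu != 0 by rewrite gt_eqF.
have F1 : f w = t / mu * v0.1 by rewrite mulrAC -E1 mulfK.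
have F2 : g w = t / mu * v0.2 by rewrite mulrAC -E2 mulfK.
apply: pairP; rewrite /= /GRing.scale /= /A /=.
  have -> : t / mu * ((b22 * v0.1 - b12 * v0.2) / D) =
    (b22 * (t / mu * v0.1) - b12 * (t / mu * v0.2)) / D by ring.
  by rewrite -F1 -F2 /f /g /lin1 /D; move: det0 => ?; field.
have -> : t / mu * ((- b21 * v0.1 + b11 * v0.2) / D) =
  (- b21 * (t / mu * v0.1) + b11 * (t / mu * v0.2)) / D by ring.
by rewrite -F1 -F2 /f /g /lin1 /D; move: det0 => ?; field.
Qed.

End RadialScaling.

Lemma jac_grad_neq0 (R : realType) (h k : plane R -> R) z :
  jac h k z != 0 -> ('D_e_x k z != 0) || ('D_e_y k z != 0).
Proof.
have [gx|//] := eqVneq ('D_e_x k z) 0; have [gy|//] := eqVneq ('D_e_y k z) 0.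
by rewrite /jac gx gy !mulr0 subrr eqxx.
Qed.

Section Classification.
Context {R : realType}.
Variables (N : set (plane R)) (p1 p2 : plane R -> R) (z1 : plane R).
Hypotheses (oN : open N) (Nz : N z1).
Hypotheses (C1 : forall n, Cn n N p1) (C2 : forall n, Cn n N p2).
Hypotheses (p10 : p1 z1 = 0) (p20 : p2 z1 = 0).
Hypotheses (lap1 : 'D_e_x ('D_e_x p1) z1 + 'D_e_y ('D_e_y p1) z1 = 0).
Hypotheses (lap2 : 'D_e_x ('D_e_x p2) z1 + 'D_e_y ('D_e_y p2) z1 = 0).

Let J := jac p1 p2.

Definition equivalent_to (phi : plane R -> plane R) :=
  exists sigma tau : plane R -> plane R,
  [/\ local_diffeo sigma 0 z1, radial_transformation tau &
      \forall z \near (0 : plane R), (p1 (sigma z), p2 (sigma z)) = tau (phi z)].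

Lemma regular_case : J z1 != 0 -> equivalent_to regular_singularity.
Proof.
move=> J0; have := inverse_function oN Nz C1 C2 J0; rewrite p10 p20.
move=> /local_diffeo_inv[sigma [ls _ TG _ _]].
exists sigma, id; split=> //; first exact: radial_id.
by apply: filterS TG => z ->; rewrite /regular_singularity -surjective_pairing.
Qed.

Section Combination.
Variables (a b : R).
Let k := fun z => a * p1 z + b * p2 z.

Lemma Cn_comb n : Cn n N k.
Proof. by apply: Cn_add => //; exact: Cn_scale. Qed.

Lemma derive_comb v z : N z -> 'D_v k z = a * 'D_v p1 z + b * 'D_v p2 z.
Proof.
move=> Nz'; have d1 := Cn_diff (C1 0) Nz'; have d2 := Cn_diff (C2 0) Nz'.
have -> : k = a \*: p1 + b \*: p2 by [].
rewrite deriveD; last 2 first.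
- by apply: diff_derivable; exact: differentiableZ.
- by apply: diff_derivable; exact: differentiableZ.
by rewrite (deriveZ _ (diff_derivable (v := v) d1)) (deriveZ _ (diff_derivable (v :=
  v) d2)).
Qed.

Lemma derive2_comb u v : 'D_u ('D_v k) z1 = a * 'D_u ('D_v p1) z1 + b * 'D_u ('D_v p2) z1.
Proof.
have d1 := Cn_diff (Cn_derive v (C1 1)) Nz; have d2 := Cn_diff (Cn_derive v (C2 1)) Nz.
have -> : 'D_u ('D_v k) z1 = 'D_u (a \*: 'D_v p1 + b \*: 'D_v p2) z1.
  apply: near_eq_derive; apply: filterS (open_nbhs_nbhs (conj oN Nz)) => z Nz'.
  exact: derive_comb.
rewrite deriveD; last 2 first.
- by apply: diff_derivable; exact: differentiableZ.
- by apply: diff_derivable; exact: differentiableZ.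
by rewrite (deriveZ _ (diff_derivable (v := u) d1)) (deriveZ _ (diff_derivable (v :=
  u) d2)).
Qed.
End Combination.

(** The new components of the target are [f = b11 p1 + b12 p2], which is critical at
    [z1], and [g = b21 p1 + b22 p2]. The Laplacian of [f] vanishes because those of [p1]
    and [p2] do. *)
Lemma hyperbolic_case b11 b12 b21 b22 :
  b11 * 'D_e_x p1 z1 + b12 * 'D_e_x p2 z1 = 0 ->
  b11 * 'D_e_y p1 z1 + b12 * 'D_e_y p2 z1 = 0 ->
  0 < (b11 * b22 - b12 * b21) * jac J (fun z => b21 * p1 z + b22 * p2 z) z1 ->
  equivalent_to hyperbolic_singularity.
Proof.
move=> fx fy jp; set D := b11 * b22 - b12 * b21 in jp.
have D0 : D != 0 by apply: contraTneq jp => ->; rewrite mul0r ltxx.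
pose f z := b11 * p1 z + b12 * p2 z; pose g z := b21 * p1 z + b22 * p2 z.
have jE z : N z -> jac f g z = D * J z.
  move=> Nz'; rewrite [LHS]/jac !derive_comb// /D /J /jac.
  by move: ('D_e_x p1 z) ('D_e_y p1 z) ('D_e_x p2 z) ('D_e_y p2 z) => *; ring.
have nN : \forall z \near z1, N z by exact: open_nbhs_nbhs.
have DJ v : 'D_v (jac f g) z1 = D * 'D_v J z1.
  have dJ : differentiable J z1 by exact: (Cn_diff (Cn_jac 0 oN C1 C2) Nz).
  rewrite -[RHS](deriveZ _ (diff_derivable (v := v) dJ)).
  by apply: near_eq_derive; apply: filterS nN => z; exact: jE.
have J0 : 0 < jac (jac f g) g z1.
  have -> : jac (jac f g) g z1 = D * jac J g z1; last exact: jp.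
  rewrite -[LHS]/('D_e_x (jac f g) z1 * 'D_e_y g z1 - 'D_e_y (jac f g) z1 * 'D_e_x g z1).
  rewrite -[jac J g z1]/('D_e_x J z1 * 'D_e_y g z1 - 'D_e_y J z1 * 'D_e_x g z1).
  move: (DJ e_x) (DJ e_y); clear; clearbody D f g J.
  move: ('D_e_x (jac f g) z1) ('D_e_y (jac f g) z1) ('D_e_x J z1) ('D_e_y J z1) =>
    X Y x y -> ->.
  by move: ('D_e_x g z1) ('D_e_y g z1) => u v; ring.
have Cf n : Cn n N f by exact: Cn_comb.
have Cg n : Cn n N g by exact: Cn_comb.
have f0 : f z1 = 0 by rewrite /f p10 p20 !mulr0 addr0.
have g0 : g z1 = 0 by rewrite /g p10 p20 !mulr0 addr0.
have fx0 : 'D_e_x f z1 = 0 by rewrite (derive_comb _ _ _ Nz).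
have fy0 : 'D_e_y f z1 = 0 by rewrite (derive_comb _ _ _ Nz).
have lapf : 'D_e_x ('D_e_x f) z1 + 'D_e_y ('D_e_y f) z1 = 0.
  rewrite (derive2_comb _ _ e_x e_x) (derive2_comb _ _ e_y e_y); move: lap1 lap2; clear.
  move: ('D_e_x ('D_e_x p1) z1) ('D_e_y ('D_e_y p1) z1) => q1 q2.
  move: ('D_e_x ('D_e_x p2) z1) ('D_e_y ('D_e_y p2) z1) => q3 q4 l1 l2.
  have -> : b11 * q1 + b12 * q3 + (b11 * q2 + b12 * q4) = b11 * (q1 + q2) + b12 * (q3 + q4)
    by ring.
  by rewrite l1 l2 !mulr0 addr0.
have fE z : f z = lin1 b11 b12 (p1 z, p2 z) by [].
have gE z : g z = lin1 b21 b22 (p1 z, p2 z) by [].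
clearbody f g.
have [d d0 [M [sigma [CM M0 ls cs E]]]] :=
  hyperbolic_form oN Nz Cf Cg f0 g0 fx0 fy0 J0 lapf.
have [tau rtau tauK] := radial_scaling d0 CM M0 D0.
exists sigma, tau; split=> //.
have sig0 : sigma 0 = z1 by case: ls.
have cp : {for z1, continuous (fun x => (p1 x, p2 x))}.
  apply: (@cvg_pair _ _ _ (nbhs z1) (nbhs (p1 z1)) (nbhs (p2 z1))).
    exact: (differentiable_continuous (Cn_diff (C1 0%N) Nz)).
  exact: (differentiable_continuous (Cn_diff (C2 0%N) Nz)).
have n1 : \forall x \near z1, tau (radial_map M b11 b12 b21 b22 (p1 x, p2 x)) =
  (p1 x, p2 x).
  by apply: (@near_comp _ _ (fun w => tau (radial_map M b11 b12 b21 b22 w) = w) _ cp);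
    rewrite p10 p20.
have n2 : \forall z \near (0 : plane R), tau (radial_map M b11 b12 b21 b22 (p1 (sigma z),
  p2 (sigma z))) = (p1 (sigma z), p2 (sigma z)).
  by apply: (@near_comp _ _ (fun x => tau (radial_map M b11 b12 b21 b22 (p1 x, p2 x)) =
    (p1 x, p2 x)) _ cs); rewrite sig0.
by apply: filterS2 E n2 => z -> n2z; rewrite -[LHS]n2z /radial_map -fE -gE.
Qed.

(** The gradient of the [p_i] with [{J, p_i} <> 0] is nonzero, so the other gradient is
    a multiple of it and a linear change of the target makes the other component
    critical. Scaling the critical component by [{J, p_i}] ensures the positivity of
    [{J, g}]. *)
Lemma degenerate_classification : J z1 = 0 -> jac J p1 z1 != 0 \/ jac J p2 z1 != 0 ->
  equivalent_to hyperbolic_singularity.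
Proof.
move=> J0; have Jz : 'D_e_x p1 z1 * 'D_e_y p2 z1 - 'D_e_y p1 z1 * 'D_e_x p2 z1 = 0 := J0.
have H (x1 y1 x2 y2 : R) : x1 * y2 - y1 * x2 = 0 -> (x2 != 0) || (y2 != 0) ->
  exists mu, x1 = mu * x2 /\ y1 = mu * y2.
  move=> j0 /orP[h|h].
    exists (x1 / x2); split; first by rewrite divfK.
    by rewrite mulrAC; move/eqP: j0; rewrite subr_eq0 => /eqP ->; rewrite mulfK.
  exists (y1 / y2); split; last by rewrite divfK.
  by rewrite mulrAC; move/eqP: j0; rewrite subr_eq0 => /eqP <-; rewrite mulfK.
have G k := @jac_grad_neq0 R J k z1.
have sg (x : R) : x != 0 -> exists2 s, 0 < s * x & True.
  by exists x => //; rewrite -expr2 exprn_even_gt0.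
case=> jk.
  have [mu [mx my]] : exists mu, 'D_e_x p2 z1 = mu * 'D_e_x p1 z1 /\ 'D_e_y p2 z1 =
    mu * 'D_e_y p1 z1.
    by apply: H (G _ jk); rewrite -[RHS]oppr0 -Jz; ring.
  have [s sp _] := sg _ jk.
  apply: (@hyperbolic_case (s * mu) (- s) 1 0).
  - by rewrite mx; ring.
  - by rewrite my; ring.
  rewrite (_ : (fun z => _) = p1); last by apply/funext => z; ring.
  by rewrite mulr0 mulr1 sub0r opprK.
have [mu [mx my]] : exists mu, 'D_e_x p1 z1 = mu * 'D_e_x p2 z1 /\ 'D_e_y p1 z1 =
  mu * 'D_e_y p2 z1.
  by apply: H (G _ jk).
have [s sp _] := sg _ jk.
apply: (@hyperbolic_case s (- s * mu) 0 1).
- by rewrite mx; ring.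
- by rewrite my; ring.
rewrite (_ : (fun z => _) = p2); last by apply/funext => z; ring.
by rewrite mulr0 mulr1 subr0.
Qed.

End Classification.

(** * A Lipschitz image of a box does not cover a cube of higher dimension *)

(** Suppose that every [a] in the cube is bad for some [u (a)]. Cut the box of the [u]
    into cells, and choose in the cube a grid with more points than there are cells: two
    distinct grid points [a] have their [u (a)] in one cell, so they are closer than the
    mesh of the grid allows. *)
Lemma exists_not_covered (R : realType) (I J : finType)
    (Bad : (J -> R) -> (I -> R) -> Prop) (B C e : R) :
  (#|I| < #|J|)%N -> 0 < B -> 0 < C -> 0 < e ->
  (forall a a' u u' d, (forall j, 0 <= a j <= e) -> (forall j, 0 <= a' j <= e) ->
     (forall i, `|u i| <= B) -> (forall i, `|u' i| <= B) -> Bad a u -> Bad a' u' ->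
     (forall i, `|u i - u' i| <= d) -> forall j, `|a j - a' j| <= C * d) ->
  exists2 a, forall j, 0 <= a j <= e & forall u, (forall i, `|u i| <= B) -> ~ Bad a u.
Proof.
move=> IJ B0 C0 e0 lip; apply: contrapT => noa.
have allbad a : (forall j, 0 <= a j <= e) -> exists u, (forall i, `|u i| <= B) /\ Bad a u.
  move=> ae; apply: contrapT => nou; apply: noa; exists a => // u uB bad.
  by apply: nou; exists u.
(* Each coordinate of the cube gets K + 1 grid points and each coordinate of the box T K
   + 1 cells, where K = (T + 1) ^ |I|. So the grid has at least (K + 1) ^ (|I| + 1)
   points, against at most ((T + 1) (K + 1)) ^ |I| = K (K + 1) ^ |I| cells. Two points u
   in one cell are within 2 B / (T K), which forces the grid points closer than their
   mesh e / K as soon as 2 B C < T e. *)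
pose T := Num.bound (2 * B * C / e).
have TP : 2 * B * C < T%:R * e.
  by rewrite -ltr_pdivrMr//; apply: archi_boundP; rewrite divr_ge0 ?mulr_ge0 ?ltW.
pose K := (T.+1 ^ #|I|)%N; pose N := (T * K)%N.
have T0 : (0 < T)%N.
  rewrite lt0n; apply: contraTneq TP => ->; rewrite mul0r -leNgt !mulr_ge0 ?ltW//.
have K0 : (0 < K)%N by rewrite expn_gt0.
have N0 : (0 < N)%N by rewrite muln_gt0 T0.
have KR : 0 < K%:R :> R by rewrite ltr0n.
have NR : 0 < N%:R :> R by rewrite ltr0n.
pose grid (c : {ffun J -> 'I_K.+1}) j : R := (c j)%:R * (e / K%:R).
have gridP c j : 0 <= grid c j <= e.
  rewrite /grid; apply/andP; split; first by rewrite mulr_ge0// divr_ge0// ltW.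
  have -> : (c j)%:R * (e / K%:R) = (c j)%:R / K%:R * e by field; rewrite gt_eqF.
  by rewrite ger_pMl// ler_pdivrMr// mul1r ler_nat -ltnS ltn_ord.
have [u uP] : {u : {ffun J -> 'I_K.+1} -> I -> R &
    forall c, (forall i, `|u c i| <= B) /\ Bad (grid c) (u c)}.
  by apply: (@choice _ _ (fun c u => (forall i, `|u i| <= B) /\ Bad (grid c) u)) => c;
    apply: allbad.
pose idx (x : R) := (x + B) / (2 * B) * N%:R.
have idx0 x : `|x| <= B -> 0 <= idx x <= N%:R.
  rewrite ler_norml => /andP[h1 h2]; have B2 : 0 < 2 * B by rewrite mulr_gt0.
  have q0 : 0 <= (x + B) / (2 * B) by apply: divr_ge0; [lra | exact: ltW].
  rewrite /idx mulr_ge0//=.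
  by rewrite ger_pMl// ler_pdivrMr// mul1r; lra.
pose cell (c : {ffun J -> 'I_K.+1}) : {ffun I -> 'I_N.+1} :=
  [ffun i => inord (Num.truncn (idx (u c i)))].
have : (#|{ffun I -> 'I_N.+1}| < #|{ffun J -> 'I_K.+1}|)%N.
  rewrite !card_ffun !card_ord.
  apply: (@leq_trans (K.+1 ^ #|I|.+1)); last by rewrite leq_pexp2l.
  apply: (@leq_ltn_trans ((T.+1 * K.+1) ^ #|I|)).
    have TK : (N.+1 <= T.+1 * K.+1)%N by rewrite /N mulSn mulnS; lia.
    by have [->//|n0] := posnP #|I|; rewrite leq_exp2r.
  by rewrite expnMn expnS ltn_pmul2r ?expn_gt0.
apply/negP; rewrite -leqNgt; apply: (@leq_card _ _ cell) => c c' cc'.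
apply/ffunP => j; apply: contrapT => cj.
have [uc Bc] := uP c; have [uc' Bc'] := uP c'.
have du i : `|u c i - u c' i| <= 2 * B / N%:R.
  have /(congr1 (@nat_of_ord _)) := congr1 (fun f : {ffun I -> 'I_N.+1} => f i) cc'.
  have tl x : `|x| <= B -> (Num.truncn (idx x) < N.+1)%N.
    move=> /idx0/andP[x0 xN]; rewrite ltnS -(ler_nat R); apply: le_trans xN.
    by have /andP[] := Num.Theory.truncn_itv x0.
  rewrite !ffunE !inordK ?tl// => E.
  have /andP[x0 _] := idx0 _ (uc i); have /andP[y0 _] := idx0 _ (uc' i).
  have := Num.Theory.truncn_itv x0; have := Num.Theory.truncn_itv y0; rewrite -E.
  move=> /andP[y1 y2] /andP[x1 x2].
  have h : `|idx (u c i) - idx (u c' i)| <= 1.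
    by move: x1 x2 y1 y2; rewrite -natr1 => x1 x2 y1 y2; rewrite ler_norml; lra.
  have -> : u c i - u c' i = (idx (u c i) - idx (u c' i)) * (2 * B / N%:R).
    by rewrite /idx; field; rewrite !gt_eqF.
  by rewrite normrM [X in _ * X]ger0_norm ?ler_piMl// divr_ge0// mulr_ge0// ltW.
have := lip _ _ _ _ _ (gridP c) (gridP c') uc uc' Bc Bc' du j.
rewrite /grid -mulrBl normrM [`|e / _|]ger0_norm; last by rewrite divr_ge0// ltW.
have h1 : 1 <= `|(c j)%:R - (c' j)%:R : R|.
  have : (c j != c' j :> nat) by apply/eqP => h; apply: cj; exact: val_inj.
  rewrite neq_ltn => /orP[]; rewrite -(ler_nat R) -natr1 => h.
    by rewrite ler_normr; apply/orP; right; lra.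
  by rewrite ler_normr; apply/orP; left; lra.
apply/negP; rewrite -ltNge.
apply: (@lt_le_trans _ _ (e / K%:R)); last by rewrite ler_peMl// divr_ge0// ltW.
rewrite /N natrM; rewrite ltr_pdivlMr//.
have -> : C * (2 * B / (T%:R * K%:R)) * K%:R = 2 * B * C / T%:R.
  by field; rewrite !gt_eqF ?ltr0n.
by rewrite ltr_pdivrMr ?ltr0n// [e * _]mulrC.
Qed.

(** * Symmetry of second derivatives *)

Section Schwarz.
Context {R : realType} {X : normedModType R}.
Implicit Types (f : X -> R) (A : set X).

(** The second difference of [f] is the increment over a unit interval of
    [s |-> f (z + h v + s h u) - f (z + s h u)]. The mean value theorem writes it with
    [D_u f] at two points whose difference is [h v], and [D_u f] is differentiable at
    [z]. *)
Lemma second_difference A f z u v e :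
  open A -> A z -> Cn 1 A f -> `|u| <= 1 -> `|v| <= 1 -> 0 < e ->
  \forall h \near (0 : R)^'+,
    `|f (z + h *: v + h *: u) - f (z + h *: u) - (f (z + h *: v) - f z)
      - h ^+ 2 * 'D_v ('D_u f) z| <= e * h ^+ 2.
Proof.
move=> oA Az Cf u1 v1 e0.
have dDu : differentiable ('D_u f) z := Cn_diff (Cn_derive u Cf) Az.
have e4 : 0 < e / 4 by rewrite divr_gt0.
have nA : \forall y \near z, A y by exact: open_nbhs_nbhs.
have /nbhs_ballP[r /= r0 rP] : \forall y \near z, A y /\
    `|'D_u f y - 'D_u f z - 'd ('D_u f) z (y - z)| <= e / 4 * `|y - z|.
  exact: (filterI nA (differentiable_eps dDu e4)).
near=> h.
have h0 : 0 < h by near: h; exact: nbhs_right_gt.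
have hr : h < r / 2 by near: h; apply: nbhs_right_lt; rewrite divr_gt0.
have near_z w t : 0 <= t <= 1 -> `|w| <= h ->
    ball z r (z + w + t *: (h *: u)) /\ `|z + w + t *: (h *: u) - z| <= 2 * h.
  move=> /andP[t0 t1] wh.
  have N : `|z + w + t *: (h *: u) - z| <= 2 * h.
    have -> : z + w + t *: (h *: u) - z = w + t *: (h *: u)
      by rewrite addrAC [z + w]addrC addrK.
    apply: le_trans (ler_normD _ _) _; rewrite !normrZ (ger0_norm t0) (gtr0_norm h0).
    have tu : t * (h * `|u|) <= h by rewrite mulrCA ger_pMr// mulr_ile1.
    lra.
  by split=> //; rewrite -ball_normE /= distrC; lra.
pose k s := f (z + h *: v + s *: (h *: u)) - f (z + 0 + s *: (h *: u)).
have hv : `|h *: v| <= h by rewrite normrZ (gtr0_norm h0) ger_pMr.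
have h00 : `|0 : X| <= h by rewrite normr0 ltW.
have dk (s : R) : 0 <= s <= 1 -> is_derive s (1 : R) k
   ('D_(h *: u) f (z + h *: v + s *: (h *: u)) - 'D_(h *: u) f (z + 0 + s *: (h *: u))).
  move=> s01; have [/rP[A1 _] _] := near_z _ _ s01 hv;
    have [/rP[A2 _] _] := near_z _ _ s01 h00.
  by apply: is_deriveB; apply: derive_segment; exact: Cn_diff Cf _.
have dk_oo (s : R) : s \in `]0, 1[ -> is_derive s (1 : R) k
   ('D_(h *: u) f (z + h *: v + s *: (h *: u)) - 'D_(h *: u) f (z + 0 + s *: (h *: u))).
  by move=> /subset_itv_oo_cc; rewrite in_itv /=; exact: dk.
have ck : {within `[0, 1], continuous k}.
  apply: continuous_in_subspaceT => t; rewrite inE /= in_itv /= => t01.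
  by apply: differentiable_continuous; apply/derivable1_diffP; have [] := dk t t01.
have [s s01] := MVT_segment ler01 dk_oo ck.
rewrite in_itv /= in s01.
have [/[dup] B1 /rP[A1 E1] N1] := near_z _ _ s01 hv; have [/[dup] B2 /rP[A2 E2] N2] :=
  near_z _ _ s01 h00.
rewrite /k !scale1r !scale0r !addr0 subr0 mulr1 => ->.
rewrite addr0 in E2 N2 A2 B2.
set q1 := z + h *: v + _ in E1 N1 A1 B1 *; set q2 := z + _ in E2 N2 A2 B2 *.
have Dh q : A q -> 'D_(h *: u) f q = h * 'D_u f q.
  by move=> Aq; rewrite !deriveE ?linearZ//; exact: Cn_diff Cf Aq.
rewrite !Dh//.
have EL : 'd ('D_u f) z (q1 - z) - 'd ('D_u f) z (q2 - z) = h * 'D_v ('D_u f) z.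
  rewrite -linearB (deriveE _ dDu) (_ : q1 - z - (q2 - z) = h *: v) ?linearZ//.
  by rewrite opprB addrA subrK /q1 /q2 opprD addrACA subrr addr0 addrAC subrr add0r.
have -> : h * 'D_u f q1 - h * 'D_u f q2 - h ^+ 2 * 'D_v ('D_u f) z =
   h * (('D_u f q1 - 'D_u f z - 'd ('D_u f) z (q1 - z)) -
        ('D_u f q2 - 'D_u f z - 'd ('D_u f) z (q2 - z))).
  by rewrite expr2 -mulrA -EL; ring.
rewrite normrM gtr0_norm// [e * _]mulrC expr2 -mulrA ler_pM2l//.
apply: le_trans (ler_normB _ _) _; nra.
Unshelve. all: by end_near. Qed.

(** The second difference is symmetric in [u] and [v]. *)
Lemma schwarz A f z u v : open A -> A z -> Cn 1 A f -> `|u| <= 1 -> `|v| <= 1 ->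
  'D_u ('D_v f) z = 'D_v ('D_u f) z.
Proof.
move=> oA Az Cf u1 v1; apply/eqP; rewrite -subr_eq0 -normr_le0; apply/ler_addgt0Pl => e e0;
  rewrite addr0.
have e2 : 0 < e / 2 by rewrite divr_gt0.
have H1 := second_difference oA Az Cf u1 v1 e2;
  have H2 := second_difference oA Az Cf v1 u1 e2.
have [h [h0 [h1 h2]]] : exists h : R, 0 < h /\
  (`|f (z + h *: v + h *: u) - f (z + h *: u) - (f (z + h *: v) - f z)
      - h ^+ 2 * 'D_v ('D_u f) z| <= e / 2 * h ^+ 2 /\
  `|f (z + h *: u + h *: v) - f (z + h *: v) - (f (z + h *: u) - f z)
      - h ^+ 2 * 'D_u ('D_v f) z| <= e / 2 * h ^+ 2).
  apply: (@filter_ex _ (0 : R)^'+); exact: (filterI (nbhs_right_gt _) (filterI H1 H2)).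
rewrite (addrAC z (h *: u) (h *: v)) in h2.
move: h1 h2; set a := f _; set b := f _; set c := f _; set d := f _.
set x := 'D_v _ _; set y := 'D_u _ _ => h1 h2; clearbody a b c d x y.
have hh : 0 < h ^+ 2 by rewrite exprn_gt0.
rewrite -(ler_pM2l hh) -[X in X * `|_|]gtr0_norm// -normrM [_ * e]mulrC.
have -> : h ^+ 2 * (y - x) = (a - b - (c - d) - h ^+ 2 * x) - (a - c - (b - d) - h ^+ 2 * y)
  by ring.
apply: le_trans (ler_normB _ _) _; move: h1 h2;
by move: `|_| `|_| => p q h1 h2; lra.
Qed.

End Schwarz.

(** * Parametrisation of the degenerate jets *)

Section BadJets.
Context {R : realType}.
Implicit Types (u v w : plane R).

(** When [c] runs from -1 to 3, this follows two sides of the boundary of the unit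
    square, from [(1, -1)] through [(1, 1)] to [(-1, 1)], and so meets every line
    through the origin. *)
Definition dir (c : R) : plane R := (Num.min 1 (2 - c), Num.min 1 c).

Lemma dir_le1 c : c <= 1 -> dir c = (1, c).
Proof. by move=> c1; rewrite /dir min_l ?min_r//; lra. Qed.

Lemma dir_ge1 c : 1 <= c -> dir c = (2 - c, 1).
Proof. by move=> c1; rewrite /dir min_r ?min_l//; lra. Qed.

(** Dividing the vector [u] (or [v], if [u = 0]) by its largest coordinate brings it to
    the path [dir]. *)
Lemma parallel u v : u.1 * v.2 = u.2 * v.1 -> exists c s t,
  [/\ -1 <= c <= 3, u = s *: dir c, v = t *: dir c, `|s| <= `|u| & `|t| <= `|v|].
Proof.
have H u' v' : u'.1 * v'.2 = u'.2 * v'.1 -> u' != 0 -> exists c s t,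
  [/\ -1 <= c <= 3, u' = s *: dir c, v' = t *: dir c, `|s| <= `|u'| & `|t| <= `|v'|].
  case: u' v' => [a b] [x y] /= E un0.
  have [ba|ab] := leP `|b| `|a|.
    have a0 : a != 0.
      apply: contra_neq un0 => a0; rewrite a0 normr0 normr_le0 in ba.
      by rewrite a0 (eqP ba).
    have c1 : `|b / a| <= 1 by rewrite normrM normfV ler_pdivrMr ?normr_gt0// mul1r.
    move: c1; rewrite ler_norml => /andP[c1 c2].
    exists (b / a), a, x; rewrite dir_le1//; split.
    - by apply/andP; split; lra.
    - by apply: pairP; rewrite /= /GRing.scale /=; field.
    - apply: pairP; rewrite /= /GRing.scale /=; first by ring.
      have -> : y = (a * y) / a by field.
      by rewrite E; ring.
    - exact: (@pair_norm1 R R R (a, b)).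
    - exact: (@pair_norm1 R R R (x, y)).
  have b0 : b != 0 by apply: contraTneq ab => ->; rewrite normr0 ltNge normr_ge0.
  have c1 : `|a / b| <= 1 by rewrite normrM normfV ler_pdivrMr ?normr_gt0// mul1r ltW.
  move: c1; rewrite ler_norml => /andP[c1 c2].
  exists (2 - a / b), b, y; rewrite dir_ge1; last by lra.
  have -> : 2 - (2 - a / b) = a / b by ring.
  split.
  - by apply/andP; split; lra.
  - by apply: pairP; rewrite /= /GRing.scale /=; field.
  - apply: pairP; rewrite /= /GRing.scale /=; last by ring.
    have -> : x = (b * x) / b by field.
    by rewrite -E; ring.
  - exact: (@pair_norm2 R R R (a, b)).
  - exact: (@pair_norm2 R R R (x, y)).
move=> E; have [u0|u0] := eqVneq u 0; last exact: H.
have [v0|v0] := eqVneq v 0.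
  exists 0, 0, 0; rewrite u0 v0 !scale0r !normr0; split=> //; lra.
have [|c [t [s [c1 e1 e2 b1 b2]]]] := H v u _ v0; first by rewrite mulrC -E mulrC.
by exists c, s, t.
Qed.

Lemma dir_norm c : -1 <= c <= 3 ->
  [/\ `|(dir c).1| <= 1, `|(dir c).2| <= 1 & 1 <= (dir c).1 ^+ 2 + (dir c).2 ^+ 2].
Proof.
move=> /andP[c1 c3]; have [h|h] := leP c 1.
  by rewrite dir_le1//= normr1 ler_norml; split=> //; [apply/andP; split; lra | nra].
rewrite dir_ge1; last exact: ltW.
rewrite /= normr1 ler_norml; split=> //;
  [apply/andP; split; lra | by rewrite expr1n lerDr sqr_ge0].
Qed.

Definition det2 u v := u.1 * v.2 - u.2 * v.1.

(** Here [w1], [w2], [A], [B] stand for [psi_x], [psi_y], [psi_xx], [psi_xy] at a zero;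
    the two equations say that [J = 0] and that [{J, p1} = {J, p2} = 0], with
    [psi_yy = - A]. The 2x2 matrix with rows [w1] and [w2] has rank at most one: its
    entries are [s] times the products of the coordinates of [dir c] and [dir e]. If
    [s <> 0], the condition on the gradient of [J] says that
    [(a ^ 2 - b ^ 2) A + 2 a b B] is parallel to [dir e] as well; if [s = 0], the
    direction [dir e] is free and can be chosen so. The other combination of [A] and
    [B], which is [q] up to a factor, is arbitrary. The eight real numbers thus depend
    on six: [c], [e], [s], [t] and the coordinates of [q]. The bounds show that the
    parameters stay in a fixed box as long as the jet is bounded. *)
Lemma bad_jet (w1 w2 A B : plane R) m :
  `|w1| <= m -> `|w2| <= m -> `|A| <= m -> `|B| <= m ->
  det2 w1 w2 = 0 ->
  (det2 A w2 + det2 w1 B) *: w2 = (det2 B w2 - det2 w1 A) *: w1 ->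
  exists c e s t q,
    [/\ -1 <= c <= 3, -1 <= e <= 3, `|s| <= m, `|t| <= 3 * m & `|q| <= 3 * m] /\
   let a := (dir c).1 in let b := (dir c).2 in
   [/\ w1 = (s * a) *: dir e, w2 = (s * b) *: dir e,
      A = (t * (a ^+ 2 - b ^+ 2)) *: dir e - (2 * a * b) *: q &
      B = (t * (2 * a * b)) *: dir e + (a ^+ 2 - b ^+ 2) *: q].
Proof.
move=> w1m w2m Am Bm D0 [E1 E2].
have [c [x [y [cP h1 h2 hx hy]]]] : exists c s t, [/\ -1 <= c <= 3,
  (w1.1, w2.1) = s *: dir c, (w1.2, w2.2) = t *: dir c,
     `|s| <= `|(w1.1, w2.1)| & `|t| <= `|(w1.2, w2.2)|].
  by apply: parallel => /=; move: D0; rewrite /det2; lra.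
have {}hx : `|x| <= m.
  by apply: le_trans hx _; rewrite pair_normP /=; apply/andP; split;
    [apply: le_trans w1m|apply: le_trans w2m]; exact: pair_norm1.
have {}hy : `|y| <= m.
  by apply: le_trans hy _; rewrite pair_normP /=; apply/andP; split;
    [apply: le_trans w1m|apply: le_trans w2m]; exact: pair_norm2.
have [a1 b1 ab] := dir_norm cP.
set a := (dir c).1 in a1 ab *; set b := (dir c).2 in b1 ab *.
have e11 : w1.1 = x * a by have := congr1 fst h1.
have e21 : w2.1 = x * b by have := congr1 snd h1.
have e12 : w1.2 = y * a by have := congr1 fst h2.
have e22 : w2.2 = y * b by have := congr1 snd h2.
(* The combination of A and B that the gradient condition constrains: it says that x r =
   y r = 0 for the determinant r of (x, y) and U. *)
pose U := (a ^+ 2 - b ^+ 2) *: A + (2 * a * b) *: B.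
have P : (x, y).1 * U.2 = (x, y).2 * U.1.
  pose r := x * U.2 - y * U.1.
  have rE : r = x * ((a ^+ 2 - b ^+ 2) * A.2 + 2 * a * b * B.2) -
      y * ((a ^+ 2 - b ^+ 2) * A.1 + 2 * a * b * B.1) by [].
  have xr : x * r = 0.
    by move: E1; rewrite /GRing.scale /= /det2 rE e11 e21 e12 e22 => E1; lra.
  have yr : y * r = 0.
    by move: E2; rewrite /GRing.scale /= /det2 rE e11 e21 e12 e22 => E2; lra.
  have : r ^+ 2 = 0.
    by rewrite expr2 {1}/r mulrBl -mulrA -[y * _ * _]mulrA ![_.2 * r]mulrC ![_.1 *
      r]mulrC !mulrA xr yr !mul0r subrr.
  by move=> /eqP; rewrite expf_eq0 /= /r subr_eq0 => /eqP.
have [e [s [t' [eP g1 g2 hs ht]]]] := parallel P.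
have [e1m e2m _] := dir_norm eP.
(* The determinant of the scaled rotation, with entries a ^ 2 - b ^ 2 and 2 a b up to
   sign, that maps (A, B) to U and a multiple of q. *)
pose D := (a ^+ 2 + b ^+ 2) ^+ 2.
have D1 : 1 <= D by rewrite /D exprn_ege1.
have S0 : a ^+ 2 + b ^+ 2 != 0 by rewrite gt_eqF// (lt_le_trans ltr01).
have c1 : `|a ^+ 2 - b ^+ 2| <= 1.
  by move: a1 b1; rewrite !ler_norml => /andP[? ?] /andP[? ?]; apply/andP; split; nra.
have c2 : `|2 * a * b| <= 2.
  by rewrite !normrM normr_nat -mulrA ler_piMr// mulr_ile1.
have m0 : 0 <= m by apply: le_trans w1m.
(* The coefficients of the combinations of A and B are at most 1 and 2. *)
have cb (p q : R) : `|p| <= 1 -> `|q| <= 2 -> forall v w, `|v| <= m -> `|w| <= m ->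
  `|p *: v + q *: w| <= 3 * m.
  move=> hp hq v w hv hw; apply: le_trans (ler_normD _ _) _; rewrite !normrZ.
  have := normr_ge0 p; have := normr_ge0 q; have := normr_ge0 v; have := normr_ge0 w; nra.
have Di : `|D^-1| <= 1
  by rewrite normfV (ger0_norm (le_trans ler01 D1)) invf_le1// (lt_le_trans ltr01).
exists c, e, s, (t' / D), (D^-1 *: ((- (2 * a * b)) *: A + (a ^+ 2 - b ^+ 2) *: B)); split.
  split=> //.
  - by apply: le_trans hs _; rewrite pair_normP /= hx hy.
  - rewrite normrM; apply: (@le_trans _ _ `|t'|); first by rewrite ler_piMr.
    by apply: le_trans ht _; exact: cb.
  rewrite normrZ; apply: le_trans (ler_piMl (normr_ge0 _) Di) _.
  by rewrite addrC; apply: cb => //; rewrite normrN.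
have u1 : U.1 = t' * (dir e).1 by rewrite g2.
have u2 : U.2 = t' * (dir e).2 by rewrite g2.
have x1 : x = s * (dir e).1 by have := congr1 fst g1.
have y1 : y = s * (dir e).2 by have := congr1 snd g1.
have sc (r : R) (v : plane R) : (r *: v).1 = r * v.1 /\ (r *: v).2 = r * v.2 by [].
move: u1 u2 x1 y1; move: (dir e) => de u1 u2 x1 y1; cbv zeta; rewrite -/a -/b;
  clearbody a b; split; apply: pairP; rewrite /= /GRing.scale /=.
- by rewrite e11 x1; ring.
- by rewrite e12 y1; ring.
- by rewrite e21 x1; ring.
- by rewrite e22 y1; ring.
- rewrite (_ : t' / D * _ * _ = (a ^+ 2 - b ^+ 2) / D * (t' * de.1)); last by ring.
  by rewrite -u1 /U /= /GRing.scale /=; rewrite /D; field.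
- rewrite (_ : t' / D * _ * _ = (a ^+ 2 - b ^+ 2) / D * (t' * de.2)); last by ring.
  by rewrite -u2 /U /= /GRing.scale /=; rewrite /D; field.
- rewrite (_ : t' / D * _ * _ = (2 * a * b) / D * (t' * de.1)); last by ring.
  by rewrite -u1 /U /= /GRing.scale /=; rewrite /D; field.
rewrite (_ : t' / D * _ * _ = (2 * a * b) / D * (t' * de.2)); last by ring.
by rewrite -u2 /U /= /GRing.scale /=; rewrite /D; field.
Qed.

End BadJets.

(** * Helmholtz functions with prescribed 2-jets *)

Section Waves.
Context {R : realType}.
Variables (z0 : plane R).

(** The solutions of [f'' = - al ^ 2 f], normalised so that their jet at [c] can be read
    off. Differentiation only changes the coefficients [a] and [b]. *)
Definition trig (a b al c s : R) : R := a * cos (al * (s - c)) + b * sin (al * (s - c)).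

Lemma is_derive_trig a b al c (s : R) :
  is_derive s (1 : R) (trig a b al c) (trig (b * al) (- (a * al)) al c s).
Proof.
have di : is_derive s (1:R) (fun s => al * (s - c)) al.
  by apply: is_derive_eq; rewrite ?subr0 /GRing.scale/= ?mulr1 ?mulr0 ?addr0.
have dc : is_derive s (1:R) (fun s => cos (al * (s - c))) (- sin (al * (s - c)) * al).
  exact: (is_derive1_comp (is_derive_cos _) di).
have ds : is_derive s (1:R) (fun s => sin (al * (s - c))) (cos (al * (s - c)) * al).
  exact: (is_derive1_comp (is_derive_sin _) di).
rewrite /trig; apply: is_derive_eq; rewrite /GRing.scale/=; ring.
Qed.

Definition wave a1 b1 al a2 b2 be (z : plane R) : R :=
  trig a1 b1 al z0.1 z.1 * trig a2 b2 be z0.2 z.2.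

Lemma wave_center a1 b1 al a2 b2 be : wave a1 b1 al a2 b2 be z0 = a1 * a2.
Proof. by rewrite /wave /trig !subrr !mulr0 sin0 cos0 !mulr1 !mulr0 !addr0. Qed.

Lemma Cn_trig n (h : plane R -> R) a b al c : (forall n, Cn n setT h) ->
  Cn n setT (fun z => trig a b al c (h z)).
Proof.
move=> Ch; have oT := @openT (plane R).
have Cl : Cn n setT (fun z => al * (h z - c)).
  apply: Cn_scale => //; apply: (@Cn_add _ _ _ _ _ _ (fun _ => - c)) => //; exact: Cn_cst.
have [Cs Cc] := Cn_sin_cos oT Cl.
by apply: Cn_add => //; apply: Cn_scale.
Qed.

Lemma Cn_wave n a1 b1 al a2 b2 be : Cn n setT (wave a1 b1 al a2 b2 be).
Proof.
have oT := @openT (plane R).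
by apply: Cn_mul => //; apply: Cn_trig => m; [exact: Cn_fst | exact: Cn_snd].
Qed.

Lemma derive_wave a1 b1 al a2 b2 be v z : 'D_v (wave a1 b1 al a2 b2 be) z =
  v.1 * wave (b1 * al) (- (a1 * al)) al a2 b2 be z +
  v.2 * wave a1 b1 al (b2 * be) (- (a2 * be)) be z.
Proof.
have [d1 D1] := differentiable_fst z; have [d2 D2] := differentiable_snd z.
have [E1 dt1] := derive_comp1 v (is_derive_trig a1 b1 al z0.1 z.1) d1.
have [E2 dt2] := derive_comp1 v (is_derive_trig a2 b2 be z0.2 z.2) d2.
have -> : wave a1 b1 al a2 b2 be = (trig a1 b1 al z0.1 \o fst) * (trig a2 b2 be z0.2 \o snd)
  by [].
rewrite deriveM; [|exact: diff_derivable|exact: diff_derivable].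
rewrite E1 E2 D1 D2 /wave /comp /GRing.scale /=.
by move: (trig _ _ _ _ _) (trig _ _ _ _ _) (trig _ _ _ _ _) (trig _ _ _ _ _) => *; ring.
Qed.

(** The functions needed below are sums of at most two waves. Their derivatives are
    again such sums, whose parameters are obtained from those of [q] and [q'] by the
    maps [dx] and [dy]. *)
Definition wave2 (q : (R * R * R) * (R * R * R)) (q' : (R * R * R) * (R * R * R))
  (z : plane R) : R :=
  wave q.1.1.1 q.1.1.2 q.1.2 q.2.1.1 q.2.1.2 q.2.2 z +
  wave q'.1.1.1 q'.1.1.2 q'.1.2 q'.2.1.1 q'.2.1.2 q'.2.2 z.

Let dx (q : (R * R * R) * (R * R * R)) :=
  ((q.1.1.2 * q.1.2, - (q.1.1.1 * q.1.2), q.1.2), q.2).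
Let dy (q : (R * R * R) * (R * R * R)) :=
  (q.1, (q.2.1.2 * q.2.2, - (q.2.1.1 * q.2.2), q.2.2)).

Lemma Cn_wave2 n q q' : Cn n setT (wave2 q q').
Proof. by apply: Cn_add; [exact: openT | exact: Cn_wave | exact: Cn_wave]. Qed.

Lemma derive_wave2 q q' v z : 'D_v (wave2 q q') z =
  v.1 * wave2 (dx q) (dx q') z + v.2 * wave2 (dy q) (dy q') z.
Proof.
case: q => [[[a1 b1] al] [[a2 b2] be]]; case: q' => [[[a1' b1'] al'] [[a2' b2'] be']].
have -> : wave2 (a1, b1, al, (a2, b2, be)) (a1', b1', al', (a2', b2', be')) =
  wave a1 b1 al a2 b2 be + wave a1' b1' al' a2' b2' be' by [].
have d1 : differentiable (wave a1 b1 al a2 b2 be) z by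
  exact: (Cn_diff (Cn_wave 0 _ _ _ _ _ _)).
have d2 : differentiable (wave a1' b1' al' a2' b2' be') z by
  exact: (Cn_diff (Cn_wave 0 _ _ _ _ _ _)).
rewrite (deriveD (diff_derivable (v := v) d1) (diff_derivable (v := v) d2)) !derive_wave
  /wave2 /dx /dy /=.
move: (wave _ _ _ _ _ _ z) (wave _ _ _ _ _ _ z) (wave _ _ _ _ _ _ z) (wave _ _ _ _ _ _ z) =>
  *; ring.
Qed.

Lemma wave2_xz q q' z : 'D_e_x (wave2 q q') z = wave2 (dx q) (dx q') z.
Proof. by rewrite derive_wave2 /= mul1r mul0r addr0. Qed.

Lemma wave2_yz q q' z : 'D_e_y (wave2 q q') z = wave2 (dy q) (dy q') z.
Proof. by rewrite derive_wave2 /= mul1r mul0r add0r. Qed.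

Lemma wave2_x q q' : 'D_e_x (wave2 q q') = wave2 (dx q) (dx q').
Proof. by apply/funext => z; exact: wave2_xz. Qed.

Lemma wave2_y q q' : 'D_e_y (wave2 q q') = wave2 (dy q) (dy q').
Proof. by apply/funext => z; exact: wave2_yz. Qed.

Lemma wave2_helmholtz q q' k z : q.1.2 ^+ 2 + q.2.2 ^+ 2 = k ^+ 2 ->
  q'.1.2 ^+ 2 + q'.2.2 ^+ 2 = k ^+ 2 ->
  'D_e_x ('D_e_x (wave2 q q')) z + 'D_e_y ('D_e_y (wave2 q q')) z +
    k ^+ 2 * wave2 q q' z = 0.
Proof.
move=> e1 e2;
  rewrite (wave2_x q q') (wave2_xz (dx q) (dx q')) (wave2_y q q') (wave2_yz (dy q) (dy q')).
rewrite (_ : k ^+ 2 * wave2 q q' z =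
  (q.1.2 ^+ 2 + q.2.2 ^+ 2) * wave q.1.1.1 q.1.1.2 q.1.2 q.2.1.1 q.2.1.2 q.2.2 z +
  (q'.1.2 ^+ 2 + q'.2.2 ^+ 2) * wave q'.1.1.1 q'.1.1.2 q'.1.2 q'.2.1.1 q'.2.1.2 q'.2.2 z);
  last by rewrite e1 e2 /wave2 mulrDr.
case: q {e1} => [[[a1 b1] al] [[a2 b2] be]];
  case: q' {e2} => [[[a1' b1'] al'] [[a2' b2'] be']].
rewrite /wave2 /dx /dy /= /wave /trig.
move: (cos _) (sin _) (cos _) (sin _) (cos _) (sin _) (cos _) (sin _) => *; ring.
Qed.

(** The derivative [f_yy] is left out because the Helmholtz equation determines it. *)
Definition jet2 (f : plane R -> R) : R * R * R * R * R :=
  (f z0, 'D_e_x f z0, 'D_e_y f z0, 'D_e_x ('D_e_x f) z0, 'D_e_x ('D_e_y f) z0).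

(** With [(X, Y)] the coordinates centred at [z0] and [c ^ 2 = k ^ 2 / 2], the five
    functions are [cos kY], [(sin kX) / k], [(sin kY) / k], [(cos kY - cos kX) / k ^ 2]
    and [(sin cX) (sin cY) / c ^ 2]. *)
Lemma helmholtz_basis (k : R) : 0 < k -> exists chi : 'I_5 -> plane R -> R,
  [/\ forall l n, Cn n setT (chi l),
      forall l z, 'D_e_x ('D_e_x (chi l)) z + 'D_e_y ('D_e_y (chi l)) z +
        k ^+ 2 * chi l z = 0 &
      forall l : 'I_5, jet2 (chi l) = ((l == 0 :> nat)%:R, (l == 1 :> nat)%:R,
        (l == 2 :> nat)%:R, (l == 3 :> nat)%:R, (l == 4 :> nat)%:R)].
Proof.
move=> k0; have kn : k != 0 by rewrite gt_eqF.
pose c := Num.sqrt (k ^+ 2 / 2).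
have cE : c ^+ 2 = k ^+ 2 / 2 by rewrite sqr_sqrtr// divr_ge0// exprn_ge0// ltW.
have cn : c != 0 by rewrite -sqrf_eq0 cE mulf_neq0// expf_neq0.
(* Zero amplitudes; the frequencies (0, k) meet the condition of wave2_helmholtz. *)
pose Z : (R * R * R) * (R * R * R) := ((0, 0, 0), (0, 0, k)).
pose q : seq (((R * R * R) * (R * R * R)) * ((R * R * R) * (R * R * R))) :=
  [:: (((1, 0, 0), (1, 0, k)), Z); (((0, k^-1, k), (1, 0, 0)), Z);
      (((1, 0, 0), (0, k^-1, k)), Z);
      (((- k^-2, 0, k), (1, 0, 0)), ((1, 0, 0), (k^-2, 0, k)));
      (((0, 1, c), (0, c^-2, c)), Z)].
exists (fun l => wave2 (nth (Z, Z) q l).1 (nth (Z, Z) q l).2); split=> [l n|l z|l].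
- exact: Cn_wave2.
- by apply: wave2_helmholtz; case: l => [[|[|[|[|[|//]]]]] l5] /=;
    rewrite ?expr0n /= ?add0r ?addr0 ?cE //; field.
set a := (nth _ q l).1; set b := (nth _ q l).2.
rewrite /jet2 (wave2_x a b) (wave2_xz (dx a) (dx b)) (wave2_y a b) (wave2_xz (dy a) (dy b))
  (wave2_xz a b) (wave2_yz a b).
rewrite /wave2 !wave_center /a /b /dx /dy {a b}.
by case: l => [[|[|[|[|[|//]]]]] l5] /=; congr (_, _, _, _, _); field.
Qed.

End Waves.

(** * Zeros of families in terms of jets *)

Section Slices.
Context {R : realType}.
Implicit Types (F : spacetime R -> plane R).

Definition X_dir : spacetime R := (e_x, 0).
Definition Y_dir : spacetime R := (e_y, 0).

Lemma slice_derivez (W : normedModType R) (F : spacetime R -> W) (l : R) (v z : plane R) :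
  'D_v (fun z => F (z, l)) z = 'D_((v, 0) : spacetime R) F (z, l).
Proof.
rewrite /derive.
have -> // : (fun h : R => h^-1 *: (((fun z => F (z, l)) \o shift z) (h *: v) - F (z, l))) =
  (fun h : R => h^-1 *: ((F \o shift (z, l)) (h *: ((v, 0) : spacetime R)) - F (z, l))).
apply/funext => h /=; congr (_ *: (F _ - _)).
by apply: pairP; rewrite //= /GRing.scale/= mulr0 add0r.
Qed.

Lemma slice_derive (W : normedModType R) (F : spacetime R -> W) (l : R) (v : plane R) :
  'D_v (fun z => F (z, l)) = fun z => 'D_((v, 0) : spacetime R) F (z, l).
Proof. by apply/funext => z; exact: slice_derivez. Qed.

Lemma slice_differentiable (W : normedModType R) (F : spacetime R -> W) l z :
  differentiable F (z, l) -> differentiable (fun z => F (z, l)) z.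
Proof.
move=> dF; apply: (differentiable_comp (f := fun z => (z, l)) _ dF).
exact: differentiable_pair.
Qed.

Lemma Cn_slice (W : normedModType R) n (V : set (spacetime R)) (F : spacetime R -> W) l :
  Cn n V F -> Cn n [set z | V (z, l)] (fun z => F (z, l)).
Proof.
elim: n F => [|n IHn] F [dF DF].
  by split=> // z Vz; apply: slice_differentiable; exact: dF.
split=> [z Vz|v]; first by apply: slice_differentiable; exact: dF.
by rewrite slice_derive; exact: IHn (DF _).
Qed.

Lemma open_slice (V : set (spacetime R)) l : open V -> open [set z | V (z, l)].
Proof.
move=> oV; rewrite openE => z Vz; have nV : nbhs (z, l) V by exact: open_nbhs_nbhs.
have c : {for z, continuous (fun z : plane R => (z, l))}.
  by apply: (@cvg_pair _ _ _ (nbhs z) (nbhs z) (nbhs l)); [exact: cvg_id | exact: cvg_cst].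
exact: (c _ nV).
Qed.

Lemma norm_e_x : `|e_x : plane R| <= 1.
Proof. by rewrite pair_normP /= normr1 normr0 lexx ler01. Qed.

Lemma norm_e_y : `|e_y : plane R| <= 1.
Proof. by rewrite pair_normP /= normr1 normr0 lexx ler01. Qed.

(** With [psi_yy = - psi_xx] and the symmetry of second derivatives, the Jacobian [J]
    and its gradient are polynomials in the jet, and the last case says that [J],
    [{J, p1}] and [{J, p2}] vanish. *)
Lemma jet_classification (V : set (spacetime R)) F p :
  open V -> V p -> (forall n, Cn n V F) ->
  F p = 0 -> 'D_X_dir ('D_X_dir F) p + 'D_Y_dir ('D_Y_dir F) p = 0 ->
  let w1 := 'D_X_dir F p in let w2 := 'D_Y_dir F p in
  let A := 'D_X_dir ('D_X_dir F) p in let B := 'D_X_dir ('D_Y_dir F) p in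
  [\/ radially_equivalent_at F p regular_singularity,
      radially_equivalent_at F p hyperbolic_singularity |
      det2 w1 w2 = 0 /\ (det2 A w2 + det2 w1 B) *: w2 = (det2 B w2 - det2 w1 A) *: w1].
Proof.
case: p => z l oV Vz CF F0 lap.
pose N := [set z | V (z, l)]; have oN : open N by exact: open_slice.
pose psi (z : plane R) := F (z, l).
have Cpsi n : Cn n N psi by exact: Cn_slice.
pose p1 := fst \o psi; pose p2 := snd \o psi.
have C1 n : Cn n N p1 by have [] := Cn_components oN (Cpsi n).
have C2 n : Cn n N p2 by have [] := Cn_components oN (Cpsi n).
have D1 v y : N y -> 'D_v p1 y = ('D_((v, 0) : spacetime R) F (y, l)).1 /\
    'D_v p2 y = ('D_((v, 0) : spacetime R) F (y, l)).2.
  move=> Ny; have [_ _ /(_ v)[-> ->]] := derive_components (Cn_diff (Cpsi 0%N) Ny).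
  by rewrite (slice_derivez F l v y).
have D2 u v : 'D_u ('D_v p1) z =
  ('D_((u, 0) : spacetime R) ('D_((v, 0) : spacetime R) F) (z, l)).1 /\
     'D_u ('D_v p2) z = ('D_((u, 0) : spacetime R) ('D_((v, 0) : spacetime R) F) (z, l)).2.
  have CD : Cn 0 N (fun y => 'D_((v, 0) : spacetime R) F (y, l)).
    exact: (@Cn_slice _ 0 V ('D_((v, 0) : spacetime R) F) l (Cn_derive _ (CF 1%N))).
  have [_ _ /(_ u)] := derive_components (Cn_diff CD Vz).
  rewrite (slice_derivez ('D_((v, 0) : spacetime R) F) l u z) => -[<- <-].
  by split; apply: near_eq_derive; apply: filterS (open_nbhs_nbhs (conj oN Vz)) => y Ny;
    have [] := D1 v y Ny.
have S (k : plane R -> R) : (forall n, Cn n N k) ->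
  'D_e_y ('D_e_x k) z = 'D_e_x ('D_e_y k) z.
  by move=> Ck; exact: (schwarz oN Vz (Ck 1%N) norm_e_y norm_e_x).
move=> w1 w2 A B.
have x1 : 'D_e_x p1 z = w1.1 by have [] := D1 e_x z Vz.
have x2 : 'D_e_x p2 z = w1.2 by have [] := D1 e_x z Vz.
have y1 : 'D_e_y p1 z = w2.1 by have [] := D1 e_y z Vz.
have y2 : 'D_e_y p2 z = w2.2 by have [] := D1 e_y z Vz.
have xx1 : 'D_e_x ('D_e_x p1) z = A.1 by have [] := D2 e_x e_x.
have xx2 : 'D_e_x ('D_e_x p2) z = A.2 by have [] := D2 e_x e_x.
have xy1 : 'D_e_x ('D_e_y p1) z = B.1 by have [] := D2 e_x e_y.
have xy2 : 'D_e_x ('D_e_y p2) z = B.2 by have [] := D2 e_x e_y.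
have yx1 : 'D_e_y ('D_e_x p1) z = B.1 by rewrite S.
have yx2 : 'D_e_y ('D_e_x p2) z = B.2 by rewrite S.
have lap1 : 'D_e_x ('D_e_x p1) z + 'D_e_y ('D_e_y p1) z = 0.
  by have [-> _] := D2 e_x e_x; have [-> _] := D2 e_y e_y; exact: (congr1 fst lap).
have lap2 : 'D_e_x ('D_e_x p2) z + 'D_e_y ('D_e_y p2) z = 0.
  by have [_ ->] := D2 e_x e_x; have [_ ->] := D2 e_y e_y; exact: (congr1 snd lap).
have yy1 : 'D_e_y ('D_e_y p1) z = - A.1 by rewrite -xx1; apply/eqP;
  rewrite -addr_eq0 addrC lap1.
have yy2 : 'D_e_y ('D_e_y p2) z = - A.2 by rewrite -xx2; apply/eqP;
  rewrite -addr_eq0 addrC lap2.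
have p10 : p1 z = 0 by rewrite /p1 /= /psi F0.
have p20 : p2 z = 0 by rewrite /p2 /= /psi F0.
have eqv phi : equivalent_to p1 p2 z phi -> radially_equivalent_at F (z, l) phi.
  move=> [sigma [tau [ls rt E]]]; exists sigma, tau; split=> //.
  by apply: filterS E => y <-; rewrite /p1 /p2 /= -surjective_pairing.
have reg := regular_case oN Vz C1 C2 p10 p20.
have deg := degenerate_classification oN Vz C1 C2 p10 p20 lap1 lap2.
clear D1 D2 lap1 lap2 Cpsi S; clearbody p1 p2 w1 w2 A B.
have JE : jac p1 p2 z = det2 w1 w2 by rewrite /jac x1 x2 y1 y2 /det2; ring.
have Jx : 'D_e_x (jac p1 p2) z = det2 A w2 + det2 w1 B.
  rewrite (derive_jac _ Vz (C1 1%N) (C2 1%N)) xx1 xx2 xy1 xy2 x1 x2 y1 y2 /det2; ring.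
have Jy : 'D_e_y (jac p1 p2) z = det2 B w2 - det2 w1 A.
  rewrite (derive_jac _ Vz (C1 1%N) (C2 1%N)) yx1 yx2 yy1 yy2 x1 x2 y1 y2 /det2; ring.
have [J0|J0] := eqVneq (jac p1 p2 z) 0; last first.
  by apply: Or31; apply: eqv; exact: (reg J0).
have [j1|j1] := eqVneq (jac (jac p1 p2) p1 z) 0; last first.
  apply: Or32; apply: eqv; apply: (deg J0).
  by left.
have [j2|j2] := eqVneq (jac (jac p1 p2) p2 z) 0; last first.
  apply: Or32; apply: eqv; apply: (deg J0).
  by right.
apply: Or33; split; first by rewrite -JE.
move: j1 j2;
  rewrite [jac (jac p1 p2) p1 z]/jac [jac (jac p1 p2) p2 z]/jac Jx Jy x1 x2 y1 y2.
by move=> /eqP + /eqP; rewrite !subr_eq0 => /eqP j1 /eqP j2; apply: pairP.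
Qed.

End Slices.

(** * Lipschitz estimates for families and their perturbations *)

Section Families.
Context {R : realType}.

Lemma family_bound (T : finType) (Q : T -> R -> Prop) :
  (forall t C C', C <= C' -> Q t C -> Q t C') -> (forall t, exists2 C, 0 <= C & Q t C) ->
  exists2 C, 0 <= C & forall t, Q t C.
Proof.
move=> mono H.
have {H}[C HC] : {C : T -> R & forall t, 0 <= C t /\ Q t (C t)}.
  by apply: (@choice _ _ (fun t C => 0 <= C /\ Q t C)) => t; have [C C0 QC] := H t;
    exists C.
exists (\sum_t C t); first by apply: sumr_ge0 => t _; have [] := HC t.
move=> t; have [C0 Qt] := HC t; apply: mono Qt.
by rewrite (bigD1 t)//= lerDl sumr_ge0// => s _; have [] := HC s.
Qed.

(** Write [M = 1 + E] with [E] small. Let [m] be the largest of the [`|al i - al' i|].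
    Comparing the two systems in the row where it is attained gives
    [m <= m / 2 + d + 5 d], where [m / 2] comes from the five entries of [E]. *)
Lemma coefficient_lipschitz (al al' : 'I_5 -> plane R) (M M' : 'I_5 -> 'I_5 -> R) (d : R) :
  (forall i l, `|M i l - (i == l)%:R| <= 10^-1) -> (forall i l, `|M i l - M' i l| <= d) ->
  (forall l, `|al' l| <= 1) ->
  (forall i, `|\sum_l M i l *: al l - \sum_l M' i l *: al' l| <= d) ->
  forall i, `|al i - al' i| <= 12 * d.
Proof.
move=> MI MM al1 E.
(* The row in which the largest difference is attained. *)
pose i0 := [arg max_(i > (ord0 : 'I_5)) `|al i - al' i|]%O.
have i0P i : `|al i - al' i| <= `|al i0 - al' i0|.
  by rewrite /i0; case: Order.TotalTheory.arg_maxP => // j _ h; exact: h.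
suff h : `|al i0 - al' i0| <= 12 * d by move=> i; exact: le_trans (i0P i) h.
set m := `|al i0 - al' i0| in i0P *.
have sum5 (F : 'I_5 -> plane R) c : (forall l, `|F l| <= c) -> `|\sum_l F l| <= 5 * c.
  move=> Fc; apply: le_trans (ler_norm_sum _ _ _) _.
  apply: le_trans (ler_sum _ (fun l _ => Fc l)) _.
  by rewrite sumr_const card_ord mulr_natl.
have Ed : al i0 - al' i0 = \sum_l (((i0 == l)%:R - M i0 l) *: (al l - al' l)) +
   (\sum_l M i0 l *: al l - \sum_l M' i0 l *: al' l) + \sum_l ((M' i0 l - M i0 l) *: al' l).
  rewrite -sumrB -!big_split /=.
  rewrite (eq_bigr (fun l => (i0 == l)%:R *: (al l - al' l))); last first.
    move=> l _; rewrite !scalerBl !scalerBr.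
    move: ((i0 == l)%:R *: al l) ((i0 == l)%:R *: al' l) (M i0 l *: al l) (M i0 l *: al' l)
      (M' i0 l *: al' l) => p q r s t.
    by apply: pairP => /=; ring.
  rewrite (bigD1 i0)//= eqxx scale1r big1 ?addr0// => l li.
  by rewrite eq_sym (negbTE li) scale0r.
have b1 : `|\sum_l (((i0 == l)%:R - M i0 l) *: (al l - al' l))| <= 5 * (10^-1 * m).
  by apply: sum5 => l; rewrite normrZ distrC ler_pM.
have b2 : `|\sum_l ((M' i0 l - M i0 l) *: al' l)| <= 5 * d.
  apply: sum5 => l; rewrite normrZ distrC -[d]mulr1 ler_pM//.
have : m <= 5 * (10^-1 * m) + d + 5 * d.
  rewrite {1}/m Ed; apply: le_trans (ler_normD _ _) _; apply: lerD => //.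
  by apply: le_trans (ler_normD _ _) _; apply: lerD.
have -> : 5 * (10^-1 * m) = m / 2 by field.
lra.
Qed.

End Families.

Section LocalLipschitz.
Context {R : realType}.
Notation S := (spacetime R).

Definition spacetime_axes (i : 'I_3) : S :=
  if i == 0 then (e_x, 0) else if i == 1 then (e_y, 0) else (0, 1).

Lemma frame_spacetime : frame spacetime_axes.
Proof.
move=> v; exists (fun i => if i == 0 then v.1.1 else if i == 1 then v.1.2 else v.2).
  move=> i; case: ifP => _; first by apply: le_trans (pair_norm1 v); exact: pair_norm1.
  case: ifP => _; last exact: pair_norm2.
  by apply: le_trans (pair_norm1 v); exact: pair_norm2.
rewrite !big_ord_recl big_ord0 /= /spacetime_axes /= addr0; case: v => [[a b] c].
by do !apply: pairP => /=; rewrite /GRing.scale/= !(mulr0, mulr1, addr0, add0r).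
Qed.

(** The derivatives of a [C^1] function are bounded near [p0], and a ball is convex. *)
Lemma local_lipschitz1 (U : set S) (f : S -> R) p0 : open U -> U p0 -> Cn 1 U f ->
  exists2 L, 0 <= L & \forall r \near (0 : R)^'+, forall x y, ball p0 r x -> ball p0 r y ->
    `|f y - f x| <= L * `|y - x|.
Proof.
move=> oU Up Cf; have nD := near_derive_lt spacetime_axes oU Up Cf (ltr01 : 0 < 1 :> R).
have nU : \forall z \near p0, U z by exact: open_nbhs_nbhs.
have /nbhs_ballP[r0 /= r00 rP] : \forall z \near p0, U z /\
    (forall i, `|'D_(spacetime_axes i) f z - 'D_(spacetime_axes i) f p0| < 1).
  exact: (filterI nU nD).
pose C := \sum_i `|'D_(spacetime_axes i) f p0| + 1.
have C0 : 0 <= C by rewrite addr_ge0// sumr_ge0.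
exists (3%:R * C); first by rewrite mulr_ge0.
near=> r => x y xr yr.
have sub : ball p0 r `<=` ball p0 r0 by apply: le_ball; apply: ltW; near: r;
  exact: nbhs_right_lt.
apply: (lipschitz_frame frame_spacetime (@seg_closed_ball _ _ p0 r)) => //.
- by move=> z /sub /rP[Uz _]; exact: Cn_diff Cf Uz.
move=> z i /sub /rP[_ /(_ i) h].
rewrite -[X in `|X|](subrK ('D_(spacetime_axes i) f p0)) addrC.
apply: le_trans (ler_normD _ _) _; apply: lerD; last exact: ltW.
by rewrite (bigD1 i)//= lerDl sumr_ge0.
Unshelve. all: by end_near. Qed.

Lemma local_lipschitz2 (U : set S) (F : S -> plane R) p0 : open U -> U p0 -> Cn 1 U F ->
  exists2 L, 0 <= L & \forall r \near (0 : R)^'+, forall x y, ball p0 r x -> ball p0 r y ->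
    `|F y - F x| <= L * `|y - x|.
Proof.
move=> oU Up CF; have [C1 C2] := Cn_components oU CF.
have [L1 L10 H1] := local_lipschitz1 oU Up C1;
  have [L2 L20 H2] := local_lipschitz1 oU Up C2.
exists (L1 + L2); first by rewrite addr_ge0.
apply: filterS2 H1 H2 => r h1 h2 x y xr yr; rewrite pair_normP mulrDl; apply/andP; split.
  by apply: le_trans (h1 x y xr yr) _; rewrite lerDl mulr_ge0.
by apply: le_trans (h2 x y xr yr) _; rewrite lerDr mulr_ge0.
Qed.

Lemma iter_derive_Cn (Y : normedModType R) (U : set S) (F : S -> Y) s :
  (forall n, Cn n U F) -> forall n, Cn n U (iter_derive s F).
Proof. by move=> CF; elim: s => [|v s IHs] n //=; exact: Cn_derive. Qed.

Lemma iter_derive_add (U : set S) (F G : S -> plane R) s p :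
  open U -> (forall n, Cn n U F) -> (forall n, Cn n U G) -> U p ->
  iter_derive s (fun q => F q + G q) p = iter_derive s F p + iter_derive s G p.
Proof.
move=> oU CF CG; elim: s p => [|v s IHs] p Up //=.
have -> : 'D_v (iter_derive s (fun q => F q + G q)) p =
  'D_v (iter_derive s F + iter_derive s G) p.
  by apply: near_eq_derive; apply: filterS (open_nbhs_nbhs (conj oU Up)) => q; exact: IHs.
by rewrite deriveD//; apply: diff_derivable; exact: Cn_diff (iter_derive_Cn _ _ 0) Up.
Qed.

Section Combination.
Variables (a : 'I_5 -> plane R).
Definition combination (chi : 'I_5 -> S -> R) (p : S) : plane R := \sum_l chi l p *: a l.

Lemma derive_combination chi v p : (forall l, differentiable (chi l) p) ->
  differentiable (combination chi) p /\
  'D_v (combination chi) p = combination (fun l => 'D_v (chi l)) p.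
Proof.
move=> dchi; have E : combination chi = \sum_l (fun p => chi l p *: a l).
  by apply/funext => q; rewrite fct_sumE.
have d l : differentiable (fun p => chi l p *: a l) p by exact: differentiableZl.
rewrite E; split; first exact: differentiable_sum.
rewrite derive_sum; last by move=> l; exact: diff_derivable.
apply: eq_bigr => l _; rewrite (deriveE v (d l)) (deriveE v (dchi l)).
by rewrite diffZl.
Qed.

Lemma Cn_combination chi : (forall l n, Cn n setT (chi l)) ->
  forall n, Cn n setT (combination chi).
Proof.
move=> Cchi n; elim: n chi Cchi => [|n IHn] chi Cchi.
  by split=> // p _;
    have [] := @derive_combination chi 0 p (fun l => Cn_diff (Cchi l 0%N) I).
split=> [p _|v];
  first by have [] := @derive_combination chi 0 p (fun l => Cn_diff (Cchi l 0%N) I).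
have -> : 'D_v (combination chi) = combination (fun l => 'D_v (chi l)).
  by apply/funext => p;
    have [] := @derive_combination chi v p (fun l => Cn_diff (Cchi l 0%N) I).
by apply: IHn => l m; exact: Cn_derive.
Qed.

Lemma iter_derive_combination chi s : (forall l n, Cn n setT (chi l)) ->
  iter_derive s (combination chi) = combination (fun l => iter_derive s (chi l)).
Proof.
move=> Cchi; elim: s => [|v s IHs] //=; rewrite IHs; apply/funext => p.
have [//|_ ->//] := @derive_combination (fun l => iter_derive s (chi l)) v p.
by move=> l; exact: (Cn_diff (iter_derive_Cn s (Cchi l) 0%N)).
Qed.
End Combination.

(** An induction on the order, applied to the derivatives in the three directions of
    [axes]. *)
Lemma iter_derive_bound (K : set S) (f : S -> R) r : compact K -> (forall n, Cn n setT f) ->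
  exists2 B, 0 <= B & forall s, {subset s <= axes} -> (size s <= r)%N -> forall p, K p ->
    `|iter_derive s f p| <= B.
Proof.
move=> cK; elim: r f => [|r IHr] f Cf.
  have [B B0 HB] :=
    compact_bound cK (fun p _ => differentiable_continuous (Cn_diff (Cf 0%N) (I : setT p))).
  by exists B; [exact: ltW | case=> // _ _ p Kp; exact: HB].
have [B B0 HB] :=
  compact_bound cK (fun p _ => differentiable_continuous (Cn_diff (Cf 0%N) (I : setT p))).
have [C C0 HC] : exists2 C, 0 <= C & forall i : 'I_3, forall s, {subset s <= axes} ->
  (size s <= r)%N ->
    forall p, K p -> `|iter_derive s ('D_(spacetime_axes i) f) p| <= C.
  apply: (@family_bound _ _ (fun i C => forall s, {subset s <= axes} -> (size s <= r)%N ->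
    forall p, K p -> `|iter_derive s ('D_(spacetime_axes i) f) p| <= C)).
    by move=> i C C' CC' h s s1 s2 p Kp; apply: le_trans (h s s1 s2 p Kp) CC'.
  by move=> i; apply: IHr => n; exact: Cn_derive.
exists (B + C); first by rewrite addr_ge0// ltW.
elim/last_ind => [_ _ p Kp|s v _ sv]; first by apply: le_trans (HB p Kp) _; rewrite lerDl.
rewrite size_rcons ltnS => sr p Kp; rewrite iter_derive_rcons.
have vP : v \in axes by apply: sv; rewrite mem_rcons in_cons eqxx.
have sP : {subset s <= axes} by move=> w ws; apply: sv; rewrite mem_rcons in_cons ws orbT.
have [i ->] : exists i, v = spacetime_axes i.
  move: vP; rewrite /axes !inE => /or3P[] /eqP ->; [exists 0|exists 1|exists 2] => //.
by apply: le_trans (HC i s sP sr p Kp) _; rewrite lerDr ltW.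
Qed.

End LocalLipschitz.

(** * Lipschitz dependence of degenerate jets on their parameters *)

Section BoxLipschitz.
Context {R : realType}.
Variable (B : R).
Notation U := ('I_9 -> R).
Implicit Types (f g : U -> R) (u : U).

(** The constant also bounds [f] itself; otherwise products would not be Lipschitz. *)
Definition box_lipschitz f := exists2 C, 0 <= C & forall u u' d,
  (forall i, `|u i| <= B) -> (forall i, `|u' i| <= B) -> (forall i, `|u i - u' i| <= d) ->
  `|f u| <= C /\ `|f u - f u'| <= C * d.

Lemma box_lipschitz_proj i : box_lipschitz (fun u => u i).
Proof.
exists (`|B| + 1) => [|u u' d uB u'B ud]; first by rewrite addr_ge0.
have d0 : 0 <= d by apply: le_trans (ud i).
split; first by apply: le_trans (uB i) _; apply: le_trans (ler_norm _) _; rewrite lerDl.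
by apply: le_trans (ud i) _; rewrite mulrDl mul1r lerDr mulr_ge0.
Qed.

Lemma box_lipschitz_cst c : box_lipschitz (fun _ => c).
Proof.
exists `|c| => // u u' d uB u'B ud; rewrite subrr normr0; split=> //.
by rewrite mulr_ge0// (le_trans _ (ud ord0)).
Qed.

Lemma box_lipschitz_add f g : box_lipschitz f -> box_lipschitz g ->
  box_lipschitz (fun u => f u + g u).
Proof.
move=> [C C0 HC] [D D0 HD]; exists (C + D) => [|u u' d uB u'B ud]; first exact: addr_ge0.
have [f1 f2] := HC _ _ _ uB u'B ud; have [g1 g2] := HD _ _ _ uB u'B ud; split.
  by apply: le_trans (ler_normD _ _) _; exact: lerD.
by rewrite opprD addrACA mulrDl; apply: le_trans (ler_normD _ _) _; exact: lerD.
Qed.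

Lemma box_lipschitz_mul f g : box_lipschitz f -> box_lipschitz g ->
  box_lipschitz (fun u => f u * g u).
Proof.
move=> [C C0 HC] [D D0 HD]; exists (2 * (C * D)) => [|u u' d uB u'B ud];
  first by rewrite !mulr_ge0.
have [f1 f2] := HC _ _ _ uB u'B ud; have [g1 g2] := HD _ _ _ uB u'B ud.
have [g1' _] := HD _ _ d u'B uB (fun i => eq_ind_r (fun x => x <= d) (ud i) (distrC _ _)).
have CD : 0 <= C * D by rewrite mulr_ge0.
have d0 : 0 <= d by apply: le_trans (ud ord0).
split.
  rewrite normrM; apply: (@le_trans _ _ (C * D)); first exact: ler_pM.
  by rewrite ler_peMl// ler1n.
have -> : f u * g u - f u' * g u' = f u * (g u - g u') + (f u - f u') * g u' by ring.
apply: le_trans (ler_normD _ _) _; rewrite !normrM.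
have -> : 2 * (C * D) * d = C * (D * d) + (C * d) * D by ring.
by apply: lerD; apply: ler_pM.
Qed.

Lemma box_lipschitz_min f : box_lipschitz f -> box_lipschitz (fun u => Num.min 1 (f u)).
Proof.
move=> [C C0 HC]; exists (C + 1) => [|u u' d uB u'B ud]; first by rewrite addr_ge0.
have [f1 f2] := HC _ _ _ uB u'B ud; have d0 : 0 <= d by apply: le_trans (ud ord0).
split.
  by have [h|h] := leP 1 (f u); [rewrite normr1 lerDr | apply: le_trans f1 _;
    rewrite lerDl].
apply: (@le_trans _ _ `|f u - f u'|); last first.
  by apply: le_trans f2 _; rewrite mulrDl mul1r lerDl.
have h1 := ler_norm (f u - f u'); have h2 := ler_norm (- (f u - f u'));
  rewrite normrN in h2.
rewrite ler_norml; have [h|h] := leP 1 (f u); have [h'|h'] := leP 1 (f u');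
  by apply/andP; split; lra.
Qed.

Definition par u k : R := u (inord k).

(** The jets of [bad_jet] together with the value 0 of the function, as functions of the
    last six of nine parameters. The first three are reserved for the point, see
    [param_point]. *)
Definition param_jet u (i : 'I_5) : plane R :=
  let a := (dir (par u 3)).1 in let b := (dir (par u 3)).2 in
  let e := dir (par u 4) in let s := par u 5 in let t := par u 6 in
  let q := (par u 7, par u 8) in
  nth 0 [:: 0; (s * a) *: e; (s * b) *: e;
    (t * (a ^+ 2 - b ^+ 2)) *: e - (2 * a * b) *: q;
    (t * (2 * a * b)) *: e + (a ^+ 2 - b ^+ 2) *: q] i.

Lemma box_lipschitz_param_jet i :
  box_lipschitz (fun u => (param_jet u i).1) /\ box_lipschitz (fun u => (param_jet u i).2).
Proof.
have P k : box_lipschitz (fun u => par u k) by exact: box_lipschitz_proj.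
have Ocst c := box_lipschitz_cst c.
have Neg f : box_lipschitz f -> box_lipschitz (fun u => - f u).
  move=> Hf; have := box_lipschitz_mul (Ocst (-1)) Hf.
  by rewrite (_ : (fun u => _) = (fun u => - f u)) //; apply/funext => u; rewrite mulN1r.
have D1 k : box_lipschitz (fun u => (dir (par u k)).1).
  by apply: box_lipschitz_min; apply: box_lipschitz_add => //; exact: Neg.
have D2 k : box_lipschitz (fun u => (dir (par u k)).2) by exact: box_lipschitz_min.
pose a u := (dir (par u 3)).1; pose b u := (dir (par u 3)).2.
pose e1 u := (dir (par u 4)).1; pose e2 u := (dir (par u 4)).2.
pose ab u := a u ^+ 2 - b u ^+ 2; pose ba u := 2 * a u * b u.
have La : box_lipschitz a by exact: D1.
have Lb : box_lipschitz b by exact: D2.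
have Le1 : box_lipschitz e1 by exact: D1.
have Le2 : box_lipschitz e2 by exact: D2.
have Lab : box_lipschitz ab.
  apply: box_lipschitz_add; first exact: (box_lipschitz_mul La La).
  by apply: Neg; exact: (box_lipschitz_mul Lb Lb).
have Lba : box_lipschitz ba by
  exact: (box_lipschitz_mul (box_lipschitz_mul (Ocst 2) La) Lb).
case: i => [[|[|[|[|[|//]]]]] i5]; rewrite /param_jet /=.
- by split; exact: Ocst.
- by split; apply: box_lipschitz_mul => //; apply: box_lipschitz_mul.
- by split; apply: box_lipschitz_mul => //; apply: box_lipschitz_mul.
- split; (apply: box_lipschitz_add; last apply: Neg); apply: box_lipschitz_mul => //;
    exact: box_lipschitz_mul.
- by split; apply: box_lipschitz_add; apply: box_lipschitz_mul => //;
    exact: box_lipschitz_mul.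
Qed.

Lemma param_jet_lipschitz : exists2 C, 0 <= C & forall i u u' d,
  (forall i, `|u i| <= B) -> (forall i, `|u' i| <= B) -> (forall i, `|u i - u' i| <= d) ->
  `|param_jet u i - param_jet u' i| <= C * d.
Proof.
apply: (@family_bound _ _ (fun i C => forall u u' d,
  (forall i, `|u i| <= B) -> (forall i, `|u' i| <= B) -> (forall i, `|u i - u' i| <= d) ->
  `|param_jet u i - param_jet u' i| <= C * d)).
  move=> i C C' CC' h u u' d uB u'B ud; apply: le_trans (h u u' d uB u'B ud) _.
  by rewrite ler_wpM2r// (le_trans _ (ud ord0)).
move=> i; have [[C C0 HC] [D D0 HD]] := box_lipschitz_param_jet i.
exists (C + D) => [|u u' d uB u'B ud]; first exact: addr_ge0.
have [_ h1] := HC _ _ _ uB u'B ud; have [_ h2] := HD _ _ _ uB u'B ud.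
have d0 : 0 <= d by apply: le_trans (ud ord0).
rewrite pair_normP mulrDl; apply/andP; split.
  by apply: le_trans h1 _; rewrite lerDl mulr_ge0.
by apply: le_trans h2 _; rewrite lerDr mulr_ge0.
Qed.

End BoxLipschitz.

(** * Perturbations without degenerate zeros *)

Section Perturbation.
Context {R : realType}.
Notation S := (spacetime R).

Lemma Cn_fst_comp (h : plane R -> R) n : (forall n, Cn n setT h) ->
  Cn n setT (fun p : S => h p.1).
Proof.
have D (k : plane R -> R) (p : S) : (forall n, Cn n setT k) ->
  differentiable (fun p : S => k p.1) p.
  move=> Ck; apply: (differentiable_comp (f := fst));
    first by have [] := differentiable_fst p.
  exact: (Cn_diff (Ck 0%N) I).
elim: n h => [|n IHn] h Ch; first by split=> // p _; exact: D.
split=> [p _|v]; first exact: D.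
have -> : 'D_v (fun p : S => h p.1) = fun p => ('D_(v.1) h) p.1 by [].
by apply: (IHn ('D_(v.1) h)) => m; exact: Cn_derive.
Qed.

Definition helmholtz_op (k : R) (F : S -> plane R) (p : S) : plane R :=
  'D_X_dir ('D_X_dir F) p + 'D_Y_dir ('D_Y_dir F) p + k ^+ 2 *: F p.

Lemma slice_helmholtz k F z l :
  'D_e_x ('D_e_x (fun z => F (z, l))) z + 'D_e_y ('D_e_y (fun z => F (z, l))) z
   + k ^+ 2 *: F (z, l) = helmholtz_op k F (z, l).
Proof.
have E v : 'D_v ('D_v (fun z => F (z, l))) z = 'D_((v, 0) : S) ('D_((v, 0) : S) F) (z, l).
  by rewrite (slice_derive F l v); exact: slice_derivez.
exact: (congr2 (fun a b => a + b + k ^+ 2 *: F (z, l)) (E e_x) (E e_y)).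
Qed.

(** The derivatives that make up the 2-jet. *)
Definition jet_dirs (i : 'I_5) : seq S :=
  nth [::] [:: [::]; [:: X_dir]; [:: Y_dir]; [:: X_dir; X_dir]; [:: X_dir; Y_dir]] i.

Lemma jet_dirs_basis (z0 : plane R) (chi : 'I_5 -> plane R -> R) (l0 : R) :
  (forall l : 'I_5, jet2 z0 (chi l) = ((l == 0 :> nat)%:R, (l == 1 :> nat)%:R,
    (l == 2 :> nat)%:R, (l == 3 :> nat)%:R, (l == 4 :> nat)%:R)) ->
  forall i l, iter_derive (jet_dirs i) (fun p : S => chi l p.1) (z0, l0) = (i == l)%:R.
Proof.
move=> J i l; have [h0 h1 h2 h3 h4] := J l; rewrite -val_eqE eq_sym.
case: i => [[|[|[|[|[|//]]]]] i5]; rewrite /jet_dirs /=;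
  [exact: h0|exact: h1|exact: h2|exact: h3|exact: h4].
Qed.

Definition coefs (a : 'I_5 * bool -> R) (l : 'I_5) : plane R := (a (l, true), a (l, false)).
Definition param_point (u : 'I_9 -> R) : S := ((par u 0, par u 1), par u 2).

Lemma norm_coefs a l e : (forall j, 0 <= a j <= e) -> `|coefs a l| <= e.
Proof.
move=> ae; rewrite pair_normP /=.
by have /andP[a0 a1] := ae (l, true); have /andP[b0 b1] := ae (l, false);
  rewrite !ger0_norm// a1.
Qed.

Lemma norm_combination (a : 'I_5 -> plane R) (f : 'I_5 -> R) c e :
  (forall l, `|f l| <= c) -> (forall l, `|a l| <= e) -> `|\sum_l f l *: a l| <= 5 * (c * e).
Proof.
move=> fc ae; apply: le_trans (ler_norm_sum _ _ _) _.
have h l : `|f l *: a l| <= c * e by rewrite normrZ ler_pM.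
apply: le_trans (ler_sum _ (fun l _ => h l)) _.
by rewrite sumr_const card_ord mulr_natl.
Qed.

End Perturbation.

Section Generic.
Context {R : realType}.
Notation S := (spacetime R).
Variables (U : set S) (Psi : S -> plane R) (chi : 'I_5 -> S -> R) (p0 : S).
Hypotheses (oU : open U) (Up0 : U p0) (CPsi : forall n, Cn n U Psi)
  (Cchi : forall l n, Cn n setT (chi l)).
Hypothesis chi0 : forall i l, iter_derive (jet_dirs i) (chi l) p0 = (i == l)%:R.

Let j p i := iter_derive (jet_dirs i) Psi p.
Let M p i l := iter_derive (jet_dirs i) (chi l) p.

(** The jets of [Psi] and of the [chi l] are Lipschitz near [p0], and the jets of the
    [chi l] form the identity matrix at [p0]. *)
Lemma good_neighbourhood : exists r L, [/\ 0 < r, r <= 1, 0 <= L, ball p0 r `<=` U &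
  forall x y, ball p0 r x -> ball p0 r y -> [/\ forall i, `|j y i - j x i| <= L * `|y - x|,
    forall i l, `|M y i l - M x i l| <= L * `|y - x| &
      forall i l, `|M x i l - (i == l)%:R| <= 10^-1]].
Proof.
have [L1 L10 H1] : exists2 L, 0 <= L & forall i, \forall r \near (0 : R)^'+,
    forall x y, ball p0 r x -> ball p0 r y -> `|j y i - j x i| <= L * `|y - x|.
  apply: (@family_bound _ _ (fun i L => \forall r \near (0 : R)^'+,
    forall x y, ball p0 r x -> ball p0 r y -> `|j y i - j x i| <= L * `|y - x|)).
    move=> i C C' CC'; apply: filterS => r h x y xr yr; apply: le_trans (h x y xr yr) _.
    by rewrite ler_wpM2r.
  by move=> i; apply: (local_lipschitz2 oU Up0); exact: (iter_derive_Cn _ CPsi 1%N).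
have [L2 L20 H2] : exists2 L, 0 <= L & forall il : 'I_5 * 'I_5, \forall r \near (0 : R)^'+,
    forall x y, ball p0 r x -> ball p0 r y -> `|M y il.1 il.2 - M x il.1 il.2| <=
      L * `|y - x|.
  apply: (@family_bound _ _ (fun il L => \forall r \near (0 : R)^'+,
    forall x y, ball p0 r x -> ball p0 r y -> `|M y il.1 il.2 - M x il.1 il.2| <=
      L * `|y - x|)).
    move=> il C C' CC'; apply: filterS => r h x y xr yr; apply: le_trans (h x y xr yr) _.
    by rewrite ler_wpM2r.
  by move=> il; apply: (local_lipschitz1 openT I);
    exact: (iter_derive_Cn _ (Cchi il.2) 1%N).
have G1 : \forall r \near (0 : R)^'+, forall i, forall x y, ball p0 r x -> ball p0 r y ->
  `|j y i - j x i| <= L1 * `|y - x|.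
  exact: filter_forall H1.
have G2 : \forall r \near (0 : R)^'+, forall il, forall x y, ball p0 r x -> ball p0 r y ->
  `|M y il.1 il.2 - M x il.1 il.2| <= L2 * `|y - x|.
  exact: filter_forall H2.
have /nbhs_ballP[r0 /= r00 rU] := open_nbhs_nbhs (conj oU Up0).
have e0 : 0 < 10^-1 / (L2 + 1) :> R by rewrite divr_gt0// ltr_pwDr.
(* The last bound on r keeps the jets of the chi l within 1/10 of the identity. *)
have [r [r_gt0 [[g1 g2] [r1 [rr0 re]]]]] : exists r : R, 0 < r /\ (
   ((forall i, forall x y, ball p0 r x -> ball p0 r y ->
     `|j y i - j x i| <= L1 * `|y - x|) /\
    (forall il, forall x y, ball p0 r x -> ball p0 r y ->
      `|M y il.1 il.2 - M x il.1 il.2| <= L2 * `|y - x|)) /\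
   (r < 1 /\ (r < r0 /\ r < 10^-1 / (L2 + 1)))).
  apply: (@filter_ex _ (0 : R)^'+).
  exact: (filterI (nbhs_right_gt _) (filterI (filterI G1 G2) (filterI (nbhs_right_lt ltr01)
    (filterI (nbhs_right_lt r00) (nbhs_right_lt e0))))).
exists r, (L1 + L2); split=> //; first exact: ltW.
- exact: addr_ge0.
- by apply: subset_trans rU; apply: le_ball; exact: ltW.
move=> x y xr yr; split.
- by move=> i; apply: le_trans (g1 i x y xr yr) _; rewrite mulrDl lerDl mulr_ge0.
- by move=> i l; apply: le_trans (g2 (i, l) x y xr yr) _; rewrite mulrDl lerDr mulr_ge0.
move=> i l; rewrite -chi0; have := g2 (i, l) p0 x (ballxx _ r_gt0) xr; rewrite /= => h.
apply: le_trans h _; have xp : `|x - p0| <= r by move: xr;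
  rewrite -ball_normE /= distrC => /ltW.
apply: (@le_trans _ _ ((L2 + 1) * r)); first by apply: ler_pM => //; rewrite lerDl.
by rewrite mulrC -ler_pdivlMr ?ltr_pwDr//; exact: ltW.
Qed.

(** A choice of coefficients [a] is bad for [u] if the perturbed family has at
    [param_point u] the degenerate jet [param_jet u]. By [coefficient_lipschitz], [u]
    determines [a] in a Lipschitz way, so [exists_not_covered] applies with nine
    parameters against ten coefficients. The ball and the bound [m] on the jets are the
    same for all [e]. *)
Lemma avoid_bad_jets : exists r m,
  [/\ 0 < r, r <= 1, ball p0 r `<=` U & forall e, 0 < e -> e <= 1 ->
  exists2 a : 'I_5 * bool -> R, forall jj, 0 <= a jj <= e &
   forall p, ball p0 r p -> let J i := j p i + \sum_l M p i l *: coefs a l in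
     (forall i, `|J i| <= m) /\
     forall u, (forall i, `|u i| <= 3 * m + (`|p0| + 4)) -> param_point u = p ->
      ~ forall i, J i = param_jet u i].
Proof.
have [r [L [r0 r1 L0 rU H]]] := good_neighbourhood.
have [jm jm0 jP] : exists2 C, 0 <= C & forall i, `|j p0 i| <= C.
  apply: (@family_bound _ _ (fun i C => `|j p0 i| <= C)); last by move=> i;
    exists `|j p0 i|.
  by move=> i C C' CC' h; exact: le_trans CC'.
(* The perturbation contributes at most 5 times 2 to the jet; the bound B below covers
   the six parameters of a degenerate jet bounded by m and the coordinates of a point
   near p0. *)
pose m := jm + L + 10; have m0 : 0 < m by rewrite /m ltr_pwDr// addr_ge0.
pose B := 3 * m + (`|p0| + 4).
have B0 : 0 < B by rewrite /B ltr_pwDl ?mulr_gt0// addr_ge0.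
have [CP CP0 PP] := @param_jet_lipschitz R B.
pose C := 12 * (CP + L + 1); have C0 : 0 < C by rewrite mulr_gt0// ltr_pwDr// addr_ge0.
exists r, m; split=> // e e0 e1.
have dist p : ball p0 r p -> `|p - p0| <= 1.
  by rewrite -ball_normE /= distrC => h; apply: le_trans (ltW h) r1.
pose Bad (a : 'I_5 * bool -> R) (u : 'I_9 -> R) := ball p0 r (param_point u) /\
  forall i, j (param_point u) i + \sum_l M (param_point u) i l *: coefs a l = param_jet u i.
have [|a a' u u' d ae ae' uB u'B [bu Eu] [bu' Eu'] ud|a ae aP] :=
  @exists_not_covered R 'I_9 ('I_5 * bool)%type Bad B C e _ B0 C0 e0.
- by rewrite card_prod !card_ord card_bool.
- have d0 : 0 <= d by apply: le_trans (ud ord0).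
  have pd : `|param_point u - param_point u'| <= d.
    by rewrite !pair_normP /=; apply/andP; split; [apply/andP; split|]; exact: ud.
  have [hj hM _] := H _ _ bu' bu; have [_ _ MI] := H _ _ bu bu.
  have Ld : L * `|param_point u - param_point u'| <= L * d by rewrite ler_wpM2l.
  have K0 : 0 <= CP + L + 1 by rewrite !addr_ge0.
  have h :=
    @coefficient_lipschitz R (coefs a) (coefs a') (M (param_point u)) (M (param_point u'))
      ((CP + L + 1) * d) MI.
  have {h}h l : `|coefs a l - coefs a' l| <= C * d.
    rewrite /C -mulrA; apply: h => {l}.
    + move=> i l; apply: le_trans (hM i l) _; apply: le_trans Ld _.
      by rewrite ler_wpM2r// -addrA addrCA lerDl addr_ge0.
    + by move=> l; apply: le_trans (norm_coefs l ae') e1.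
    move=> i;
      have -> : \sum_l M (param_point u) i l *: coefs a l -
          \sum_l M (param_point u') i l *: coefs a' l =
        (param_jet u i - param_jet u' i) - (j (param_point u) i - j (param_point u') i).
      rewrite -Eu -Eu'; move: (\sum_l _) (\sum_l _) (j _ _) (j _ _) => s s' t t'.
      by apply: pairP => /=; ring.
    apply: le_trans (ler_normB _ _) _.
    apply: (@le_trans _ _ (CP * d + L * d)); last by rewrite !mulrDl lerDl mul1r.
    by apply: lerD; [exact: PP | exact: le_trans (hj i) Ld].
  case=> l [].
    by apply: le_trans (h l); exact: (@pair_norm1 R R R (coefs a l - coefs a' l)).
  by apply: le_trans (h l); exact: (@pair_norm2 R R R (coefs a l - coefs a' l)).
exists a => // p bp; split.
  move=> i; have [hj _ _] := H _ _ (ballxx _ r0) bp; have [_ _ MI] := H _ _ bp bp.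
  apply: le_trans (ler_normD _ _) _.
  have b1 : `|j p i| <= jm + L.
    rewrite -(subrK (j p0 i) (j p i)) addrC; apply: le_trans (ler_normD _ _) _;
      apply: lerD => //.
    by apply: le_trans (hj i) _; rewrite ler_piMr// dist.
  have b2 : `|\sum_l M p i l *: coefs a l| <= 5 * (2 * 1).
    apply: norm_combination => l; last by apply: le_trans (norm_coefs l ae) e1.
    rewrite -(subrK ((i == l)%:R) (M p i l)); apply: le_trans (ler_normD _ _) _.
    have h1 : `|(i == l)%:R : R| <= 1 by case: (i == l); rewrite ?normr1 ?normr0.
    by have := MI i l; lra.
  by rewrite /m; lra.
move=> u uB pu EJ; apply: (aP u uB); rewrite /Bad pu; split=> //.
Qed.

End Generic.

(** * Classification of the zeros of generic families *)

Section Final.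
Context {R : realType}.
Notation S := (spacetime R).

Lemma perturbed_helmholtz (U : set S) (k : R) (Psi : S -> plane R)
    (chi : 'I_5 -> plane R -> R) (a : 'I_5 -> plane R) p :
  open U -> (forall n, Cn n U Psi) -> (forall l n, Cn n setT (chi l)) -> U p ->
  (forall l z,
    'D_e_x ('D_e_x (chi l)) z + 'D_e_y ('D_e_y (chi l)) z + k ^+ 2 * chi l z = 0) ->
  helmholtz_op k (fun p => Psi p + combination a (fun l p => chi l p.1) p) p =
    helmholtz_op k Psi p.
Proof.
move=> oU CPsi Cchi0 Up Hchi; pose c l (p : S) := chi l p.1.
have Cchi l n : Cn n setT (c l) := Cn_fst_comp n (Cchi0 l).
have CQ n : Cn n U (combination a c) by apply: Cn_sub (Cn_combination a Cchi n) => q _.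
have D v : 'D_v ('D_v (fun p => Psi p + combination a c p)) p =
   'D_v ('D_v Psi) p + combination a (fun l => 'D_v ('D_v (c l))) p.
  apply: etrans (iter_derive_add [:: v; v] oU CPsi CQ Up) _.
  exact: (congr1 (fun G => 'D_v ('D_v Psi) p + G p)
    (iter_derive_combination a [:: v; v] Cchi)).
have -> : helmholtz_op k (fun p => Psi p + combination a c p) p =
    'D_X_dir ('D_X_dir Psi) p + combination a (fun l => 'D_X_dir ('D_X_dir (c l))) p +
    ('D_Y_dir ('D_Y_dir Psi) p + combination a (fun l => 'D_Y_dir ('D_Y_dir (c l))) p) +
    k ^+ 2 *: (Psi p + combination a c p).
  exact: (congr2 (fun x y => x + y + k ^+ 2 *: (Psi p + combination a c p))
    (D X_dir) (D Y_dir)).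
rewrite /helmholtz_op scalerDr.
have alg (A B P x y z : plane R) : x + y + z = 0 -> A + x + (B + y) + (P + z) = A + B + P.
  by move=> E; rewrite (addrACA A x) (addrACA (A + B)) E addr0.
apply: alg; rewrite /combination scaler_sumr -!big_split /= big1// => l _.
by rewrite scalerA -!scalerDl (Hchi l p.1) scale0r.
Qed.

(** Since [psi = 0] at [p], the Helmholtz equation reduces there to the vanishing of the
    Laplacian. A zero which is neither regular nor hyperbolic then has a degenerate jet,
    and [bad_jet] provides its parameters in the box that is excluded. *)
Lemma far_from_bad_jets (V : set S) (k : R) (Psi : S -> plane R) p m q :
  open V -> V p -> (forall n, Cn n V Psi) -> helmholtz_op k Psi p = 0 -> Psi p = 0 ->
  `|p| <= q + 1 ->
  (forall i, `|iter_derive (jet_dirs i) Psi p| <= m) ->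
  (forall u, (forall i, `|u i| <= 3 * m + (q + 4)) -> param_point u = p ->
      ~ forall i, iter_derive (jet_dirs i) Psi p = param_jet u i) ->
  radially_equivalent_at Psi p regular_singularity \/
  radially_equivalent_at Psi p hyperbolic_singularity.
Proof.
move=> oV Vp CPsi H P0 pq Jm Jbad.
have lap : 'D_X_dir ('D_X_dir Psi) p + 'D_Y_dir ('D_Y_dir Psi) p = 0.
  by move: H; rewrite /helmholtz_op P0 scaler0 addr0.
have [|/=|[d0 E]] := jet_classification oV Vp CPsi P0 lap; [by left | by right | exfalso].
have [c [e [s [t [w [[cP eP sm tm wm] [E1 E2 E3 E4]]]]]]] :=
  bad_jet (Jm 1) (Jm 2) (Jm 3) (Jm 4) d0 E.
pose us : seq R := [:: p.1.1; p.1.2; p.2; c; e; s; t; w.1; w.2].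
pose u (i : 'I_9) := nth 0 us i.
have uE i : (i < 9)%N -> par u i = nth 0 us i by move=> i9; rewrite /par /u inordK.
have u0 : par u 0 = p.1.1 := uE 0 isT; have u1 : par u 1 = p.1.2 := uE 1 isT.
have u2 : par u 2 = p.2 := uE 2 isT; have u3 : par u 3 = c := uE 3 isT.
have u4 : par u 4 = e := uE 4 isT; have u5 : par u 5 = s := uE 5 isT.
have u6 : par u 6 = t := uE 6 isT; have u7 : par u 7 = w.1 := uE 7 isT.
have u8 : par u 8 = w.2 := uE 8 isT.
have m0 : 0 <= m by apply: le_trans (Jm 0).
have q0 : 0 <= q + 1 by apply: le_trans pq.
apply: (Jbad u).
- have w1 := le_trans (pair_norm1 w) wm; have w2 := le_trans (pair_norm2 w) wm.
  have p1 := le_trans (pair_norm1 p) pq; have p2 := le_trans (pair_norm2 p) pq.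
  have p11 := le_trans (pair_norm1 p.1) p1; have p12 := le_trans (pair_norm2 p.1) p1.
  have c3 : `|c| <= 3 by move: cP => /andP[? ?]; rewrite ler_norml; apply/andP; split; lra.
  have e3 : `|e| <= 3 by move: eP => /andP[? ?]; rewrite ler_norml; apply/andP; split; lra.
  have hq : q + 1 <= 3 * m + (q + 4) by lra.
  have h3 : 3 <= 3 * m + (q + 4) by lra.
  have hm : m <= 3 * m + (q + 4) by lra.
  have h3m : 3 * m <= 3 * m + (q + 4) by lra.
  case=> [[|[|[|[|[|[|[|[|[|//]]]]]]]]] i9]; rewrite /u /=.
  + exact: le_trans p11 hq.
  + exact: le_trans p12 hq.
  + exact: le_trans p2 hq.
  + exact: le_trans c3 h3.
  + exact: le_trans e3 h3.
  + exact: le_trans sm hm.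
  + exact: le_trans tm h3m.
  + exact: le_trans w1 h3m.
  exact: le_trans w2 h3m.
- by rewrite /param_point u0 u1 u2 -!surjective_pairing.
move=> i; rewrite /param_jet u3 u4 u5 u6 u7 u8; clear u0 u1 u2 u3 u4 u5 u6 u7 u8 uE.
case: i => [[|[|[|[|[|//]]]]] i5] /=.
- exact: P0.
- exact: E1.
- exact: E2.
- by rewrite -surjective_pairing; exact: E3.
- by rewrite -surjective_pairing; exact: E4.
Qed.

End Final.

Unset Implicit Arguments.

Theorem theorem3p3 (R : realType) (k : R) (hk : 0 < k) :
  holds_generically k (fun (Psi : spacetime R -> plane R) (p : spacetime R) =>
    Psi p = 0 ->
    radially_equivalent_at Psi p regular_singularity \/
    radially_equivalent_at Psi p hyperbolic_singularity).
Proof.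
move=> U Psi p0 oU Up0 [sPsi hPsi].
have CPsi := (smooth_onP U Psi).1 sPsi.
have [chi0 [Cchi0 Hchi Jchi]] := helmholtz_basis p0.1 hk.
pose chi l (p : spacetime R) := chi0 l p.1.
have Cchi l n : Cn n setT (chi l) := Cn_fst_comp n (Cchi0 l).
have Hc i l : iter_derive (jet_dirs i) (chi l) p0 = (i == l)%:R.
  by have := jet_dirs_basis p0.2 Jchi i l; rewrite -surjective_pairing.
have [r [m [r0 r1 rU A]]] := avoid_bad_jets oU Up0 CPsi Cchi Hc.
have oV : open (ball p0 r) by exact: ball_open.
exists (ball p0 r); split=> //; first exact: ballxx.
move=> K n e cK KV e0.
have [B B0 HB] : exists2 B, 0 <= B & forall l, forall s, {subset s <= axes} ->
  (size s <= n)%N ->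
    forall p, K p -> `|iter_derive s (chi l) p| <= B.
  apply: (@family_bound _ _ (fun l B => forall s, {subset s <= axes} -> (size s <= n)%N ->
    forall p, K p -> `|iter_derive s (chi l) p| <= B)).
    by move=> l C C' CC' h s s1 s2 p Kp; apply: le_trans (h s s1 s2 p Kp) CC'.
  by move=> l; exact: iter_derive_bound.
have B1 : 0 < B + 1 by rewrite ltr_pwDr.
(* Each derivative of the perturbation is a sum of five terms of size at most B e1. *)
pose e1 := Num.min 1 (e / (10 * (B + 1))).
have e10 : 0 < e1 by rewrite lt_min ltr01 divr_gt0// mulr_gt0.
have e11 : e1 <= 1 by rewrite ge_min lexx.
have [a ae aP] := A e1 e10 e11.
pose Q := combination (coefs a) chi.
have CQ m' : Cn m' (ball p0 r) Q by apply: Cn_sub (Cn_combination (coefs a) Cchi m') => q _.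
have CP m' : Cn m' (ball p0 r) Psi by exact: Cn_sub rU (CPsi m').
pose Psi' p := Psi p + Q p.
have CP' m' : Cn m' (ball p0 r) Psi' by exact: Cn_add.
have hz p : ball p0 r p -> helmholtz_op k Psi' p = 0.
  move=> bp; rewrite (perturbed_helmholtz (coefs a) oU CPsi Cchi0 (rU _ bp) Hchi).
  rewrite (surjective_pairing p) -slice_helmholtz; have [_] := hPsi p.2.
  by apply; rewrite /= -surjective_pairing; exact: rU.
have ID s p : ball p0 r p ->
  iter_derive s Psi' p = iter_derive s Psi p + \sum_l iter_derive s (chi l) p *: coefs a l.
  move=> bp; rewrite (iter_derive_add s oV CP CQ bp); congr (_ + _).
  exact: (congr1 (fun F => F p) (iter_derive_combination (coefs a) s Cchi)).
exists Psi'; split.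
- split; first by apply/smooth_onP.
  move=> l; split; first by apply/smooth_onP => m'; exact: Cn_slice.
  by move=> z bz; rewrite slice_helmholtz; exact: hz.
- move=> s sax sn p Kp; rewrite (ID s p (KV _ Kp)) addrC addKr.
  apply: (@le_lt_trans _ _ (5 * (B * e1))).
    by apply: norm_combination => l; [exact: HB | exact: norm_coefs].
  have h1 : e1 * (10 * (B + 1)) <= e by rewrite -ler_pdivlMr ?mulr_gt0// ge_min lexx orbT.
  have : 0 <= B * e1 by rewrite mulr_ge0// ltW.
  by move=> h2; nra.
move=> p bp P0; have [Jm Jbad] := aP p bp.
have pq : `|p| <= `|p0| + 1.
  rewrite -(subrK p0 p) addrC; apply: le_trans (ler_normD _ _) _; apply: lerD => //.
  by move: bp; rewrite -ball_normE /= distrC => h; apply: le_trans (ltW h) r1.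
apply: (far_from_bad_jets oV bp CP' (hz p bp) P0 pq).
  by move=> i; rewrite ID//; exact: Jm.
move=> u uB pu EJ; apply: (Jbad u uB pu) => i; rewrite -EJ ID//.
Qed.
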